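(* Suppose that $F:D(A^\alpha)\to H$ satisfies $F(0)=0$ and $\|F(u_1)-F(u_2)\|\le L\|A^\alpha(u_1-u_2)\|$ for all $u_1,u_2\in D(A^\alpha)$ with a constant $L>0$, and that there are $n\in\mathbb{N}$ and $k\in(0,\tfrac12)$ such that $$\lambda_{n+1}-\lambda_n\ \ge\ \frac{2L}{k}\left(\lambda_{n+1}^\alpha+\lambda_n^\alpha+c_\alpha(\lambda_{n+1}-\lambda_n)^\alpha\right).$$ Put $\mu=\lambda_n+\frac{2L}{k}\lambda_n^\alpha$. If $g:\mathbb{R}\to D(A^\alpha)$, $g\in L^2_{loc}(\mathbb{R},D(A^\alpha))$, is periodic with period $T>0$, then the cocycle $\Phi$ generated by $\frac{du}{dt}+Au=F(u)+g(t)+\frac{dW}{dt}$ has a pathwise periodic random inertial manifold with period $T$, $\widetilde{\mathcal M}=\{\widetilde{\mathcal M}(\tau,\omega):\tau\in\mathbb{R},\omega\in\Omega\}$, given by $$\widetilde{\mathcal M}(\tau,\omega)=\{x+z(\omega)+m(\tau,\omega)(x):x\in P_nH\}=\mathcal M(\tau,\omega)+z(\omega).$$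
   Context: Setting. $H$ is a separable Hilbert space with norm $\|\cdot\|$, and $A:D(A)\subseteq H\to H$ is a symmetric positive operator with compact inverse; $\{e_j\}_{j\ge1}$ is an orthonormal basis of $H$ with $Ae_j=\lambda_je_j$, $0<\lambda_1\le\lambda_2\le\cdots$, $\lambda_j\to\infty$. Fix $\alpha\in[0,\tfrac12)$; $D(A^\alpha)$ carries the norm $\|u\|_{D(A^\alpha)}=\|A^\alpha u\|$. $P_n$ is the orthogonal projection of $H$ onto $\mathrm{span}\{e_1,\dots,e_n\}$ and $Q_n=I-P_n$; $e^{-At}$ is defined on $P_nH$ for all $t\in\mathbb{R}$. $c_\alpha=\alpha^\alpha\int_0^\infty s^{-\alpha}e^{-s}ds$ if $\alpha>0$ and $c_\alpha=0$ if $\alpha=0$. $g^\tau(s)=g(s+\tau)$. Noise. $\Omega=\{\omega\in C(\mathbb{R},H):\omega(0)=0\}$ with the compact-open topology, $\mathcal F$ its Borel $\sigma$-algebra, $P$ the Wiener measure of a two-sided $H$-valued Wiener process $W$ with trace class covariance $Q$, and $\theta_t\omega(\cdot)=\omega(\cdot+t)-\omega(t)$. $z:\Omega\to D(A^\alpha)$ is the unique stationary solution of $dz(\theta_t\omega)+Az(\theta_t\omega)\,dt=dW$, taken in a version for which, for every $\omega$, $t\mapsto z(\theta_t\omega)$ is continuous from $\mathbb{R}$ to $D(A^\alpha)$ and $\lim_{t\to-\infty}e^{ct}\|A^\alpha z(\theta_t\omega)\|=0$ for every $c>0$. Solutions and cocycles. For a forcing $h\in L^2_{loc}(\mathbb{R},D(A^\alpha))$,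 $r\in\mathbb{R}$, $v_r\in D(A^\alpha)$, let $v(t)=v(t,r,\omega,h,v_r)$, $t\ge r$, be the unique mild solution in $C([r,\infty),D(A^\alpha))$ of $\frac{dv}{dt}+Av=F(v+z(\theta_t\omega))+h(t)$, $v(r)=v_r$, i.e. $v(t)=e^{-A(t-r)}v_r+\int_r^te^{-A(t-s)}(F(v(s)+z(\theta_s\omega))+h(s))\,ds$. Set $\Psi(t,\tau,\omega,v_0)=v(t,0,\omega,g^\tau,v_0)$ for $t\ge0$. With $u(t,\tau,\omega,g,u_\tau)=v(t,\tau,\omega,g,u_\tau-z(\theta_\tau\omega))+z(\theta_t\omega)$ (a mild solution of the stochastic equation), set $\Phi(t,\tau,\omega,u_0)=u(t+\tau,\tau,\theta_{-\tau}\omega,g,u_0)$; equivalently $\Phi(t,\tau,\omega,u_0)=\Psi(t,\tau,\omega,u_0-z(\omega))+z(\theta_t\omega)$. Both are continuous cocycles on $D(A^\alpha)$ over $(\Omega,\mathcal F,P,\{\theta_t\})$. The sets $\mathcal M(\tau,\omega)$ and maps $m(\tau,\omega)$. Let $\mathcal S=\{\xi\in C((-\infty,0],D(A^\alpha)):\|\xi\|_{\mathcal S}=\sup_{t\le0}e^{\mu t}\|A^\alpha\xi(t)\|<\infty\}$ and $\mathcal M(\tau,\omega)=\{\xi(0):\xi\in\mathcal S,\ v(t,r,\omega,g^\tau,\xi(r))=\xi(t)\text{ for all }r\le t\le0\}$. For $x\in P_nH$ let $\xi^*(x,\omega,\tau)$ be the unique $\xi\in\mathcal S$ with $$\xi(t)=e^{-At}x-\int_t^0e^{-A(t-s)}P_n(F(\xi(s)+z(\theta_s\omega))+g(s+\tau))ds+\int_{-\infty}^te^{-A(t-s)}Q_n(F(\xi(s)+z(\theta_s\omega))+g(s+\tau))ds,\quad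 t\le0,$$ and $m(\tau,\omega):P_nH\to Q_nD(A^\alpha)$, $m(\tau,\omega)(x)=Q_n\xi^*(x,\omega,\tau)(0)$. One has $\mathcal M(\tau,\omega)=\{x+m(\tau,\omega)(x):x\in P_nH\}$. Definition (random inertial manifold). Let $\Phi$ be a cocycle on a separable Banach space $X$ (here $X=D(A^\alpha)$). A family $\mathcal N=\{\mathcal N(\tau,\omega)\}$ of subsets of $X$, measurable in $\omega$ for each fixed $\tau$ (in the usual sense of closed random sets), is a random inertial manifold of $\Phi$ if: (i) there is a finite-dimensional subspace $X_1$ with $X=X_1\oplus X_2$ and a mapping $q:\mathbb{R}\times\Omega\times X_1\to X_2$ with $\mathcal N(\tau,\omega)=\{x+q(\tau,\omega)(x):x\in X_1\}$ for all $\tau,\omega$, where $q(\tau,\omega)(x)$ is measurable in $\omega$ and Lipschitz continuous in $x$; (ii) $\Phi(t,\tau,\omega,\mathcal N(\tau,\omega))=\mathcal N(\tau+t,\theta_t\omega)$ for all $t\ge0$, $\tau$, $\omega$; (iii) for all $\tau,\omega$ and $x\in X$ there is $y=y(\tau,\omega,x)\in\mathcal N(\tau,\omega)$ such that $\|\Phi(t,\tau,\omega,x)-\Phi(t,\tau,\omega,y)\|_X\le c_1e^{-c_2t}$ for all $t\ge0$, with positive numbers $c_1,c_2$ depending on $\tau,\omega,x$. A random inertial manifold $\mathcal N$, given as the graph of $q$ as in (i), is pathwise periodic with period $T>0$ if $q(\tau+T,\omega)(x)=q(\tau,\omega)(x)$ for all $\tau\in\mathbb{R}$, $\omega\in\Omega$,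 $x\in X_1$. *)

(* Defs.v *)
From HB Require Import structures.
From mathcomp Require Import all_boot all_order all_algebra.
From mathcomp Require Import all_classical all_reals all_analysis.
From mathcomp Require Import ring.

Set Implicit Arguments.
Unset Strict Implicit.
Unset Printing Implicit Defensive.

Import Order.TTheory GRing.Theory Num.Theory.
Import numFieldNormedType.Exports.

Local Open Scope classical_set_scope.
Local Open Scope ring_scope.

HB.mixin Record CompleteNormedModule_isHilbert (R : realType) H
    & CompleteNormedModule R H := {
  dot : H -> H -> R;
  dot_linearl : forall (a : R) (u v w : H),
    dot (a *: u + v) w = a * dot u w + dot v w;
  dotC : forall u v : H, dot u v = dot v u;
  dot_norm : forall u : H, dot u u = `|u| ^+ 2;
}.

#[short(type="hilbertType")]
HB.structure Definition Hilbert (R : realType) :=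
  {H of CompleteNormedModule R H & CompleteNormedModule_isHilbert R H}.

Definition separable (T : topologicalType) : Prop :=
  exists2 D : set T, countable D & dense D.

Definition borel (T : ptopologicalType) := g_sigma_algebraType (@open T).

Section operator.
Context {R : realType}.

(* `eigval A j` and `eigvec A j` stand for lambda_(j+1) and e_(j+1). *)
Record posOperator (H : hilbertType R) := PosOperator {
  opdom : set H;
  op : H -> H;
  opdom0 : opdom 0;
  opdomP : forall (a : R) u v, opdom u -> opdom v -> opdom (a *: u + v);
  op_linear : forall (a : R) u v, opdom u -> opdom v ->
    op (a *: u + v) = a *: op u + op v;
  op_sym : forall u v, opdom u -> opdom v -> dot (op u) v = dot u (op v);
  op_pos : forall u, opdom u -> u != 0 -> 0 < dot (op u) u;
  op_compact_inverse : exists B : H -> H,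
    [/\ forall u, opdom (B u) /\ op (B u) = u,
        forall u, opdom u -> B (op u) = u &
        compact (closure (B @` [set u | `|u| <= 1]))];
  eigvec : nat -> H;
  eigval : nat -> R;
  eigvec_ortho : forall i j, dot (eigvec i) (eigvec j) = (i == j)%:R;
  eigvec_basis : forall u,
    series (fun j => dot u (eigvec j) *: eigvec j) @ \oo --> u;
  eigvec_dom : forall j, opdom (eigvec j);
  op_eig : forall j, op (eigvec j) = eigval j *: eigvec j;
  eigval_gt0 : 0 < eigval 0%N;
  eigval_homo : forall j, eigval j <= eigval j.+1;
  eigval_infty : eigval @ \oo --> +oo;
}.

Context {H : hilbertType R} (A : posOperator H).
Local Notation e := (eigvec A).
Local Notation lam := (eigval A).

Definition fracpow (a : R) (u : H) : H :=
  limn (series (fun j => (lam j `^ a * dot u (e j)) *: e j)).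

Definition fracdom (a : R) : set H :=
  [set u | cvgn (series (fun j => (lam j `^ a * dot u (e j)) ^+ 2))].

(* For t < 0 this is used only on P_n H, where the series is a finite sum. *)
Definition semigroup (t : R) (u : H) : H :=
  limn (series (fun j => (expR (- (lam j * t)) * dot u (e j)) *: e j)).

Definition projP (n : nat) (u : H) : H := \sum_(j < n) dot u (e j) *: e j.

Definition projQ (n : nat) (u : H) : H := u - projP n u.

End operator.

Arguments eigvec_basis {R H} _ _.

Section hilbert_theory.
Context {R : realType} {H : hilbertType R}.
Implicit Types u v w : H.

Lemma dotDl u v w : dot (u + v) w = dot u w + dot v w.
Proof. by rewrite -{1}[u]scale1r dot_linearl mul1r. Qed.

Lemma dot0l w : dot (0 : H) w = 0.
Proof. by apply: (addIr (dot 0 w)); rewrite -dotDl addr0 add0r. Qed.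

Lemma dotZl (a : R) u w : dot (a *: u) w = a * dot u w.
Proof. by rewrite -[a *: u]addr0 dot_linearl dot0l addr0. Qed.

Lemma dotDr u v w : dot w (u + v) = dot w u + dot w v.
Proof. by rewrite dotC dotDl !(dotC w). Qed.

Lemma dotZr (a : R) u w : dot w (a *: u) = a * dot w u.
Proof. by rewrite dotC dotZl (dotC w). Qed.

Lemma dotNl u w : dot (- u) w = - dot u w.
Proof. by rewrite -scaleN1r dotZl mulN1r. Qed.

Lemma dotBl u v w : dot (u - v) w = dot u w - dot v w.
Proof. by rewrite dotDl dotNl. Qed.

Lemma dot_suml (I : Type) (r : seq I) (F : I -> H) w :
  dot (\sum_(i <- r) F i) w = \sum_(i <- r) dot (F i) w.
Proof.
elim: r => [|i r IH]; first by rewrite !big_nil dot0l.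
by rewrite !big_cons dotDl IH.
Qed.

Lemma dotBr u v w : dot w (u - v) = dot w u - dot w v.
Proof. by rewrite dotC dotBl !(dotC w). Qed.

Lemma dot_unit_le u w : dot w w = 1 -> `|dot u w| <= `|u|.
Proof.
move=> w1; have : 0 <= dot (u - dot u w *: w) (u - dot u w *: w).
  by rewrite dot_norm sqr_ge0.
rewrite dotBr !dotBl !dotZl !dotZr w1 dot_norm (dotC w u) => h.
rewrite -(@ler_pXn2r _ 2) ?nnegrE// real_normK ?num_real//.
by rewrite -subr_ge0; move: h; rewrite mulr1 subrr subr0 expr2.
Qed.

Lemma cvg_dot_unit (f : nat -> H) u w : dot w w = 1 ->
  f @ \oo --> u -> (fun n => dot (f n) w) @ \oo --> dot u w.
Proof.
move=> w1 fu; apply/cvgrPdist_lt => eps eps0.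
move/cvgrPdist_lt: fu => /(_ _ eps0); apply: filterS => n.
by apply: le_lt_trans; rewrite -dotBl; exact: dot_unit_le.
Qed.

End hilbert_theory.

Section expansion.
Context {R : realType} {H : hilbertType R} (A : posOperator H).
Local Notation e := (eigvec A).
Local Notation lam := (eigval A).
Implicit Types (c d : nat -> R) (u v : H) (a : R).

Lemma eigvec_unit j : dot (e j) (e j) = 1.
Proof. by rewrite eigvec_ortho eqxx. Qed.

Lemma eigval_pos j : 0 < lam j.
Proof.
elim: j => [|j IH]; first exact: eigval_gt0.
exact: lt_le_trans IH (eigval_homo A j).
Qed.

Lemma eigval_ge0th j : lam 0%N <= lam j.
Proof. by elim: j => // j IH; exact: le_trans IH (eigval_homo A j). Qed.

Lemma pythagoras c m n :
  `|\sum_(m <= j < n) c j *: e j| ^+ 2 = \sum_(m <= j < n) c j ^+ 2.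
Proof.
rewrite -dot_norm dot_suml; apply: eq_big_nat => j /andP[mj jn].
rewrite dotZl dotC dot_suml (bigD1_seq j) ?mem_index_iota ?mj ?iota_uniq//=.
rewrite big1 => [|i ij]; first by rewrite dotZl eigvec_unit mulr1 addr0 expr2.
by rewrite dotZl eigvec_ortho (negbTE ij) mulr0.
Qed.

Lemma dot_partial c n i : (i < n)%N ->
  dot (\sum_(0 <= j < n) c j *: e j) (e i) = c i.
Proof.
move=> ni; rewrite dot_suml (bigD1_seq i) ?mem_index_iota ?iota_uniq//=.
rewrite big1 => [|j ji]; first by rewrite dotZl eigvec_unit mulr1 addr0.
by rewrite dotZl eigvec_ortho (negbTE ji) mulr0.
Qed.

Lemma expansion_cvg c : cvgn (series (fun j => c j ^+ 2)) ->
  cvgn (series (fun j => c j *: e j)).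
Proof.
move=> /cauchy_cvgP/cauchy_seriesP h.
apply/cauchy_cvgP/cauchy_seriesP => eps eps0.
have := h _ (exprn_gt0 2 eps0); apply: filterS => -[m n] /=.
rewrite -pythagoras ger0_norm ?sqr_ge0// => h'.
by rewrite -(@ltr_pXn2r _ 2) ?nnegrE// ltW.
Qed.

Lemma expansion_coef c u i :
  series (fun j => c j *: e j) @ \oo --> u -> dot u (e i) = c i.
Proof.
move=> /(cvg_dot_unit (eigvec_unit i)) h.
apply: (cvg_unique _ h) => //; apply: cvg_near_cst.
exists i.+1 => // n /= ni; by rewrite /series/= dot_partial.
Qed.

Lemma eq_coef u v : (forall i, dot u (e i) = dot v (e i)) -> u = v.
Proof.
move=> uv.
have hl := @norm_hausdorff R H.
rewrite -(cvg_lim hl (eigvec_basis A u)) -(cvg_lim hl (eigvec_basis A v)).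
by congr (limn (series _)); apply/funext => j; rewrite uv.
Qed.

Lemma sqr_series_bounded c (M : R) :
  (forall n, \sum_(0 <= j < n) c j ^+ 2 <= M) ->
  cvgn (series (fun j => c j ^+ 2)).
Proof.
move=> hM; apply: nondecreasing_is_cvgn.
  by apply: nondecreasing_series => j _ _; exact: sqr_ge0.
by exists M => _ [n _ <-]; exact: hM.
Qed.

Lemma sqr_series_le c n : cvgn (series (fun j => c j ^+ 2)) ->
  \sum_(0 <= j < n) c j ^+ 2 <= limn (series (fun j => c j ^+ 2)).
Proof.
move=> h; apply: (nondecreasing_cvgn_le _ h n).
by apply: nondecreasing_series => j _ _; exact: sqr_ge0.
Qed.

Lemma parseval_cvg u : cvgn (series (fun j => dot u (e j) ^+ 2)).
Proof.
apply: (@sqr_series_bounded _ (`|u| ^+ 2)) => n.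
rewrite -pythagoras.
have -> : `|u| ^+ 2 = `|\sum_(0 <= j < n) dot u (e j) *: e j| ^+ 2 +
   `|u - \sum_(0 <= j < n) dot u (e j) *: e j| ^+ 2; last first.
  by rewrite lerDl sqr_ge0.
set s := \sum_(0 <= j < n) _.
have us : dot u s = dot s s.
  rewrite dotC {1 3}/s !dot_suml; apply: eq_big_nat => j /andP[_ jn].
  by rewrite !dotZl (dotC (e j) s) dot_partial// (dotC (e j)).
rewrite -!dot_norm dotBl (dotC u (u - s)) (dotC s (u - s)) !dotBl.
by rewrite (dotC s u) us subrr subr0 addrC subrK.
Qed.

Lemma fracpow_cvg a u : fracdom A a u ->
  series (fun j => (lam j `^ a * dot u (e j)) *: e j) @ \oo --> fracpow A a u.
Proof. exact: expansion_cvg. Qed.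

Lemma fracpow_coef a u i : fracdom A a u ->
  dot (fracpow A a u) (e i) = lam i `^ a * dot u (e i).
Proof. by move=> /fracpow_cvg /expansion_coef ->. Qed.

Lemma fracdom0 a : fracdom A a 0.
Proof.
apply: (@sqr_series_bounded _ 0) => n.
by rewrite big1// => j _; rewrite dot0l mulr0 expr0n.
Qed.

Lemma fracdomP a (b : R) u v :
  fracdom A a u -> fracdom A a v -> fracdom A a (b *: u + v).
Proof.
move=> du dv.
apply: (@sqr_series_bounded _
  (2 * b ^+ 2 * limn (series (fun j => (lam j `^ a * dot u (e j)) ^+ 2)) +
   2 * limn (series (fun j => (lam j `^ a * dot v (e j)) ^+ 2)))) => n.
have hle := lerD (ler_wpM2l (_ : 0 <= 2 * b ^+ 2) (sqr_series_le n du))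
  (ler_wpM2l (_ : 0 <= 2) (sqr_series_le n dv)).
apply: le_trans (hle _ _) => //; last by rewrite mulr_ge0// sqr_ge0.
rewrite !mulr_sumr -big_split/=; apply: ler_sum => j _.
rewrite dot_linearl -subr_ge0.
set x := dot u _; set y := dot v _; set l := _ `^ _.
rewrite (_ : _ - _ = (b * (l * x) - l * y) ^+ 2) ?sqr_ge0//.
by ring.
Qed.

Lemma fracpow_linear a (b : R) u v : fracdom A a u -> fracdom A a v ->
  fracpow A a (b *: u + v) = b *: fracpow A a u + fracpow A a v.
Proof.
move=> du dv; apply: eq_coef => i.
by rewrite dot_linearl !fracpow_coef ?dot_linearl//; [ring|exact: fracdomP].
Qed.

Lemma fracpow_eq0 a u : fracdom A a u -> fracpow A a u = 0 -> u = 0.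
Proof.
move=> du u0; apply: eq_coef => i; rewrite dot0l.
have /esym/eqP := fracpow_coef i du; rewrite u0 dot0l mulf_eq0 => /orP[|/eqP//].
by rewrite gt_eqF// powR_gt0// eigval_pos.
Qed.

Lemma fracpow_surj a w : 0 <= a ->
  exists2 u, fracdom A a u & fracpow A a u = w.
Proof.
move=> a0; pose c j := (lam j `^ a)^-1 * dot w (e j).
have l0 j : 0 < lam j `^ a by rewrite powR_gt0// eigval_pos.
have hc : cvgn (series (fun j => c j ^+ 2)).
  apply: (@sqr_series_bounded _ ((lam 0%N `^ a)^-1 ^+ 2 *
    limn (series (fun j => dot w (e j) ^+ 2)))) => n.
  have := ler_wpM2l (sqr_ge0 (lam 0%N `^ a)^-1)
    (sqr_series_le n (@parseval_cvg w)).
  apply: le_trans; rewrite mulr_sumr; apply: ler_sum => j _.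
  rewrite exprMn ler_wpM2r ?sqr_ge0// ler_pXn2r ?nnegrE ?invr_ge0 ?powR_ge0//.
  rewrite lef_pV2 ?posrE//; apply: ge0_ler_powR => //.
  - by rewrite nnegrE ltW// eigval_pos.
  - by rewrite nnegrE ltW// eigval_pos.
  - exact: eigval_ge0th.
have hu := expansion_cvg hc; set u := limn _ in hu.
have uc i : dot u (e i) = c i by exact: expansion_coef hu.
have cE j : lam j `^ a * dot u (e j) = dot w (e j).
  by rewrite uc /c mulrA divff ?mul1r// gt_eqF.
have du : fracdom A a u.
  rewrite /fracdom/= (_ : (fun j => _) = (fun j => dot w (e j) ^+ 2)).
    exact: parseval_cvg.
  by apply/funext => j; rewrite cE.
by exists u => //; apply: eq_coef => i; rewrite fracpow_coef.
Qed.

Lemma projP_fracdom a n u : fracdom A a (projP A n u).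
Proof.
apply: (@sqr_series_bounded _
  (\sum_(0 <= j < n) (lam j `^ a * dot u (e j)) ^+ 2)) => m.
have coef j : dot (projP A n u) (e j) = if (j < n)%N then dot u (e j) else 0.
  rewrite /projP -(big_mkord xpredT (fun j => dot u (e j) *: e j)).
  case: ifPn => jn; first by rewrite dot_partial.
  rewrite dot_suml big_nat big1// => i /andP[_ ni].
  by rewrite dotZl eigvec_ortho ltn_eqF ?mulr0// (leq_trans ni)// leqNgt.
have [mn|/ltnW nm] := leqP m n.
  rewrite [leRHS](big_cat_nat (n := m))//= -[leLHS]addr0 lerD//; last first.
    by apply: sumr_ge0 => j _; exact: sqr_ge0.
  rewrite [leLHS]big_nat [leRHS]big_nat; apply: ler_sum => j /andP[_ jm].
  by rewrite coef (leq_trans jm mn).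
rewrite (big_cat_nat (n := n))//= [X in _ + X](_ : _ = 0) ?addr0.
  rewrite [leLHS]big_nat [leRHS]big_nat; apply: ler_sum => j /andP[_ jn].
  by rewrite coef jn.
rewrite big_nat big1// => j /andP[nj _].
by rewrite coef ltnNge nj/= mulr0 expr0n.
Qed.

End expansion.

Arguments fracdom0 {R H} _ _.

Record fracSpace (R : realType) (H : hilbertType R) (A : posOperator H)
    (alpha : {nonneg R}) := FracSpace {
  fracval :> H;
  fracvalP : fracval \in [pred u | `[< fracdom A alpha%:num u >]];
}.

Section fracSpace.
Context {R : realType} {H : hilbertType R} (A : posOperator H).
Variable alpha : {nonneg R}.
Local Notation X := (fracSpace A alpha).

HB.instance Definition _ := [isSub for @fracval R H A alpha].
HB.instance Definition _ := [Choice of X by <:].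

Fact fracdom_submod_closed :
  subsemimod_closed [pred u | `[< fracdom A alpha%:num u >]].
Proof.
split.
  split; first by apply/asboolP; exact: fracdom0.
  move=> u v /asboolP du /asboolP dv; apply/asboolP.
  by rewrite -[u]scale1r; exact: fracdomP.
move=> b u /asboolP du; apply/asboolP.
by rewrite -[_ *: _]addr0; apply: fracdomP => //; exact: fracdom0.
Qed.

HB.instance Definition _ :=
  GRing.SubChoice_isSubLmodule.Build R H _ X fracdom_submod_closed.

Lemma fracdom_val (x : X) : fracdom A alpha%:num x.
Proof. by case: x => u /= /asboolP. Qed.

Lemma fracvalD (x y : X) : fracval (x + y) = fracval x + fracval y.
Proof. exact: (raddfD (val : X -> H)). Qed.

Lemma fracvalB (x y : X) : fracval (x - y) = fracval x - fracval y.
Proof. exact: (raddfB (val : X -> H)). Qed.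

Lemma fracvalZ (b : R) (x : X) : fracval (b *: x) = b *: fracval x.
Proof. exact: (linearZZ (val : X -> H)). Qed.

Lemma fracval0 : fracval (0 : X) = 0.
Proof. exact: (raddf0 (val : X -> H)). Qed.

Definition fracnorm (x : X) : R := `|fracpow A alpha%:num x|.

Fact fracnormD (x y : X) : fracnorm (x + y) <= fracnorm x + fracnorm y.
Proof.
rewrite /fracnorm fracvalD -[fracval x]scale1r fracpow_linear ?scale1r.
- exact: ler_normD.
- exact: fracdom_val.
- exact: fracdom_val.
Qed.

Fact fracnormZ (b : R) (x : X) : fracnorm (b *: x) = `|b| * fracnorm x.
Proof.
rewrite /fracnorm -normrZ fracvalZ -[b *: fracval x]addr0.
rewrite fracpow_linear; [|exact: fracdom_val|exact: fracdom0].
suff -> : fracpow A alpha%:num 0 = 0 by rewrite addr0.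
have := fracpow_linear 1 (fracdom0 A alpha%:num) (fracdom0 A alpha%:num).
by rewrite scaler0 addr0 scale1r -{1}[fracpow _ _ _]addr0 => /addrI.
Qed.

Fact fracnorm0_eq0 (x : X) : fracnorm x = 0 -> x = 0.
Proof.
move=> /normr0_eq0 x0; apply: val_inj; rewrite [RHS]fracval0.
by apply: (fracpow_eq0 _ x0); exact: fracdom_val.
Qed.

HB.instance Definition _ :=
  Lmodule_isNormed.Build R X fracnormD fracnormZ fracnorm0_eq0.

Lemma fracnormE (x : X) : `|x| = `|fracpow A alpha%:num x|.
Proof. by []. Qed.

Fact fracSpace_complete (F : set_system X) : ProperFilter F ->
  cauchy F -> cvg F.
Proof.
move=> FF Fc; pose J (x : X) := fracpow A alpha%:num x.
have JB x y : J x - J y = J (x - y).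
  rewrite /J fracvalB [in RHS]addrC -[in RHS]scaleN1r fracpow_linear.
  - by rewrite scaleN1r addrC.
  - exact: fracdom_val.
  - exact: fracdom_val.
have Jc : cauchy (J @ F).
  apply/cauchy_ballP => eps eps0; move/cauchy_ballP: Fc => /(_ _ eps0).
  move=> [[P Q] [/= FP FQ] PQ]; exists (J @` P, J @` Q).
    split=> /=; [apply: filterS FP|apply: filterS FQ] => x Px; by exists x.
  move=> [_ _] /= [[x Px <-] [y Qy <-]].
  by have := PQ (x, y) (conj Px Qy); rewrite -!ball_normE/= JB.
have [w Jw] : exists w : H, J @ F --> w.
  by apply/cvg_ex; exact: (cauchy_cvg (J @ F)).
have [u du uw] := fracpow_surj A w (ge0 alpha).
have du' : u \in [pred u | `[< fracdom A alpha%:num u >]] by apply/asboolP.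
apply/cvg_ex; exists (FracSpace du' : X).
apply/cvgrPdist_lt => eps eps0; move/cvgrPdist_lt: Jw => /(_ _ eps0).
apply: filterS => x; rewrite -uw.
by rewrite (JB (FracSpace du') x).
Qed.

HB.instance Definition _ := Uniform_isComplete.Build X fracSpace_complete.

Fact projP_subproof (n : nat) (u : H) :
  projP A n u \in [pred u | `[< fracdom A alpha%:num u >]].
Proof. by apply/asboolP; exact: projP_fracdom. Qed.

Definition fracP (n : nat) (x : X) : X := FracSpace (projP_subproof n x).

Definition fracQ (n : nat) (x : X) : X := x - fracP n x.

Definition PnH (n : nat) : set X := [set x | exists u : H, x = projP A n u :> H].

End fracSpace.

Arguments PnH {R H} A alpha n.

(* Bochner integral of an H-valued function with respect to Lebesgue measure:
   for f strongly measurable (H is separable) with integrable norm, it is the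
   vector representing the functional h |-> int <f(s), h> ds; the value is 0
   when f is not Bochner integrable. *)
Section bochner.
Context {R : realType} {H : hilbertType R}.
Local Notation mu := (@lebesgue_measure R).

Definition bochner_integrable (D : set R) (f : R -> H) : Prop :=
  measurable_fun D (f : R -> borel H) /\
  (\int[mu]_(s in D) (`|f s|%:E) < +oo)%E.

Definition bochner_integral (D : set R) (f : R -> H) : H :=
  xget 0 [set y | bochner_integrable D f /\
    forall h : H, dot y h = \int[mu]_(s in D) dot (f s) h].

End bochner.

Section L2loc.
Context {R : realType}.

Definition L2loc (V : normedModType R) (h : R -> V) : Prop :=
  measurable_fun [set: R] (h : R -> borel V) /\
  forall a b : R,
    (\int[@lebesgue_measure R]_(s in `[a, b]) (`|h s| ^+ 2)%:E < +oo)%E.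

Definition c_alpha (a : R) : R :=
  if a == 0 then 0
  else a `^ a *
    \int[@lebesgue_measure R]_(s in `]0, +oo[) (s `^ (- a) * expR (- s)).

Definition shift {V : Type} (tau : R) (g : R -> V) : R -> V :=
  fun s => g (s + tau).

End L2loc.

Record path0 (R : realType) (H : normedModType R) := Path0 {
  path0_fun :> R -> H;
  path0_cts : continuous path0_fun;
  path0_0 : path0_fun 0 = 0;
}.

Section path0.
Context {R : realType} {H : normedModType R}.
Local Notation Omega := (path0 H).

HB.instance Definition _ := gen_eqMixin Omega.
HB.instance Definition _ := gen_choiceMixin Omega.

Fact path0_zero_cts : continuous (fun _ : R => 0 : H).
Proof. by move=> s; exact: cvg_cst. Qed.

HB.instance Definition _ :=
  isPointed.Build Omega (Path0 path0_zero_cts erefl).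

Definition path0_open : set (set Omega) :=
  [set B | exists2 U : set {compact-open, R -> H},
     open U & B = [set w : Omega | U (path0_fun w)]].

Fact theta_cts (t : R) (w : Omega) : continuous (fun s => w (s + t) - w t).
Proof.
move=> s; apply: cvgB; last exact: cvg_cst.
apply: (@continuous_comp _ _ _ (fun s : R => s + t) w).
  by apply: cvgD; [exact: cvg_id|exact: cvg_cst].
exact: path0_cts.
Qed.

Fact theta_0 (t : R) (w : Omega) : w (0 + t) - w t = 0.
Proof. by rewrite add0r subrr. Qed.

End path0.

Arguments theta_cts {R H} _ _.

Notation wienerSpace H := (g_sigma_algebraType (@path0_open _ H)).

Definition theta {R : realType} {H : normedModType R} (t : R)
    (w : wienerSpace H) : wienerSpace H :=
  Path0 (theta_cts t w) (theta_0 t w).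

Section wiener.
Context {R : realType} {H : hilbertType R} (A : posOperator H).

Definition trace_class_covariance (Q : {linear H -> H}) : Prop :=
  [/\ continuous Q, forall u v, dot (Q u) v = dot u (Q v),
      forall u, 0 <= dot (Q u) u &
      cvgn (series (fun j => dot (Q (eigvec A j)) (eigvec A j)))].

(* `normal_prob` takes the standard deviation and is uniform at 0. *)
Definition centered_gaussian (v : R) (B : set R) : \bar R :=
  if v == 0 then \d_(0 : R) B else normal_prob 0 (Num.sqrt v) B.

Definition wiener_measure (P : probability (wienerSpace H) R)
    (Q : {linear H -> H}) : Prop :=
  (forall (s t : R) (h : H) (B : set R), s <= t -> measurable B ->
     P [set w | B (dot ((w : path0 H) t - (w : path0 H) s) h)] =
     centered_gaussian ((t - s) * dot (Q h) h) B) /\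
  (forall (m : nat) (t : nat -> R) (B : nat -> set (borel H)),
     (forall i, t i <= t i.+1) -> (forall i, measurable (B i)) ->
     let E i := [set w : wienerSpace H |
       B i ((w : path0 H) (t i.+1) - (w : path0 H) (t i))] in
     P (\bigcap_(i in `I_m) E i) = (\prod_(i < m) P (E i))%E).

End wiener.

Section dynamics.
Context {R : realType} {H : hilbertType R} (A : posOperator H).
Context {alpha : {nonneg R}}.
Local Notation X := (fracSpace A alpha).
Local Notation Omega := (wienerSpace H).
Local Notation leb := (@lebesgue_measure R).

(* t |-> z(theta_t omega) is an analytically weak solution of
   dz + A z dt = dW for W(t, omega) = omega(t); the noise being additive, no
   stochastic integral is involved beyond increments of omega. *)
Definition stationary_OU (P : probability Omega R) (z : Omega -> X) : Prop :=
  measurable_fun [set: Omega] (z : Omega -> borel X) /\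
  {ae P, forall w : Omega, forall (s t : R) (phi : H),
     s <= t -> opdom A phi ->
     dot (z (theta t w)) phi - dot (z (theta s w)) phi +
       \int[leb]_(r in `[s, t]) dot (z (theta r w)) (op A phi) =
     dot ((w : path0 H) t - (w : path0 H) s) phi}.

Definition regular_version (z : Omega -> X) : Prop :=
  forall w : Omega,
    continuous (fun t : R => z (theta t w)) /\
    forall c : R, 0 < c ->
      (fun t : R => expR (c * t) * `|z (theta t w)|) @ -oo --> (0 : R).

Variables (F : X -> H) (z : Omega -> X) (g : R -> X).

Definition mild_solution (r : R) (w : Omega) (h : R -> X) (vr : X)
    (v : R -> X) : Prop :=
  {within `[r, +oo[, continuous v} /\
  forall t, r <= t ->
    v t = semigroup A (t - r) vr +
      bochner_integral `[r, t] (fun s =>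
        semigroup A (t - s) (F (v s + z (theta s w)) + fracval (h s))) :> H.

(* The mild solution is unique on [r, +oo[, so only t >= r is meaningful. *)
Definition vsol (t r : R) (w : Omega) (h : R -> X) (vr : X) : X :=
  xget (fun=> 0) (mild_solution r w h vr) t.

Definition usol (t tau : R) (w : Omega) (utau : X) : X :=
  vsol t tau w g (utau - z (theta tau w)) + z (theta t w).

Definition Phi (t tau : R) (w : Omega) (u0 : X) : X :=
  usol (t + tau) tau (theta (- tau) w) u0.

Variables (n : nat) (mu : R).

Definition Sspace : set (R -> X) :=
  [set xi | {within `]-oo, (0 : R)], continuous xi} /\
    exists C : R, forall t, t <= 0 -> expR (mu * t) * `|xi t| <= C].

Definition Mset (tau : R) (w : Omega) : set X :=
  [set xi 0 | xi in [set xi | Sspace xi /\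
    forall r t, r <= t -> t <= 0 ->
      vsol t r w (shift tau g) (xi r) = xi t]].

Definition xistar_spec (x : X) (w : Omega) (tau : R) (xi : R -> X) : Prop :=
  Sspace xi /\
  forall t, t <= 0 ->
    xi t = semigroup A t x
      - bochner_integral `[t, 0] (fun s => semigroup A (t - s)
          (projP A n (F (xi s + z (theta s w)) + fracval (g (s + tau)))))
      + bochner_integral `]-oo, t] (fun s => semigroup A (t - s)
          (projQ A n (F (xi s + z (theta s w)) + fracval (g (s + tau))))) :> H.

(* Unique on ]-oo, 0]; its values for t > 0 are irrelevant. *)
Definition xistar (x : X) (w : Omega) (tau : R) : R -> X :=
  xget (fun=> 0) (xistar_spec x w tau).

Definition mmap (tau : R) (w : Omega) (x : X) : X :=
  fracQ n (xistar x w tau 0).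

End dynamics.

Section inertial_manifold.
Context {R : realType} {d : measure_display} {Omega : measurableType d}.
Context {X : completeNormedModType R}.
Variables (flow : R -> Omega -> Omega) (Psi : R -> R -> Omega -> X -> X).

(* Measurability of a random closed set: omega |-> dist(x, N(omega)) is
   measurable for every x. *)
Definition closed_random_set (N : Omega -> set X) : Prop :=
  (forall w, closed (N w) /\ N w !=set0) /\
  forall x : X, measurable_fun [set: Omega]
    (fun w => inf [set `|x - y| | y in N w]).

Definition finite_dim_subspace (X1 : set X) : Prop :=
  exists (m : nat) (b : 'I_m -> X),
    X1 = [set x | exists c : 'I_m -> R, x = \sum_i c i *: b i].

Definition closed_subspace (X2 : set X) : Prop :=
  [/\ closed X2, X2 0 &
      forall (a : R) x y, X2 x -> X2 y -> X2 (a *: x + y)].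

(* With a closed X2, this is the direct sum of Banach spaces. *)
Definition direct_sum (X1 X2 : set X) : Prop :=
  X1 `&` X2 = [set 0] /\
  forall x, exists x1 x2, [/\ X1 x1, X2 x2 & x = x1 + x2].

(* q(tau, omega) : X1 -> X2 is a total function used on X1 only. *)
Definition inertial_graph (N : R -> Omega -> set X) (X1 X2 : set X)
    (q : R -> Omega -> X -> X) : Prop :=
  [/\ finite_dim_subspace X1, closed_subspace X2 & direct_sum X1 X2] /\
  [/\ forall tau w x, X1 x -> X2 (q tau w x),
      forall tau w, N tau w = [set x + q tau w x | x in X1],
      forall tau x, X1 x ->
        measurable_fun [set: Omega] (fun w => q tau w x : borel X) &
      forall tau w, exists k : R, k.-lipschitz_X1 (q tau w)].

Definition random_inertial_manifold (N : R -> Omega -> set X) : Prop :=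
  [/\ forall tau, closed_random_set (N tau),
      exists X1 X2 q, inertial_graph N X1 X2 q,
      forall t tau w, 0 <= t ->
        Psi t tau w @` N tau w = N (tau + t) (flow t w) &
      forall tau w x, exists2 y, N tau w y &
        exists c1 c2 : R, [/\ 0 < c1, 0 < c2 & forall t, 0 <= t ->
          `|Psi t tau w x - Psi t tau w y| <= c1 * expR (- (c2 * t))]].

Definition pathwise_periodic (N : R -> Omega -> set X) (T : R) : Prop :=
  exists X1 X2 q, inertial_graph N X1 X2 q /\
    forall tau w x, X1 x -> q (tau + T) w x = q tau w x.

End inertial_manifold.

(* Main.v *)
(* For each noise path the transformed equation dv/dt + A v = F(v + z) + g is a
   nonautonomous equation whose linear part is diagonal, so all objects are
   handled through their coefficients on the eigenbasis, weighted by expR (lam i * t).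
   The Green operator of the dichotomy at the n-th mode is bounded, from
   H-valued to D(A^alpha)-valued functions of growth expR (- mu * t), by a constant
   kappa; Minkowski's integral inequality reduces this bound to a scalar kernel, and the
   gap condition says exactly that L * kappa <= k < 1.
   Three contractions in such weighted spaces give everything: the Cauchy problem
   (no low modes, mu very negative), the Lyapunov-Perron equation on the negative
   half line, whose solutions are the complete orbits of growth expR (- mu * t) and
   whose dependence on the low part at time 0 defines m, and a perturbation
   equation on the whole line producing, for each solution v, a complete orbit
   that shadows v at rate expR (- mu * t). Complete orbits are carried to complete
   orbits by time shift, which is the invariance; measurability is obtained by
   solving the fixed point equation with the noise path as a parameter, the
   joint measurability of z (theta s w) following from that of theta s and from
   continuity in s; periodicity of g passes to m by uniqueness. *)

(* The obstacle is the loss of A^alpha: F takes values in H only, so its Green kernel carries a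
   factor lam_i^alpha, which over all modes is as singular as r^(-alpha) at 0 and integrable because
   alpha < 1. The forcing g is used only as locally integrable in time, with no pointwise bound, but
   it takes values in D(A^alpha), where the kernel needs no power of A. Estimates of the Green
   operator therefore come in two forms, with suffix [H] for the first kind of source and [X] for
   the second. Continuity is not carried through the fixed point iterations: measurability suffices
   for the integrals, and continuity in time is read off afterwards from the equation that the fixed
   point solves. The noise acts on the manifold twice, through the equation and through the final
   translation by z. This translation moves the low modes too, so as a graph over P_n H the manifold
   involves m at a random base point, and measurability of m is needed at such points. *)
Require Import Defs.
From mathcomp Require Import all_boot all_order all_algebra.
From mathcomp Require Import all_classical all_reals all_analysis.
From mathcomp Require Import measurable_realfun ring lra.
Set Implicit Arguments.
Unset Strict Implicit.
Unset Printing Implicit Defensive.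
Import Order.TTheory GRing.Theory Num.Theory.
Import numFieldNormedType.Exports.
Local Open Scope classical_set_scope.
Local Open Scope ring_scope.

(** * Eigencoefficients and the norm of D(A^alpha) *)

Section coefficients.
Context {R : realType} {H : hilbertType R} (A : posOperator H).
Local Notation e := (eigvec A).
Local Notation lam := (eigval A).
Implicit Types (c : nat -> R) (u v : H).

Lemma dot_le u v : `|dot u v| <= `|u| * `|v|.
Proof.
have [->|v0] := eqVneq v 0.
  by rewrite dotC dot0l normr0 mulr_ge0.
have nv : `|v| != 0 by rewrite normr_eq0.
have w1 : dot (`|v|^-1 *: v) (`|v|^-1 *: v) = 1 by rewrite dotZl dotZr dot_norm; field.
have := dot_unit_le u w1; rewrite dotZr normrM normfV normr_id => h.
by rewrite -ler_pdivrMr ?normr_gt0// mulrC.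
Qed.

Lemma cvg_dot T (F : set_system T) {FF : Filter F} (f : T -> H) u w :
  f @ F --> u -> (fun t => dot (f t) w) @ F --> dot u w.
Proof.
move=> fu; apply/cvgrPdist_le => eps eps0.
move/cvgrPdist_le: fu => /(_ (eps / (1 + `|w|))).
have w0 : 0 < 1 + `|w| by rewrite ltr_pwDl.
move=> /(_ (divr_gt0 eps0 w0)); apply: filterS => t ht.
rewrite -dotBl (le_trans (dot_le _ _))//.
apply: (@le_trans _ _ (eps / (1 + `|w|) * (1 + `|w|))); last by rewrite divfK// gt_eqF.
by rewrite ler_pM// lerDr.
Qed.

(** Together with [norm_coef_lb] this stands in for Parseval's identity: all norm estimates are made
    on finite partial sums, uniformly in their length. *)
Lemma norm_coef_ub u (B : R) : 0 <= B ->
  (forall N, \sum_(0 <= j < N) dot u (e j) ^+ 2 <= B ^+ 2) -> `|u| <= B.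
Proof.
move=> B0 hB; have := cvg_norm (eigvec_basis A u) => h.
apply: (cvgr_to_le (h _)); apply: nearW => N.
by rewrite -ler_sqr ?nnegrE// pythagoras.
Qed.

Lemma norm_coef_lb u N : \sum_(0 <= j < N) dot u (e j) ^+ 2 <= `|u| ^+ 2.
Proof.
rewrite -(pythagoras A); set s := \sum_(0 <= j < N) _.
have us : dot u s = dot s s.
  rewrite dotC {1 3}/s !dot_suml; apply: eq_big_nat => j /andP[_ jn].
  by rewrite !dotZl (dotC (e j) s) dot_partial// (dotC (e j)).
rewrite -!dot_norm -subr_ge0.
have -> : dot u u - dot s s = dot (u - s) (u - s).
  by rewrite dotBl (dotC u (u - s)) (dotC s (u - s)) !dotBl (dotC s u) us subrr subr0.
by rewrite dot_norm sqr_ge0.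
Qed.

Lemma coef_le u j : `|dot u (e j)| <= `|u|.
Proof. by apply: dot_unit_le; exact: eigvec_unit. Qed.

Lemma eigval_mono i j : (i <= j)%N -> lam i <= lam j.
Proof.
move=> ij; rewrite -(subnK ij) addnC.
by elim: (j - i)%N => [|k]; rewrite ?addn0// addnS => /le_trans; apply; exact: eigval_homo.
Qed.

Lemma projP_coef n u j :
  dot (projP A n u) (e j) = if (j < n)%N then dot u (e j) else 0.
Proof.
rewrite /projP -(big_mkord xpredT (fun j => dot u (e j) *: e j)).
case: ifPn => jn; first by rewrite dot_partial.
rewrite dot_suml big_nat big1// => i /andP[_ ni].
by rewrite dotZl eigvec_ortho ltn_eqF ?mulr0// (leq_trans ni)// leqNgt.
Qed.

Lemma projQ_coef n u j :
  dot (projQ A n u) (e j) = if (j < n)%N then 0 else dot u (e j).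
Proof. by rewrite dotBl projP_coef; case: ifP => _; rewrite ?subrr ?subr0. Qed.

Lemma coef_series c (B : R) : (forall N, \sum_(0 <= j < N) c j ^+ 2 <= B) ->
  exists u, forall j, dot u (e j) = c j.
Proof.
move=> /sqr_series_bounded/(@expansion_cvg _ _ A) h.
by exists (limn (series (fun j => c j *: e j))) => j; exact: expansion_coef h.
Qed.

(** [semigroup] is a limit, meaningful only when its coefficients are square summable. The bound is
    supplied by contractivity for [0 <= t], and on P_n H for every [t] because finitely many
    coefficients survive. *)
Lemma semigroup_coef t u c :
  (forall j, c j = expR (- (lam j * t)) * dot u (e j)) ->
  (exists B : R, forall N, \sum_(0 <= j < N) c j ^+ 2 <= B) ->
  forall j, dot (semigroup A t u) (e j) = c j.
Proof.
move=> cE [B hB] j; rewrite /semigroup.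
have -> : (fun j => (expR (- (lam j * t)) * dot u (e j)) *: e j) = (fun j => c j *: e j).
  by apply/funext => i; rewrite cE.
by apply: expansion_coef; exact: (@expansion_cvg _ _ A _ (sqr_series_bounded hB)).
Qed.

Lemma semigroup_coef_ge0 t u j : 0 <= t ->
  dot (semigroup A t u) (e j) = expR (- (lam j * t)) * dot u (e j).
Proof.
move=> t0; apply: (@semigroup_coef t u (fun j => expR (- (lam j * t)) * dot u (e j))) => //.
exists (`|u| ^+ 2) => N; apply: le_trans (norm_coef_lb u N).
apply: ler_sum => i _; rewrite exprMn ler_piMl ?sqr_ge0// expr_le1//.
by rewrite -expR0 ler_expR oppr_le0 mulr_ge0// ltW// eigval_pos.
Qed.

Lemma semigroup_coef_proj t u n j : projP A n u = u ->
  dot (semigroup A t u) (e j) = expR (- (lam j * t)) * dot u (e j).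
Proof.
move=> uE; apply: (@semigroup_coef t u (fun j => expR (- (lam j * t)) * dot u (e j))) => //.
exists (\sum_(0 <= i < n) (expR (- (lam i * t)) * dot u (e i)) ^+ 2) => N.
have [Nn|/ltnW nN] := leqP N n.
  rewrite [leRHS](big_cat_nat (n := N))//= lerDl.
  by apply: sumr_ge0 => i _; exact: sqr_ge0.
rewrite (big_cat_nat (n := n))//= [X in _ + X](_ : _ = 0) ?addr0//.
rewrite big_nat big1// => i /andP[ni _].
by rewrite -uE projP_coef ltnNge ni/= mulr0 expr0n.
Qed.

End coefficients.

Section fractional_coefficients.
Context {R : realType} {H : hilbertType R} (A : posOperator H) (alpha : {nonneg R}).
Local Notation e := (eigvec A).
Local Notation lam := (eigval A).
Local Notation a := (alpha%:num).
Local Notation X := (fracSpace A alpha).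
Implicit Types (x y : X).

Lemma fracnorm_ub x (B : R) : 0 <= B ->
  (forall N, \sum_(0 <= j < N) (lam j `^ a * dot x (e j)) ^+ 2 <= B ^+ 2) -> `|x| <= B.
Proof.
move=> B0 hB; rewrite fracnormE; apply: (@norm_coef_ub _ _ A) => // N.
by under eq_bigr do rewrite (fracpow_coef _ (@fracdom_val _ _ _ _ x)).
Qed.

Lemma fracnorm_lb x N :
  \sum_(0 <= j < N) (lam j `^ a * dot x (e j)) ^+ 2 <= `|x| ^+ 2.
Proof.
rewrite fracnormE; apply: le_trans (norm_coef_lb A _ N).
by under [leRHS]eq_bigr do rewrite (fracpow_coef _ (@fracdom_val _ _ _ _ x)).
Qed.

Lemma lama_gt0 j : 0 < lam j `^ a.
Proof. by rewrite powR_gt0// eigval_pos. Qed.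

Lemma lama_le i j : (i <= j)%N -> lam i `^ a <= lam j `^ a.
Proof.
move=> ij; apply: ge0_ler_powR; rewrite ?nnegrE//; try exact: ltW (eigval_pos _ _).
exact: eigval_mono.
Qed.

Lemma frac_eq x y : (forall j, dot x (e j) = dot y (e j)) -> x = y.
Proof. by move=> h; apply: val_inj; exact: (@eq_coef _ _ A). Qed.

Lemma frac_norm_le x : `|x : H| <= (lam 0%N `^ a)^-1 * `|x|.
Proof.
apply: (@norm_coef_ub _ _ A); first by rewrite mulr_ge0// invr_ge0 powR_ge0.
move=> N; rewrite exprMn; apply: le_trans (ler_wpM2l _ (fracnorm_lb x N)); last exact: sqr_ge0.
rewrite mulr_sumr; apply: ler_sum => j _.
rewrite [in leRHS]exprMn mulrA ler_peMl ?sqr_ge0//.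
rewrite exprVn ler_pdivlMl ?exprn_gt0 ?lama_gt0// mulr1.
by rewrite ler_sqr ?nnegrE ?powR_ge0// lama_le.
Qed.

(** A^alpha is onto H: the vector is the preimage of the element of H with coefficients lam_j^alpha
    c_j. *)
Lemma frac_exists (c : nat -> R) (B : R) : 0 <= B ->
  (forall N, \sum_(0 <= j < N) (lam j `^ a * c j) ^+ 2 <= B ^+ 2) ->
  exists2 x : X, forall j, dot x (e j) = c j & `|x| <= B.
Proof.
move=> B0 hB; have [w wE] := @coef_series _ _ A (fun j => lam j `^ a * c j) _ hB.
have [u du uw] := fracpow_surj A w (ge0 alpha).
have du' : u \in [pred u | `[< fracdom A a u >]] by apply/asboolP.
have uE j : dot (FracSpace du' : X) (e j) = c j.
  have /= h := fracpow_coef j du; move: h; rewrite uw wE => /(mulfI _) -> //.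
  by rewrite gt_eqF// lama_gt0.
exists (FracSpace du' : X) => //; apply: fracnorm_ub => // N.
by under eq_bigr do rewrite uE.
Qed.

(* The vector with coefficients [c], and a junk value when there is none. *)
Definition mkX (c : nat -> R) : X :=
  locked (xget 0 [set x : X | forall j, dot x (e j) = c j]).

Lemma mkX_coef (c : nat -> R) (B : R) : 0 <= B ->
  (forall N, \sum_(0 <= j < N) (lam j `^ a * c j) ^+ 2 <= B ^+ 2) ->
  (forall j, dot (mkX c) (e j) = c j) /\ `|mkX c| <= B.
Proof.
move=> B0 hB; have [x xE xB] := frac_exists B0 hB.
have mE : forall j, dot (mkX c) (e j) = c j.
  by rewrite /mkX -lock; case: xgetP => [y _ //|/(_ x)]; case.
by split => //; rewrite (_ : mkX c = x)//; apply: frac_eq => j; rewrite mE.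
Qed.

Lemma coefD x y j : dot (x + y : X) (e j) = dot x (e j) + dot y (e j).
Proof. by rewrite fracvalD dotDl. Qed.

Lemma coefB x y j : dot (x - y : X) (e j) = dot x (e j) - dot y (e j).
Proof. by rewrite fracvalB dotBl. Qed.

Lemma coef0 j : dot (0 : X) (e j) = 0.
Proof. by rewrite fracval0 dot0l. Qed.

Lemma fracP_coef n x j : dot (fracP n x) (e j) = if (j < n)%N then dot x (e j) else 0.
Proof. exact: projP_coef. Qed.

Lemma fracQ_coef n x j : dot (fracQ n x) (e j) = if (j < n)%N then 0 else dot x (e j).
Proof. by rewrite coefB fracP_coef; case: ifP => _; rewrite ?subrr ?subr0. Qed.

Lemma sum_restrict_le (p : pred nat) x N :
  \sum_(0 <= j < N) (lam j `^ a * (if p j then dot x (e j) else 0)) ^+ 2 <= `|x| ^+ 2.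
Proof.
apply: le_trans (fracnorm_lb x N); apply: ler_sum => j _.
by case: ifP => _//; rewrite mulr0 expr0n/= sqr_ge0.
Qed.

Lemma fracP_norm n x : `|fracP n x| <= `|x|.
Proof.
apply: fracnorm_ub => // N; apply: le_trans (sum_restrict_le (fun j => (j < n)%N) x N).
by under eq_bigr do rewrite fracP_coef.
Qed.

Lemma fracQ_norm n x : `|fracQ n x| <= `|x|.
Proof.
apply: fracnorm_ub => // N; apply: le_trans (sum_restrict_le (fun j => ~~ (j < n)%N) x N).
by under eq_bigr do rewrite fracQ_coef -if_neg.
Qed.

Lemma fracPQ n x : fracP n x + fracQ n x = x.
Proof. by rewrite /fracQ addrC subrK. Qed.

Lemma fracPB n x y : fracP n (x - y) = fracP n x - fracP n y.
Proof. by apply: frac_eq => j; rewrite coefB !fracP_coef coefB; case: ifP; rewrite ?subr0. Qed.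

Lemma fracQB n x y : fracQ n (x - y) = fracQ n x - fracQ n y.
Proof. by apply: frac_eq => j; rewrite coefB !fracQ_coef coefB; case: ifP; rewrite ?subr0. Qed.

Lemma PnHP n x : PnH A alpha n x <-> fracP n x = x.
Proof.
split=> [[u xE]|<-]; last by exists (x : H).
by apply: frac_eq => j; rewrite fracP_coef xE projP_coef; case: (j < n)%N.
Qed.

Lemma fracQ_cvg0 (x : X) : (fun M => fracQ M x) @ \oo --> (0 : X).
Proof.
apply/cvgr0Pnorm_le => eps eps0.
have := @fracdom_val _ _ _ _ x => /cauchy_cvgP/cauchy_seriesP/(_ _ (exprn_gt0 2 eps0)).
case=> -[P Q] /= [[m _ mP] [k _ kQ]] hPQ.
exists (maxn m k) => // M /= hM; apply: fracnorm_ub => [|N]; first exact: ltW.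
have [MN|NM] := leqP M N; last first.
  rewrite big_nat big1 ?sqr_ge0// => j /andP[_ jN].
  by rewrite fracQ_coef (ltn_trans jN NM) mulr0 expr0n.
rewrite (big_cat_nat (n := M))//= [X in X + _](_ : _ = 0) ?add0r; last first.
  by rewrite big_nat big1// => j /andP[_ jM]; rewrite fracQ_coef jM mulr0 expr0n.
have /= := hPQ (M, N); rewrite geq_max in hM; case/andP: hM => mM kM.
move=> /(_ (conj (mP _ mM) (kQ _ (leq_trans kM MN)))).
rewrite ger0_norm ?sumr_ge0// => [/ltW|j _]; last exact: sqr_ge0.
apply: le_trans; rewrite [leLHS]big_nat [leRHS]big_nat; apply: ler_sum => j /andP[Mj _].
by rewrite fracQ_coef ltnNge Mj.
Qed.

End fractional_coefficients.

(** * Measurability through coefficients *)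

Section borel_measurability.
Context {R : realType}.

Lemma continuous_borel_measurable (V : normedModType R) (g : V -> R) :
  continuous g -> measurable_fun setT (g : borel V -> R).
Proof.
move=> cg; apply: (@measurability _ _ (borel V) R setT g _ (@RGenOInfty.measurableE R)).
move=> _ [_ [a ->] <-]; rewrite setTI; apply: sub_sigma_algebra.
by move/continuousP: cg; apply; exact: interval_open.
Qed.

Lemma lipschitz_continuous (V W : normedModType R) (g : V -> W) (k : R) :
  (forall u v, `|g u - g v| <= k * `|u - v|) -> continuous g.
Proof.
move=> gk u; apply/cvgrPdist_le => eps eps0.
have k0 : 0 < `|k| + 1 by rewrite ltr_wpDl.
have /cvgrPdist_le/(_ _ (divr_gt0 eps0 k0)) := @cvg_id _ (nbhs u).
apply: filterS => v huv; apply: (le_trans (gk _ _)).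
apply: (@le_trans _ _ ((`|k| + 1) * (eps / (`|k| + 1)))); last first.
  by rewrite mulrC divfK// gt_eqF.
apply: (@le_trans _ _ ((`|k| + 1) * `|u - v|)); last by rewrite ler_pM2l.
by rewrite ler_wpM2r// (le_trans (ler_norm k))// lerDl.
Qed.

Lemma lipschitz_borel_measurable (V W : normedModType R) (g : V -> W) (k : R) :
  (forall u v, `|g u - g v| <= k * `|u - v|) ->
  measurable_fun setT (g : borel V -> borel W).
Proof.
move=> /lipschitz_continuous cg.
apply: (@measurability _ _ (borel V) (borel W) setT g (@open W)) => // _ [U oU <-].
by rewrite setTI; apply: sub_sigma_algebra; move/continuousP: cg; exact.
Qed.

Lemma separable_dense_seq (V : normedModType R) : separable V ->
  exists u : nat -> V, forall v eps, 0 < eps -> exists m, `|v - u m| < eps.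
Proof.
move=> [S cS dS]; have S0 v eps : 0 < eps -> exists2 c, S c & `|v - c| < eps.
  move=> eps0; have oB : open (ball v eps) by exact: ball_open.
  have [|c [vc Sc]] := dS (ball v eps) _ oB.
    by exists v; exact: ballxx.
  by exists c => //; rewrite -ball_normE in vc.
(* A countable set is empty, which density excludes, or the image of a sequence. *)
case/pfcard_geP: cS => [SE|[u]].
  by have [c] := S0 0 1 ltr01; rewrite SE.
exists u => v eps /(S0 v)[c Sc vc].
have [m _ mc] := @surj _ _ _ _ u c Sc.
by exists m; rewrite mc.
Qed.

(** An open set is the union of the countably many balls it contains that have centre in a dense
    sequence and radius 1/(j+1); preimages of such balls are sublevel sets of distances. *)
Lemma separable_measurable (V : normedModType R) d (T : measurableType d)
    (D : set T) (f : T -> V) : separable V -> measurable D ->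
  (forall c, measurable_fun D (fun t => `|f t - c|)) ->
  measurable_fun D (f : T -> borel V).
Proof.
move=> /separable_dense_seq[u hu] mD mf.
apply: (@measurability _ _ T (borel V) D f (@open V)) => // _ [U oU <-].
pose F (m j : nat) := [set t | D t /\ (ball (u m) j.+1%:R^-1 `<=` U /\ `|f t - u m| < j.+1%:R^-1)].
have -> : D `&` f @^-1` U = \bigcup_m \bigcup_j F m j.
  apply/seteqP; split=> [t [Dt Ut]|t [m _ [j _ [Dt [h1 h2]]]]]; last first.
    by split => //; apply: h1; rewrite -ball_normE/= distrC.
  have /nbhs_ballP[eps /= eps0 epsU] : nbhs (f t : V) U by exact: open_nbhs_nbhs.
  have [j hj] : exists j, j.+1%:R^-1 < eps / 2.
    have [m _ /(_ m)] := near_infty_natSinv_lt (PosNum (divr_gt0 eps0 (ltr0Sn _ 1))).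
    by move=> /(_ (leqnn m)); exists m.
  have j0 : 0 < j.+1%:R^-1 :> R by rewrite invr_gt0.
  have [m hm] := hu (f t) _ j0.
  exists m => //; exists j => //; split=> //; split=> // v.
  rewrite -ball_normE/= => hv; apply: epsU; rewrite -ball_normE/=.
  rewrite (_ : f t - v = (f t - u m) + (u m - v)); last by rewrite addrA subrK.
  by rewrite (le_lt_trans (ler_normD _ _))// (splitr eps) ltrD// (lt_trans _ hj).
apply: bigcupT_measurable => m; apply: bigcupT_measurable => j.
have [bU|bU] := pselect (ball (u m) j.+1%:R^-1 `<=` U); last first.
  rewrite (_ : F m j = set0); first exact: measurable0.
  by apply/seteqP; split=> // t [_ []].
rewrite (_ : F m j = D `&` (fun t => `|f t - u m|) @^-1` `]-oo, j.+1%:R^-1[).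
  by apply: mf => //; exact: measurable_itv.
apply/seteqP; split=> t [Dt] /=; rewrite in_itv/=; first by case.
by move=> h; split.
Qed.

End borel_measurability.

Section coefficient_measurability.
Context {R : realType} {H : hilbertType R} (A : posOperator H) (alpha : {nonneg R}).
Local Notation e := (eigvec A).
Local Notation lam := (eigval A).
Local Notation a := (alpha%:num).
Local Notation X := (fracSpace A alpha).
Context {d} {T : measurableType d}.

Lemma norm_coef_cvg (u : H) :
  (fun N => Num.sqrt (\sum_(0 <= j < N) dot u (e j) ^+ 2)) @ \oo --> `|u|.
Proof.
have /(_ _) h := cvg_norm (eigvec_basis A u).
rewrite (_ : (fun N => _) = fun N => `|series (fun j => dot u (e j) *: e j) N|).
  exact: h.
by apply/funext => N; rewrite -(pythagoras A) sqrtr_sqr normr_id.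
Qed.

(** A form of Pettis' theorem along the eigenbasis: the distance to a fixed vector is a limit of
    square roots of partial sums of squared coefficients. *)
Lemma borel_coefP (f : T -> H) (D : set T) : separable H -> measurable D ->
  measurable_fun D (f : T -> borel H) <->
  forall i, measurable_fun D (fun t => dot (f t) (e i)).
Proof.
move=> hsep mD; split=> [mf i|mf].
  have m1 : measurable_fun setT ((fun u => dot u (e i)) : borel H -> R).
    by apply: continuous_borel_measurable => u; exact: cvg_dot.
  exact: (measurableT_comp m1 mf).
apply: separable_measurable => // c.
apply: (measurable_fun_cvg (h := fun N t =>
  Num.sqrt (\sum_(0 <= j < N) dot (f t - c) (e j) ^+ 2))) => [N|t _]; last exact: norm_coef_cvg.
apply: (@measurableT_comp _ _ _ _ _ _ (@Num.sqrt R)).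
  by apply: continuous_measurable_fun; exact: sqrt_continuous.
apply: measurable_sum => j; apply: measurable_funX.
by under eq_fun do rewrite dotBl; apply: measurable_funB.
Qed.

Lemma measurable_norm (f : T -> H) (D : set T) :
  (forall i, measurable_fun D (fun t => dot (f t) (e i))) ->
  measurable_fun D (fun t => `|f t|).
Proof.
move=> mf; apply: (measurable_fun_cvg (h := fun N t =>
  Num.sqrt (\sum_(0 <= j < N) dot (f t) (e j) ^+ 2))) => [N|t _]; last exact: norm_coef_cvg.
apply: (@measurableT_comp _ _ _ _ _ _ (@Num.sqrt R)).
  by apply: continuous_measurable_fun; exact: sqrt_continuous.
by apply: measurable_sum => j; apply: measurable_funX.
Qed.

(** A^alpha is an isometry of D(A^alpha) onto H, so a dense sequence of H pulls back. *)
Lemma frac_separable : separable H -> separable X.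
Proof.
move=> /separable_dense_seq[u hu].
have hc m : exists x : X, fracpow A a x = u m.
  have [w dw wE] := fracpow_surj A (u m) (ge0 alpha).
  have dw' : w \in [pred u | `[< fracdom A a u >]] by apply/asboolP.
  by exists (FracSpace dw').
have [v vE] := choice hc.
exists (range v); first exact: (card_le_trans (card_image_le _ _) (countableP _)).
move=> O [x Ox] oO; have /nbhs_ballP[eps /= eps0 epsO] : nbhs x O by exact: open_nbhs_nbhs.
have [m hm] := hu (fracpow A a x) _ eps0.
exists (v m); split; last by exists m.
apply: epsO; rewrite -ball_normE/= fracnormE fracvalB addrC -scaleN1r fracpow_linear.
- by rewrite vE scaleN1r addrC.
- exact: fracdom_val.
- exact: fracdom_val.
Qed.

Lemma dot_frac_continuous i : continuous (fun x : X => dot x (e i)).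
Proof.
apply: (@lipschitz_continuous _ X R^o (fun x : X => dot x (e i)) ((lam 0%N `^ a)^-1)) => x y.
by rewrite -coefB (le_trans (coef_le _ _ _))// frac_norm_le.
Qed.

Lemma measurable_fracnorm (f : T -> X) (D : set T) :
  (forall i, measurable_fun D (fun t => dot (f t) (e i))) ->
  measurable_fun D (fun t => `|f t|).
Proof.
move=> mf; apply: measurable_norm => j.
under eq_fun do rewrite (fracpow_coef _ (@fracdom_val _ _ _ _ _)).
exact: measurable_funM.
Qed.

Lemma borel_fraccoefP (f : T -> X) (D : set T) : separable H -> measurable D ->
  measurable_fun D (f : T -> borel X) <->
  forall i, measurable_fun D (fun t => dot (f t) (e i)).
Proof.
move=> hsep mD; split=> [mf i|mf].
  have m1 : measurable_fun setT ((fun u : X => dot u (e i)) : borel X -> R).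
    by apply: continuous_borel_measurable; exact: dot_frac_continuous.
  exact: (measurableT_comp m1 mf).
apply: separable_measurable => //; first exact: frac_separable.
move=> c; apply: measurable_fracnorm => i.
by under eq_fun do rewrite coefB; apply: measurable_funB.
Qed.

(** A nonlinear F mixes all coefficients, so the argument has to pass through the Borel
    sigma-algebras, where composition is available. *)
Lemma lipschitz_coef_measurable (F : X -> H) (L : R) (f : T -> X) (D : set T) :
  separable H -> measurable D -> (forall u v, `|F u - F v| <= L * `|u - v|) ->
  (forall i, measurable_fun D (fun t => dot (f t) (e i))) ->
  forall i, measurable_fun D (fun t => dot (F (f t)) (e i)).
Proof.
move=> hsep mD FL mf; apply/(borel_coefP (F \o f) hsep mD).
have mF := lipschitz_borel_measurable FL.
exact: (measurableT_comp mF ((borel_fraccoefP f hsep mD).2 mf)).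
Qed.

End coefficient_measurability.

(** * Lebesgue integrals *)

Section affine_change_of_variable.
Context {R : realType}.
Local Notation leb := (@lebesgue_measure R).

(** The image of Lebesgue measure under the affine map, multiplied by [c], agrees with Lebesgue
    measure on half-open intervals, hence everywhere by uniqueness. *)
Lemma ge0_integral_affine (f : R -> \bar R) (c b : R) : 0 < c ->
  measurable_fun setT f -> (forall s, (0 <= f s)%E) ->
  (\int[leb]_s f s = c%:E * \int[leb]_s f (c * s + b)%R)%E.
Proof.
move=> c0 mf f0; pose phi (s : measurableTypeR R) : measurableTypeR R := c * s + b.
have mphi : measurable_fun setT phi.
  by apply: measurable_funD => //; exact: measurable_funM.
have := @ge0_integral_pushforward _ _ _ _ R phi mphi leb setT f measurableT mf.
rewrite preimage_setT => /(_ (fun y _ => f0 y)) /= <-.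
have mphi_mixin := isMeasurableFun.Build _ _ _ _ _ mphi.
pose mphi_pack : {mfun measurableTypeR R >-> measurableTypeR R} := MeasurableFun.Pack (MeasurableFun.Class mphi_mixin).
rewrite -(@ge0_integral_mscale _ _ R (pushforward leb mphi_pack) setT measurableT (NngNum (ltW c0)) f)//.
apply: eq_measure_integral => A mA _.
have := @lebesgue_measure_unique R (mscale (NngNum (ltW c0)) (pushforward leb mphi_pack)).
apply => //; move=> _ [[x y]] _ <- /=.
rewrite /mscale/= /pushforward.
have -> : phi @^-1` `]x, y] = `](x - b) / c, (y - b) / c]%classic.
  apply/seteqP; split=> s /=; rewrite !in_itv/= /phi ltr_pdivrMr// ler_pdivlMr// (mulrC s) ltrBlDr lerBrDr//.
rewrite !lebesgue_measure_itv/= !lte_fin ltr_pM2r ?invr_gt0// ltrD2r.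
case: ifPn => _; last by rewrite mule0.
by rewrite -!EFinB -EFinM; congr (_%:E); field; rewrite gt_eqF.
Qed.

Lemma integral_shift (f : R -> \bar R) (b : R) : measurable_fun setT f ->
  (\int[leb]_s f (s + b)%R = \int[leb]_s f s)%E.
Proof.
have ge0 (h : R -> \bar R) : measurable_fun setT h -> (forall s, (0 <= h s)%E) ->
    (\int[leb]_s h (s + b)%R = \int[leb]_s h s)%E.
  move=> mh h0; rewrite [RHS](ge0_integral_affine b ltr01)// mul1e.
  by under [RHS]eq_integral do rewrite mul1r.
move=> mf; rewrite [LHS]integralE [RHS]integralE; congr (_ - _)%E.
  rewrite -(ge0 _ (measurable_funepos mf))//.
  by apply: eq_integral => s _; rewrite !funeposE.
rewrite -[RHS](ge0 _ (measurable_funeneg mf))//.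
by apply: eq_integral => s _; rewrite !funenegE.
Qed.

Lemma integral_opp (f : R -> \bar R) : measurable_fun setT f ->
  (forall s, (0 <= f s)%E) ->
  (\int[leb]_s f (- s)%R = \int[leb]_s f s)%E.
Proof.
move=> mf f0; have mo : measurable_fun setT (-%R : measurableTypeR R -> measurableTypeR R) by exact: oppr_measurable.
have := @ge0_integral_pushforward _ _ _ _ R _ mo leb setT f measurableT mf.
rewrite preimage_setT => /(_ (fun y _ => f0 y)) /= <-.
by apply: eq_measure_integral => //= A mA AS; exact: lebesgue_measureN.
Qed.

End affine_change_of_variable.

Section lebesgue_integrable_functions.
Context {R : realType}.
Local Notation leb := (@lebesgue_measure R).
Local Notation mR := (measurableTypeR R).
Local Notation L1 D f := (leb.-integrable (D : set mR) (EFin \o f)).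
Implicit Types (D : set mR) (f g : mR -> R).

Lemma L1_measurable D f : L1 D f -> measurable_fun D f.
Proof. by move=> /measurable_int/measurable_EFinP. Qed.

Lemma L1_le D f g : measurable D -> measurable_fun D f ->
  (forall s, D s -> `|f s| <= g s) -> L1 D g -> L1 D f.
Proof.
move=> mD mf fg; apply: le_integrable => //; first exact/measurable_EFinP.
by move=> s Ds /=; rewrite lee_fin (le_trans (fg _ Ds))// ler_norm.
Qed.

Lemma L1Z D f c : measurable D -> L1 D f -> L1 D (fun s => c * f s).
Proof. by move=> mD fi; exact: (integrableZl mD c fi). Qed.

Lemma L1D D f g : measurable D -> L1 D f -> L1 D g -> L1 D (fun s => f s + g s).
Proof. by move=> mD fi gi; exact: (integrableD mD fi gi). Qed.

Lemma L1_sub D D' f : measurable D -> measurable D' -> D' `<=` D -> L1 D f -> L1 D' f.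
Proof. by move=> mD mD' DD; exact: integrableS. Qed.

Lemma L1_eq D f g : measurable D -> (forall s, D s -> f s = g s) -> L1 D f -> L1 D g.
Proof. by move=> mD fg; apply: (eq_integrable mD) => s /set_mem Ds /=; rewrite fg. Qed.

Lemma L1_sum D (h : nat -> mR -> R) N : measurable D ->
  (forall i, (i < N)%N -> L1 D (h i)) -> L1 D (fun s => \sum_(0 <= i < N) h i s).
Proof.
move=> mD hi; have := integrable_sum mD (index_iota 0 N) (P := fun i => (i < N)%N)
  (h := fun i s => (h i s)%:E) hi.
by apply: (eq_integrable mD) => s _ /=; rewrite sumEFin [in RHS]big_nat.
Qed.

Lemma L1_restrict D f : measurable D ->
  L1 D f <-> L1 setT (fun s => if s \in D then f s else 0).
Proof.
move=> mD; rewrite (integrable_mkcond _ mD).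
rewrite (_ : (EFin \o f) \_ D = EFin \o (fun s => if s \in D then f s else 0))//.
by apply/funext => s; rewrite patchE/=; case: ifP.
Qed.

Lemma Rintegral_restrict D f :
  \int[leb]_(s in D) f s = \int[leb]_s (if s \in D then f s else 0).
Proof.
by rewrite Rintegral_mkcond; apply: eq_Rintegral => s _; rewrite patchE.
Qed.

Lemma Rintegral_sum D (h : nat -> mR -> R) N : measurable D ->
  (forall i, (i < N)%N -> L1 D (h i)) ->
  \int[leb]_(s in D) (\sum_(0 <= i < N) h i s) = \sum_(0 <= i < N) \int[leb]_(s in D) h i s.
Proof.
move=> mD; elim: N => [|N IH] hi.
  by rewrite big_nil; under eq_Rintegral do rewrite big_nil; rewrite Rintegral_cst// mul0r.
under eq_Rintegral do rewrite big_nat_recr//=.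
rewrite big_nat_recr//= RintegralD//; last exact: hi.
  by rewrite IH// => i iN; apply: hi; exact: ltnW.
by apply: L1_sum => // i iN; apply: hi; exact: ltnW.
Qed.

Lemma L1_shift f (b : R) : L1 setT f -> L1 setT (fun s : R => f (s + b)).
Proof.
move=> fi; have mf := L1_measurable fi.
have mfb : measurable_fun [set: mR] (fun s : R => f (s + b)).
  by apply: (measurableT_comp mf); exact: measurable_funD.
apply/integrableP; split; first exact/measurable_EFinP.
case/integrableP: fi => _; rewrite -(integral_shift b)//.
by apply/measurableT_comp => //; exact/measurable_EFinP.
Qed.

Lemma Rintegral_shift f (b : R) : measurable_fun setT f ->
  \int[leb]_s f (s + b)%R = \int[leb]_s f s.
Proof.
move=> mf; rewrite /Rintegral -(@integral_shift _ (EFin \o f) b)//.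
exact/measurable_EFinP.
Qed.

Lemma L1_bounded (a b M : R) f : measurable_fun (`[a, b]%classic : set mR) f ->
  (forall s : R, a <= s <= b -> `|f s| <= M) -> L1 `[a, b] f.
Proof.
move=> mf fM; apply: (@L1_le _ _ (fun=> M)) => //.
apply/integrableP; split; first exact/measurable_EFinP.
rewrite integral_cst//= lebesgue_measure_itv/=.
by case: ifP => _; rewrite ?mule0// -EFinB -EFinM ltry.
Qed.

End lebesgue_integrable_functions.

Section real_integrals.
Context {R : realType}.
Local Notation leb := (@lebesgue_measure R).
Local Notation mR := (measurableTypeR R).
Local Notation L1 D f := (leb.-integrable (D : set mR) (EFin \o f)).

(** Tonelli applies to the positive and negative parts, and taking their difference and then [fine]
    preserves measurability; so integrability for each parameter does not have to be tracked. *)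
Lemma measurable_Rintegral_param d (T : measurableType d) (f : T * R -> R) :
  measurable_fun setT f -> measurable_fun setT (fun t => \int[leb]_s f (t, s)).
Proof.
move=> mf; rewrite /Rintegral; apply: measurableT_comp => //.
have mE : measurable_fun setT (EFin \o f) by exact/measurable_EFinP.
have mp : measurable_fun setT (fun t => \int[leb]_s (EFin \o f)^\+%E (t, s))%E.
  by apply: measurable_fun_fubini_tonelli_F => //; exact: measurable_funepos.
have mn : measurable_fun setT (fun t => \int[leb]_s (EFin \o f)^\-%E (t, s))%E.
  by apply: measurable_fun_fubini_tonelli_F => //; exact: measurable_funeneg.
rewrite (_ : (fun t => _) = fun t => ((\int[leb]_s (EFin \o f)^\+%E (t, s)) -
    \int[leb]_s (EFin \o f)^\-%E (t, s))%E); first exact: emeasurable_funB.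
apply/funext => t; rewrite integralE; congr (_ - _)%E; apply: eq_integral => s _.
  by rewrite !funeposE.
by rewrite !funenegE.
Qed.

(** Duality: with y_i the integral of psi_i and S the sum of the y_i^2, S is the integral of the sum
    of the y_i psi_i, at most sqrt S times the integral of b by pointwise Cauchy-Schwarz. Dividing
    by sqrt S concludes. *)
Lemma minkowski_Rintegral (N : nat) (psi : nat -> R -> R) (b : R -> R) :
  (forall i, measurable_fun setT (psi i)) ->
  leb.-integrable setT (EFin \o b) -> (forall s, 0 <= b s) ->
  (forall s, \sum_(0 <= i < N) psi i s ^+ 2 <= b s ^+ 2) ->
  \sum_(0 <= i < N) (\int[leb]_s psi i s) ^+ 2 <= (\int[leb]_s b s) ^+ 2.
Proof.
move=> mpsi ib b0 hb.
have ipsi i : (i < N)%N -> leb.-integrable setT (EFin \o psi i).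
  move=> iN; apply: le_integrable ib => //; first by apply/measurable_EFinP; exact: mpsi.
  move=> s _ /=; rewrite lee_fin (ger0_norm (b0 s)) -ler_sqr ?nnegrE//.
  rewrite real_normK ?num_real// (le_trans _ (hb s))//.
  rewrite (bigD1_seq i) ?mem_index_iota ?iota_uniq//= lerDl.
  by apply: sumr_ge0 => j _; exact: sqr_ge0.
pose y i := \int[leb]_s psi i s; pose S := \sum_(0 <= i < N) y i ^+ 2.
rewrite -/S; have S0 : 0 <= S by apply: sumr_ge0 => j _; exact: sqr_ge0.
have [->|Sn0] := eqVneq S 0; first exact: sqr_ge0.
have Sp : 0 < Num.sqrt S by rewrite sqrtr_gt0 lt0r Sn0.
(* Cauchy-Schwarz from the nonnegative sum of the squares (sqrt S psi_i - b y_i)^2. The final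
   division needs [b s != 0]; if [b s = 0], all the psi_i vanish at [s]. *)
have cs s : \sum_(0 <= i < N) y i * psi i s <= Num.sqrt S * b s.
  have := hb s; have [bs0|bn0] := eqVneq (b s) 0.
    rewrite bs0 expr0n/= mulr0 => hs.
    have h0 : \sum_(0 <= i < N) psi i s ^+ 2 = 0.
      by apply/eqP; rewrite eq_le hs/= sumr_ge0// => j _; exact: sqr_ge0.
    rewrite big_nat big1// => i /= iN.
    have := psumr_eq0P (P := fun i : 'I_N => true) (F := fun i : 'I_N => psi i s ^+ 2).
    move=> /(_ (fun j _ => sqr_ge0 _)); rewrite -(big_mkord xpredT (fun i => psi i s ^+ 2)) h0.
    by move=> /(_ erefl (Ordinal iN) isT)/eqP; rewrite sqrf_eq0 => /eqP/= ->; rewrite mulr0.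
  have bp : 0 < b s by rewrite lt0r bn0 b0.
  move=> hs.
  have : 0 <= \sum_(0 <= i < N) (Num.sqrt S * psi i s - b s * y i) ^+ 2.
    by apply: sumr_ge0 => j _; exact: sqr_ge0.
  have -> : \sum_(0 <= i < N) (Num.sqrt S * psi i s - b s * y i) ^+ 2 =
      S * (\sum_(0 <= i < N) psi i s ^+ 2) + b s ^+ 2 * S
      - 2 * Num.sqrt S * b s * \sum_(0 <= i < N) y i * psi i s.
    rewrite {2 3}/S !mulr_sumr -big_split/= -sumrB; apply: eq_bigr => i _.
    by rewrite -[in S * _](sqr_sqrtr S0); ring.
  rewrite subr_ge0 => h.
  have {h} h : 2 * Num.sqrt S * b s * (\sum_(0 <= i < N) y i * psi i s) <= 2 * S * b s ^+ 2.
    apply: (le_trans h); rewrite -lerBrDr (_ : 2 * S * b s ^+ 2 - b s ^+ 2 * S = S * b s ^+ 2); last by ring.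
    by rewrite ler_wpM2l.
  rewrite -(@ler_pM2l _ (2 * Num.sqrt S * b s)) ?mulr_gt0// (le_trans h)//.
  by rewrite -[in leLHS](sqr_sqrtr S0) le_eqVlt; apply/orP; left; apply/eqP; ring.
have iy i : (i < N)%N -> L1 setT (fun s => y i * psi i s).
  by move=> iN; apply: L1Z => //; exact: ipsi.
have SE : S = \int[leb]_s \sum_(0 <= i < N) y i * psi i s.
  rewrite Rintegral_sum// /S big_nat [RHS]big_nat; apply: eq_bigr => i /= iN.
  by rewrite RintegralZl// ?ipsi// expr2.
have ile : S <= Num.sqrt S * \int[leb]_s b s.
  rewrite {1}SE -RintegralZl//; apply: le_Rintegral => //; first exact: L1_sum.
  exact: L1Z.
have B0 : 0 <= \int[leb]_s b s by exact: Rintegral_ge0.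
have : Num.sqrt S <= \int[leb]_s b s.
  by rewrite -(@ler_pM2l _ (Num.sqrt S))// -expr2 sqr_sqrtr.
by rewrite -(@ler_sqr _ (Num.sqrt S)) ?nnegrE// ?sqr_sqrtr// ltW.
Qed.

End real_integrals.

(** * The Gamma integral and the smoothing estimate for the linear flow *)

Section kernel_integrals.
Context {R : realType}.
Local Notation leb := (@lebesgue_measure R).
Local Notation mR := (measurableTypeR R).
Local Notation L1 D f := (leb.-integrable (D : set mR) (EFin \o f)).

Lemma L1_bigcup (F : nat -> set mR) (f : mR -> R) (C : R) :
  nondecreasing_seq F -> (forall i, measurable (F i)) -> measurable_fun setT f ->
  (forall s, 0 <= f s) -> (forall i, \int[leb]_(s in F i) (f s)%:E <= C%:E)%E ->
  L1 (\bigcup_i F i) f.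
Proof.
move=> ndF mF mf f0 hC; apply/integrableP; split.
  by apply/measurable_EFinP; apply: measurable_funS mf => //.
under eq_integral do rewrite /= (ger0_norm (f0 _)).
have mFf i : measurable_fun (F i) (EFin \o f).
  by apply/measurable_EFinP; apply: measurable_funS mf => //.
have f0' i x : F i x -> (0 <= (EFin \o f) x)%E by move=> _; rewrite lee_fin.
have h := ge0_nondecreasing_set_cvg_integral ndF mF mFf f0'.
apply: (@le_lt_trans _ _ C%:E); last exact: ltry.
have hl := h leb; rewrite -(cvg_lim _ hl)//.
apply: lime_le; first by apply/cvg_ex; eexists; exact: hl.
exact: nearW.
Qed.

Lemma expR_integral (d : R) : 0 < d ->
  L1 `]0, +oo[ (fun s => expR (- (d * s))) /\
  \int[leb]_(s in `]0, +oo[) expR (- (d * s)) = d^-1.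
Proof.
move=> d0; have h := integral_exponential_pdf d0.
have ip := integrable_exponential_pdf d0.
have i1 : L1 `[0, +oo[ (fun s => d * expR (- (d * s))).
  have := (@integrableS _ _ R leb setT `[0, +oo[%classic _ measurableT (measurable_itv _) (@subsetT _ _) ip).
  apply: eq_integrable => // s /= s0; rewrite /exponential_pdf patchE s0.
  by rewrite mulNr.
have i2 : L1 `[0, +oo[ (fun s => expR (- (d * s))).
  have := L1Z d^-1 (measurable_itv _) i1; apply: L1_eq => // s _ /=.
  by rewrite mulrA mulVf ?mul1r// gt_eqF.
have i3 : L1 `]0, +oo[ (fun s => expR (- (d * s))).
  by apply: L1_sub i2 => // s /=; rewrite !in_itv/= !andbT => /ltW.
split => //; rewrite Rintegral_itv_obnd_cbnd//.
apply: (mulfI (lt0r_neq0 d0)); rewrite divff ?gt_eqF// -RintegralZl//.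
rewrite /Rintegral -[RHS]/(fine 1%:E) -h [in RHS]/exponential_pdf.
rewrite integral_mkcond; congr fine; apply: eq_integral => s _.
by rewrite !patchE; case: ifP => // _; rewrite mulNr.
Qed.

(** Dyadic decomposition: on the interval from 2^-(m+1) to 2^-m the integral is at most q^(m+1) with
    q = 2^-(1-b) < 1, and the geometric series bounds the total. *)
Lemma powR_near0_integrable (b : R) : 0 <= b < 1 -> L1 `]0, 1] (fun s => s `^ (- b)).
Proof.
move=> /andP[b0 b1]; pose F m : set mR := `](2^-1 ^+ m), 1]%classic.
pose q : R := 2^-1 `^ (1 - b).
have q0 : 0 < q by rewrite powR_gt0.
have q1 : q < 1.
  suff : q < 1 `^ (1 - b) by rewrite powR1.
  by apply: gt0_ltr_powR; rewrite ?nnegrE ?subr_gt0// invf_lt1// ltr1n.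
have half0 m : 0 < 2^-1 ^+ m :> R by rewrite exprn_gt0.
have ndF : nondecreasing_seq F.
  apply/nondecreasing_seqP => m; rewrite /F subsetEset => s /=; rewrite !in_itv/=.
  case/andP => h ->; rewrite andbT (le_lt_trans _ h)// exprS ler_piMl ?(ltW (half0 _))//.
  by rewrite invf_le1// ler1n.
have mpow : measurable_fun [set: mR] (fun s : R => s `^ (- b)) by exact: measurable_powR.
have -> : `]0%R, 1%R]%classic = \bigcup_i F i.
  apply/seteqP; split=> [s|s [i _]]; rewrite /F/= !in_itv/=; last first.
    by case/andP => h ->; rewrite andbT (lt_trans _ h).
  case/andP => s0 s1.
  have := @cvg_geometric R 1 2^-1; rewrite ger0_norm// invf_lt1// ltr1n => /(_ isT).
  move/cvgr0Pnorm_lt => /(_ _ s0)[m _ /(_ m (leqnn m))]; rewrite /geometric/= mul1r.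
  by rewrite ger0_norm ?(ltW (half0 _))// => hm; exists m => //=; rewrite in_itv/= hm s1.
apply: (@L1_bigcup F _ ((1 - q)^-1)) => //.
- by move=> i; exact: measurable_itv.
- by move=> s; exact: powR_ge0.
move=> m; apply: (@le_trans _ _ (\sum_(0 <= j < m) q ^+ j)%:E); last first.
  rewrite lee_fin; have := @geometric_seriesE R 1 q; rewrite lt_eqF// => /(_ isT).
  move=> /(congr1 (fun u => u m)); rewrite /series/= /geometric/=.
  under eq_bigr do rewrite mul1r.
  move=> ->; rewrite mul1r ler_pdivrMr ?subr_gt0// mulVf ?gt_eqF ?subr_gt0//.
  by rewrite gerBl exprn_ge0// ltW.
elim: m => [|m IH].
  by rewrite big_nil /F expr0 set_itv_ge ?integral_set0// bnd_simp ltxx.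
have FE : F m.+1 = `](2^-1 ^+ m.+1), (2^-1 ^+ m)]%classic `|` F m.
  rewrite /F -(@itv_bndbnd_setU _ _ (BRight (2^-1 ^+ m.+1)) (BRight (2^-1 ^+ m)) (BRight 1))// !bnd_simp.
    by rewrite exprS ler_piMl ?(ltW (half0 _))// invf_le1// ler1n.
  by rewrite exprn_ile1// invf_le1// ler1n.
rewrite FE ge0_integral_setU//=.
- rewrite big_nat_recr//= EFinD addeC leeD//.
  apply: (@le_trans _ _ (\int[leb]_(s in `](2^-1 ^+ m.+1)%R, (2^-1 ^+ m)%R]) ((2^-1 ^+ m.+1) `^ (- b))%:E)%E).
    apply: ge0_le_integral => //.
    + by move=> s _; rewrite lee_fin powR_ge0.
    + by apply/measurable_EFinP; apply: measurable_funS mpow.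
    + move=> s /=; rewrite in_itv/= => /andP[h _]; rewrite lee_fin !powRN.
      rewrite lef_pV2 ?posrE ?powR_gt0// ?(lt_trans _ h)//.
      by apply: ge0_ler_powR; rewrite ?nnegrE//; apply: ltW => //; exact: lt_trans h.
  rewrite integral_cst//= lebesgue_measure_itv/= lte_fin.
  case: ifPn => _; last by rewrite mule0 lee_fin exprn_ge0// ltW.
  rewrite -EFinB -EFinM lee_fin.
  have -> : 2^-1 ^+ m - 2^-1 ^+ m.+1 = 2^-1 ^+ m.+1 :> R by rewrite exprS; lra.
  rewrite -[X in _ * X <= _]powRr1 ?(ltW (half0 _))// -powRD; last first.
    by rewrite (gt_eqF (half0 _)) implybT.
  rewrite addrC -(@powR_mulrn _ 2^-1 m.+1)// -powRrM mulrC powRrM -/q powR_mulrn ?(ltW q0)//.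
  by rewrite exprS ler_piMl ?exprn_ge0 ?(ltW q0)// ltW.
- exact: measurable_itv.
- by apply/measurable_EFinP; apply: measurable_funS mpow.
- by move=> s _; rewrite lee_fin powR_ge0.
- rewrite disj_set2E; apply/eqP; apply/seteqP; split=> // s [] /=; rewrite /F/= !in_itv/=.
  by case/andP => _ h /andP[]; rewrite ltNge h.
Qed.

Lemma gamma_integrable (b : R) : 0 <= b < 1 ->
  L1 `]0, +oo[ (fun s => s `^ (- b) * expR (- s)).
Proof.
move=> hb; have [i1 _] := expR_integral ltr01.
have mpow : measurable_fun [set: mR] (fun s : R => s `^ (- b)) by exact: measurable_powR.
have mexp : measurable_fun [set: mR] (fun s : R => expR (- s)).
  by apply: measurableT_comp; [exact: measurable_expR|exact: oppr_measurable].
(* The dominating function: on []0, 1]] the exponential is at most 1, beyond 1 the power is at most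
   1. *)
pose g (s : R) := (if s \in `]0%R, 1%R]%classic then s `^ (- b) else 0) + expR (- (1 * s)).
have ig : L1 `]0, +oo[ g.
  apply: L1D => //.
  have /(L1_restrict _ (measurable_itv _)) h := powR_near0_integrable hb.
  exact: L1_sub h.
apply: (@L1_le _ _ _ g) => //.
  by apply: measurable_funS (measurable_funM mpow mexp).
move=> s /=; rewrite in_itv/= andbT => s0.
rewrite ger0_norm ?mulr_ge0 ?powR_ge0 ?expR_ge0// /g mul1r mem_setE in_itv/= s0/=.
case: ifPn => [s1|]; last rewrite -ltNge => s1.
  rewrite (@le_trans _ _ (s `^ (- b)))// ?lerDl ?expR_ge0//.
  by rewrite ler_piMr ?powR_ge0// -expR0 ler_expR oppr_le0 ltW.
rewrite add0r ler_piMl ?expR_ge0// powRN invf_le1 ?powR_gt0//.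
by rewrite -(powRr0 s) ler_powR ?(ltW s1)//; case/andP: hb.
Qed.

(* For [b > 0], the maximum of [x ^ b * expR (- x * r)] over [x >= 0] is at most
   [sing b r], whose Laplace transform produces the constant c_alpha; for
   [b = 0] the term [lam n ^ b] of [gker] suffices. *)
Definition sing (b r : R) : R := if b == 0 then 0 else b `^ b * r `^ (- b).

Lemma sing_ge0 b r : 0 <= sing b r.
Proof. by rewrite /sing; case: ifP => _//; rewrite mulr_ge0 ?powR_ge0. Qed.

(** The substitution s -> d s in the Gamma integral inside [c_alpha] produces the factor d^(b-1).
    The integrand is extended by zero so that the change of variable takes place on the whole
    line. *)
Lemma sing_integral (b d : R) : 0 <= b < 1 -> 0 < d ->
  L1 `]0, +oo[ (fun s => sing b s * expR (- (d * s))) /\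
  \int[leb]_(s in `]0, +oo[) (sing b s * expR (- (d * s))) = c_alpha b * d `^ (b - 1).
Proof.
move=> hb d0; rewrite /sing /c_alpha; have [b0|bn0] := eqVneq b 0.
  under [X in _ /\ X = _]eq_Rintegral do rewrite mul0r.
  split; last by rewrite Rintegral_cst// !mul0r.
  by apply: (@L1_eq _ _ (fun=> 0)) => //; [move=> s _; rewrite mul0r|exact: integrable0].
pose h (s : R) := if s \in `]0%R, +oo[%classic then s `^ (- b) * expR (- s) else 0.
have ih : L1 setT h by apply/(L1_restrict _ (measurable_itv _)); exact: gamma_integrable.
have mh := L1_measurable ih.
have h0 s : 0 <= h s by rewrite /h; case: ifP => // _; rewrite mulr_ge0 ?powR_ge0 ?expR_ge0.
have hd s : h (d * s) = if s \in `]0%R, +oo[%classic then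
    d `^ (- b) * (s `^ (- b) * expR (- (d * s))) else 0.
  rewrite /h !mem_setE !in_itv/= !andbT pmulr_rgt0//; case: ifPn => // s0.
  by rewrite powRM ?(ltW d0) ?(ltW s0)// mulrA.
have E := @ge0_integral_affine R (EFin \o h) d 0 d0 (measurableT_comp (@EFin_measurable _ _) mh) (fun s => h0 s).
have {}E : (\int[leb]_s (h s)%:E = d%:E * \int[leb]_s (h (d * s))%:E)%E.
  by rewrite -[LHS]/(\int[leb]_s (EFin \o h) s)%E E; under eq_integral do rewrite addr0.
have mhd : measurable_fun [set: mR] (fun s : R => h (d * s)).
  by apply: (measurableT_comp mh); exact: measurable_funM.
have ihd : L1 setT (fun s : R => h (d * s)).
  apply/integrableP; split; first exact/measurable_EFinP.
  case/integrableP: ih => _; under eq_integral do rewrite /= ger0_norm//.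
  under [X in _ -> (X < _)%E]eq_integral do rewrite /= ger0_norm//.
  have fin (I : \bar R) : (d%:E * I < +oo -> I < +oo)%E.
    case: I => [r _||_]; rewrite ?ltry ?ltNyr//.
    by rewrite mulry gtr0_sg// mul1e.
  by rewrite E; exact: fin.
have ER : \int[leb]_s h s = d * \int[leb]_s h (d * s).
  by rewrite /Rintegral E fineM//; exact: integrable_fin_num.
have {}ihd : L1 `]0, +oo[ (fun s => d `^ (- b) * (s `^ (- b) * expR (- (d * s)))).
  by apply/(L1_restrict _ (measurable_itv _)); apply: L1_eq ihd.
have db : d `^ (- b) != 0 by rewrite gt_eqF// powR_gt0.
have i1 : L1 `]0, +oo[ (fun s => s `^ (- b) * expR (- (d * s))).
  have := L1Z (d `^ (- b))^-1 (measurable_itv _) ihd.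
  by apply: L1_eq => // s _; rewrite mulrA mulVf// mul1r.
have i2 : L1 `]0, +oo[ (fun s => b `^ b * s `^ (- b) * expR (- (d * s))).
  by have := L1Z (b `^ b) (measurable_itv _) i1; apply: L1_eq => // s _; rewrite mulrA.
split => //; under eq_Rintegral do rewrite -mulrA.
rewrite RintegralZl// -mulrA; congr (_ * _).
rewrite [in RHS]Rintegral_restrict -/h [X in X * _](_ : _ = \int[leb]_s h s)// ER.
have -> : \int[leb]_s h (d * s) = d `^ (- b) * \int[leb]_(s in `]0, +oo[) (s `^ (- b) * expR (- (d * s))).
  rewrite -RintegralZl// [in RHS]Rintegral_restrict; apply: eq_Rintegral => s _; by rewrite hd.
set I := \int[leb]_(_ in _) _.
have e1 : d * d `^ (- b) * d `^ (b - 1) = 1.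
  rewrite -{1}(powRr1 (ltW d0)) -!powRD ?(gt_eqF d0) ?implybT//.
  by rewrite (_ : 1 + - b + (b - 1) = 0) ?powRr0//; ring.
by rewrite -[LHS]mul1r -{1}e1; ring.
Qed.

(** For u in {x, y} the ratio u / (x + y) lies in [0, 1], hence is at most its b-th power; the two
    ratios sum to 1. *)
Lemma powR_subadd (x y b : R) : 0 <= x -> 0 <= y -> 0 <= b <= 1 ->
  (x + y) `^ b <= x `^ b + y `^ b.
Proof.
move=> x0 y0 /andP[b0 b1]; have [xy0|xyn0] := eqVneq (x + y) 0.
  have /andP[/eqP -> /eqP ->] : (x == 0) && (y == 0) by rewrite -paddr_eq0// xy0.
  by rewrite addr0 lerDl powR_ge0.
have xy : 0 < x + y by rewrite lt0r xyn0 addr_ge0.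
have part u : 0 <= u -> u <= x + y -> u / (x + y) * (x + y) `^ b <= u `^ b.
  move=> u0 uxy; have [->|un0] := eqVneq u 0; first by rewrite !mul0r powR_ge0.
  have up : 0 < u by rewrite lt0r un0.
  rewrite -{2}(divfK xyn0 u) (powRM _ (divr_ge0 u0 (ltW xy)) (ltW xy)).
  rewrite ler_wpM2r ?powR_ge0// ger1_powR// divr_gt0//=.
  by rewrite ler_pdivrMr// mul1r.
apply: (@le_trans _ _ (x / (x + y) * (x + y) `^ b + y / (x + y) * (x + y) `^ b)).
  by rewrite -mulrDl -mulrDl divff// mul1r.
by apply: lerD; apply: part => //; rewrite ?lerDl ?lerDr.
Qed.

(** Raise y / b <= exp(y / b) to the power b. The true maximum carries a further factor e^-b; the
    cruder b^b is the constant that appears in [c_alpha]. *)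
Lemma powR_expR_le (b y : R) : 0 < b -> 0 <= y -> y `^ b * expR (- y) <= b `^ b.
Proof.
move=> b0 y0; rewrite expRN ler_pdivrMr ?expR_gt0//.
have h : y / b <= expR (y / b).
  by apply: le_trans (expR_ge1Dx _); rewrite lerDr.
have hb : (y / b) `^ b <= (expR (y / b)) `^ b.
  by apply: ge0_ler_powR; rewrite ?nnegrE ?expR_ge0 ?divr_ge0// ltW.
rewrite -{1}(divfK (lt0r_neq0 b0) y) powRM ?divr_ge0 ?(ltW b0)// mulrC ler_wpM2l ?powR_ge0//.
apply: (le_trans hb).
by rewrite /powR gt_eqF ?expR_gt0// expRK mulrCA divff ?gt_eqF// mulr1.
Qed.

(** The bound is uniform in l >= ell. Splitting l = (l - ell) + ell, subadditivity of the power
    leaves (l - ell)^b, which the surplus decay exp(-(l - ell) r) turns into [sing b r], and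
    ell^b. *)
Lemma smoothing_bound (b l ell mu r : R) : 0 <= b <= 1 -> 0 < ell <= l -> 0 < r ->
  l `^ b * expR (- ((l - mu) * r)) <= (sing b r + ell `^ b) * expR (- ((ell - mu) * r)).
Proof.
move=> /andP[b0 b1] /andP[ell0 ell_l] r0.
have [->|bn0] := eqVneq b 0.
  rewrite /sing eqxx !powRr0 add0r !mul1r ler_expR lerN2 ler_pM2r//.
  by rewrite lerB.
have bp : 0 < b by rewrite lt0r bn0.
have d0 : 0 <= l - ell by rewrite subr_ge0.
have -> : l `^ b * expR (- ((l - mu) * r)) =
    l `^ b * expR (- ((l - ell) * r)) * expR (- ((ell - mu) * r)).
  by rewrite -mulrA -expRD; congr (_ * expR _); ring.
rewrite ler_wpM2r ?expR_ge0//.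
apply: (@le_trans _ _ (((l - ell) `^ b + ell `^ b) * expR (- ((l - ell) * r)))).
  rewrite ler_wpM2r ?expR_ge0// -{1}(subrK ell l) powR_subadd ?b0//.
  exact: ltW.
rewrite mulrDl lerD//; last first.
  by rewrite ler_piMr ?powR_ge0// -expR0 ler_expR oppr_le0 mulr_ge0// ltW.
rewrite /sing (negbTE bn0) powRN ler_pdivlMr ?powR_gt0//.
rewrite mulrAC -powRM ?(ltW r0)//.
by apply: powR_expR_le => //; rewrite mulr_ge0// ltW.
Qed.

End kernel_integrals.

(** * The Green operator of the linear part *)

Section reflection.
Context {R : realType}.
Local Notation leb := (@lebesgue_measure R).
Local Notation mR := (measurableTypeR R).
Local Notation L1 D f := (leb.-integrable (D : set mR) (EFin \o f)).

Lemma Rintegral_reflect (f : mR -> R) (t : R) : measurable_fun setT f ->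
  (forall s, 0 <= f s) -> \int[leb]_s f (t - s)%R = \int[leb]_s f s.
Proof.
move=> mf f0; have mE : measurable_fun [set: mR] (EFin \o f) by exact/measurable_EFinP.
rewrite /Rintegral -(integral_opp mE); last by move=> s; rewrite lee_fin.
have mo : measurable_fun [set: mR] (fun s : R => (EFin \o f) (- s)).
  by apply: (measurableT_comp mE); exact: oppr_measurable.
rewrite -(integral_shift (- t) mo); congr fine; apply: eq_integral => s _ /=.
by rewrite opprB.
Qed.

Lemma L1_reflect (f : mR -> R) (t : R) : (forall s, 0 <= f s) ->
  L1 setT f -> L1 setT (fun s : R => f (t - s)).
Proof.
move=> f0 fi; have mf := L1_measurable fi.
have mE : measurable_fun [set: mR] (EFin \o f) by exact/measurable_EFinP.
have mo : measurable_fun [set: mR] (fun s : R => (EFin \o f) (- s)).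
  by apply: (measurableT_comp mE); exact: oppr_measurable.
have mo' : measurable_fun [set: mR] (fun s : R => f (t - s)).
  by apply: (measurableT_comp mf); apply: measurable_funB.
apply/integrableP; split; first exact/measurable_EFinP.
case/integrableP: fi => _; under eq_integral do rewrite /= ger0_norm//.
under [X in _ -> (X < _)%E]eq_integral do rewrite /= ger0_norm//.
rewrite -(integral_opp mE) -?(integral_shift (- t) mo) => [|s]; last by rewrite lee_fin.
by apply: le_lt_trans; rewrite le_eqVlt; apply/orP; left; apply/eqP; apply: eq_integral => s _ /=; rewrite opprB.
Qed.

Lemma measurable_if_lt0 (f g : mR -> R) : measurable_fun setT f -> measurable_fun setT g ->
  measurable_fun setT (fun r : mR => if r < 0 then f r else g r).
Proof. by move=> mf mg; apply: measurable_fun_ifT => //; apply: measurable_fun_ltr. Qed.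

Lemma measurable_if_gt0 (f g : mR -> R) : measurable_fun setT f -> measurable_fun setT g ->
  measurable_fun setT (fun r : mR => if 0 < r then f r else g r).
Proof. by move=> mf mg; apply: measurable_fun_ifT => //; apply: measurable_fun_ltr. Qed.

Lemma measurable_expRM (c : R) : measurable_fun [set: mR] (fun r : R => expR (c * r)).
Proof.
by apply: (measurableT_comp (@measurable_expR R)); apply: measurable_funM.
Qed.

End reflection.

Section green_kernel.
Context {R : realType} {H : hilbertType R} (A : posOperator H) (alpha : {nonneg R}).
Local Notation e := (eigvec A).
Local Notation lam := (eigval A).
Local Notation a := (alpha%:num).
Local Notation X := (fracSpace A alpha).
Local Notation leb := (@lebesgue_measure R).
Local Notation mR := (measurableTypeR R).
Local Notation L1 D f := (leb.-integrable (D : set mR) (EFin \o f)).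

(* Exponential dichotomy: the modes below [n] are integrated from the future,
   the others from the past. With [n = 0] this is the forward Duhamel formula. *)
Definition green (n i : nat) (r : R) : R :=
  if (i < n)%N then (if r < 0 then - expR (- lam i * r) else 0)
  else (if 0 < r then expR (- lam i * r) else 0).

(* Dominates [lam i ^ b * |green n i r|] for all [i] at once, in the norm
   weighted by [expR (mu * t)]; its integral is [kappa]. *)
Definition gker (n : nat) (mu b r : R) : R :=
  if r < 0 then (if n is n'.+1 then lam n' `^ b * expR (- (mu - lam n') * (- r)) else 0)
  else if 0 < r then (sing b r + lam n `^ b) * expR (- ((lam n - mu) * r)) else 0.

(** Indices start at 0, so [mu] separates the first [n] eigenvalues from lambda_(n+1) = [lam n]. For
    [n = 0] it may be any number below the spectrum, negative ones included. *)
Definition spectral_gap (n : nat) (mu : R) :=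
  mu < lam n /\ forall i, (i < n)%N -> lam i < mu.

(** The summands come, in order, from the low modes, from the singular part and from the regular
    part of the bound on the high modes. *)
Definition kappa (n : nat) (mu b : R) : R :=
  (if n is n'.+1 then lam n' `^ b / (mu - lam n') else 0) +
  (c_alpha b * (lam n - mu) `^ (b - 1) + lam n `^ b / (lam n - mu)).

Lemma gker_ge0 n mu b r : 0 <= gker n mu b r.
Proof.
rewrite /gker; case: ifP => _.
  by case: n => // n; rewrite mulr_ge0 ?powR_ge0 ?expR_ge0.
by case: ifP => // _; rewrite mulr_ge0 ?expR_ge0// addr_ge0 ?sing_ge0 ?powR_ge0.
Qed.

(** On the low modes the power and the exponential both increase with the eigenvalue, so the last
    low mode dominates. On the high modes they compete, which is where [smoothing_bound] enters. *)
Lemma green_gker n mu b i r : 0 <= b <= 1 ->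
  lam i `^ b * `|green n i r| * expR (mu * r) <= gker n mu b r.
Proof.
move=> hb; have := hb => /andP[b0 b1]; rewrite /green /gker; case: ifPn => ni.
  case: ifPn => r0; last first.
    by rewrite normr0 mulr0 mul0r; case: ifP => // _; rewrite mulr_ge0 ?expR_ge0// addr_ge0 ?sing_ge0 ?powR_ge0.
  rewrite normrN ger0_norm ?expR_ge0//; case: n ni => // n; rewrite ltnS => ni.
  rewrite -mulrA -expRD ler_pM ?powR_ge0 ?expR_ge0//.
    by apply: ge0_ler_powR; rewrite ?nnegrE ?(ltW (eigval_pos _ _))// eigval_mono.
  rewrite ler_expR (_ : - lam i * r + mu * r = (mu - lam i) * r); last by ring.
  rewrite (_ : - (mu - lam n) * - r = (mu - lam n) * r); last by ring.
  by rewrite ler_wnM2r ?(ltW r0)// lerB// eigval_mono.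
rewrite -leqNgt in ni; case: (ltrgtP 0 r) => [r0|r0|<-]; rewrite ?ltxx ?normr0 ?mulr0 ?mul0r//.
  rewrite ger0_norm ?expR_ge0// -mulrA -expRD.
  rewrite (_ : - lam i * r + mu * r = - ((lam i - mu) * r)); last by ring.
  by apply: smoothing_bound => //; rewrite eigval_pos eigval_mono.
by case: n ni => // n _; rewrite mulr_ge0 ?powR_ge0 ?expR_ge0.
Qed.

Lemma green_le1 n mu i r : spectral_gap n mu -> `|green n i r| * expR (mu * r) <= 1.
Proof.
move=> [mun muP]; rewrite /green; case: ifPn => ni.
  case: ifPn => r0; last by rewrite normr0 mul0r.
  rewrite normrN ger0_norm ?expR_ge0// -expRD -expR0 ler_expR.
  rewrite -mulrDl mulr_ge0_le0 ?(ltW r0)// addrC subr_ge0 ltW//; exact: muP.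
rewrite -leqNgt in ni; case: ifPn => r0; last by rewrite normr0 mul0r.
rewrite ger0_norm ?expR_ge0// -expRD -expR0 ler_expR -mulrDl mulr_le0_ge0 ?(ltW r0)//.
by rewrite addrC subr_le0 (le_trans (ltW mun))// eigval_mono.
Qed.

Lemma measurable_green n i : measurable_fun [set: mR] (green n i).
Proof.
rewrite /green; case: (i < n)%N.
  apply: measurable_if_lt0 => //; apply: measurable_funN; exact: measurable_expRM.
by apply: measurable_if_gt0 => //; exact: measurable_expRM.
Qed.

Lemma gker_integral n mu b : 0 <= b < 1 -> spectral_gap n mu ->
  L1 setT (gker n mu b) /\ \int[leb]_s gker n mu b s = kappa n mu b.
Proof.
move=> hb [mun muP]; have d0 : 0 < lam n - mu by rewrite subr_gt0.
have [i1 E1] := sing_integral hb d0; have [i2 E2] := expR_integral d0.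
pose g1 (r : R) := if r \in `]0%R, +oo[%classic then (sing b r + lam n `^ b) * expR (- ((lam n - mu) * r)) else 0.
have i3 : L1 `]0, +oo[ (fun r => (sing b r + lam n `^ b) * expR (- ((lam n - mu) * r))).
  apply: L1_eq (L1D (measurable_itv _) i1 (L1Z (lam n `^ b) (measurable_itv _) i2)) => // s _ /=.
  by rewrite [RHS]mulrDl.
have ig1 : L1 setT g1 by apply/(L1_restrict _ (measurable_itv _)).
have Eg1 : \int[leb]_s g1 s = c_alpha b * (lam n - mu) `^ (b - 1) + lam n `^ b / (lam n - mu).
  rewrite -Rintegral_restrict; under eq_Rintegral do rewrite mulrDl.
  by rewrite RintegralD// ?E1 ?RintegralZl// ?E2//; exact: L1Z.
(* Without low modes the coefficient [c'] is 0, and the default 1 merely keeps the rate positive. *)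
pose m' := if n is n'.+1 then mu - lam n' else 1.
have m'0 : 0 < m' 
  by rewrite /m'; move: muP; case: (n) => // k; rewrite subr_gt0; exact.
have [i4 E4] := expR_integral m'0.
pose c' : R := if n is n'.+1 then lam n' `^ b else 0.
pose g2 (r : R) := if r \in `]0%R, +oo[%classic then c' * expR (- (m' * r)) else 0.
have ig2 : L1 setT g2 by apply/(L1_restrict _ (measurable_itv _)); exact: L1Z.
have Eg2 : \int[leb]_s g2 s = c' / m'.
  by rewrite -Rintegral_restrict RintegralZl// E4.
have g20 s : 0 <= g2 s.
  rewrite /g2; case: ifP => // _; rewrite mulr_ge0 ?expR_ge0// /c'.
  by case: (n) => // k; rewrite powR_ge0.
have gE s : gker n mu b s = g2 (0 - s) + g1 s.
  rewrite /gker /g1 /g2 !mem_setE !in_itv/= !andbT sub0r oppr_gt0.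
  case: (ltrgtP 0 s) => s0; rewrite ?add0r ?addr0//.
  rewrite /c' /m'; case: (n) => [|n']; first by rewrite mul0r.
  by rewrite mulNr.
have ig2' := L1_reflect 0 g20 ig2.
split; first by apply: L1_eq (L1D measurableT ig2' ig1) => // s _; rewrite gE.
under eq_Rintegral do rewrite gE.
rewrite RintegralD// Eg1 Rintegral_reflect ?Eg2//; last exact: L1_measurable ig2.
by rewrite /kappa /c' /m'; case: (n) => //; rewrite mul0r.
Qed.

Definition cmeas (phi : R -> H) :=
  forall i, measurable_fun [set: mR] (fun s : R => dot (phi s) (e i)).

Definition Kc (n : nat) (phi : R -> H) (t : R) (i : nat) : R :=
  \int[leb]_s (green n i (t - s)%R * dot (phi s) (e i)).

Definition Kop (n : nat) (phi : R -> H) (t : R) : X := mkX A alpha (Kc n phi t).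

(** [Kop] is built from total integrals and a choice, so it has a value even when the formula
    diverges. This predicate certifies that the value is the intended one, as algebra on [Kop]
    requires. *)
Definition Kgood n phi t :=
  (forall i, L1 setT (fun s : R => green n i (t - s) * dot (phi s) (e i))) /\
  (forall j, dot (Kop n phi t) (e j) = Kc n phi t j).

Lemma measurable_green_refl n i t : measurable_fun [set: mR] (fun s : R => green n i (t - s)).
Proof.
by apply: (measurableT_comp (@measurable_green n i)); apply: measurable_funB.
Qed.

(** The exponent [b] is kept free: [b = a] controls the norm of D(A^alpha), and a larger [b] makes
    tails of the expansion small. *)
Lemma Kc_bound n phi t b (B : mR -> R) : cmeas phi -> L1 setT B ->
  (forall s, 0 <= B s) ->
  (forall s N, \sum_(0 <= i < N) (lam i `^ b * (green n i (t - s) * dot (phi s) (e i))) ^+ 2 <= B s ^+ 2) ->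
  (forall i, L1 setT (fun s : R => green n i (t - s) * dot (phi s) (e i))) /\
  (forall N, \sum_(0 <= i < N) (lam i `^ b * Kc n phi t i) ^+ 2 <= (\int[leb]_s B s) ^+ 2).
Proof.
move=> mphi iB B0 hB.
have l0 i : 0 < lam i `^ b by rewrite powR_gt0// eigval_pos.
have mp i : measurable_fun [set: mR] (fun s : R => green n i (t - s) * dot (phi s) (e i)).
  by apply: measurable_funM; [exact: measurable_green_refl|exact: mphi].
have mlp i : measurable_fun [set: mR] (fun s : R => lam i `^ b * (green n i (t - s) * dot (phi s) (e i))).
  by apply: measurable_funM => //; exact: mp.
have ip i : L1 setT (fun s : R => lam i `^ b * (green n i (t - s) * dot (phi s) (e i))).
  apply: (L1_le _ (mlp i) _ iB) => // s _; rewrite -ler_sqr ?nnegrE// real_normK ?num_real//.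
  apply: le_trans (hB s i.+1); rewrite big_nat_recr//= lerDr.
  by apply: sumr_ge0 => j _; exact: sqr_ge0.
have ip' i : L1 setT (fun s : R => green n i (t - s) * dot (phi s) (e i)).
  apply: L1_eq (L1Z (lam i `^ b)^-1 measurableT (ip i)) => // s _.
  by rewrite mulrA mulVf ?mul1r// gt_eqF.
split=> // N; have := minkowski_Rintegral (psi := fun i (s : R) => lam i `^ b * (green n i (t - s) * dot (phi s) (e i))) mlp iB B0 (fun s => hB s N).
apply: le_trans; rewrite le_eqVlt; apply/orP; left; apply/eqP.
by apply: eq_bigr => i _; rewrite RintegralZl.
Qed.

Lemma Kc_boundH n mu phi b M t : 0 <= b < 1 -> spectral_gap n mu -> cmeas phi ->
  0 <= M -> (forall s, `|phi s| <= M * expR (- mu * s)) ->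
  (forall i, L1 setT (fun s : R => green n i (t - s) * dot (phi s) (e i))) /\
  (forall N, \sum_(0 <= i < N) (lam i `^ b * Kc n phi t i) ^+ 2 <=
    (kappa n mu b * M * expR (- mu * t)) ^+ 2).
Proof.
move=> hb gap mphi M0 hM; have [ig Eg] := gker_integral hb gap.
have hb' : 0 <= b <= 1 by case/andP: hb => -> /ltW.
have iB := L1Z (M * expR (- mu * t)) measurableT (L1_reflect t (@gker_ge0 n mu b) ig).
have B0 s : 0 <= M * expR (- mu * t) * gker n mu b (t - s).
  by rewrite !mulr_ge0 ?expR_ge0 ?gker_ge0.
have -> : kappa n mu b * M * expR (- mu * t) =
   \int[leb]_s (M * expR (- mu * t) * gker n mu b (t - s)%R).
  rewrite RintegralZl//; last exact: L1_reflect (@gker_ge0 n mu b) ig.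
  rewrite Rintegral_reflect ?Eg; [ring|exact: L1_measurable ig|exact: gker_ge0].
apply: (Kc_bound mphi iB) => // s N.
rewrite exprMn (le_trans (y := (M * expR (- mu * s)) ^+ 2 * (gker n mu b (t - s) * expR (- mu * (t - s))) ^+ 2))//.
  apply: (@le_trans _ _ (\sum_(0 <= i < N) (gker n mu b (t - s) * expR (- mu * (t - s))) ^+ 2 * dot (phi s) (e i) ^+ 2)).
    apply: ler_sum => i _; rewrite mulrA exprMn ler_wpM2r ?sqr_ge0//.
    have := green_gker n mu i (t - s) hb'.
    rewrite -[X in X <= _ -> _]/(_ * _) -ler_pdivlMr ?expR_gt0// -expRN -mulNr => h.
    rewrite -[leLHS]real_normK ?num_real// ler_sqr ?nnegrE ?mulr_ge0 ?gker_ge0 ?expR_ge0//.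
    by rewrite normrM (ger0_norm (powR_ge0 _ _)).
  rewrite -mulr_sumr mulrC ler_wpM2r ?sqr_ge0//.
  apply: (le_trans (norm_coef_lb A (phi s) N)).
  by rewrite ler_sqr ?nnegrE// mulr_ge0 ?expR_ge0.
rewrite -!exprMn le_eqVlt; apply/orP; left; apply/eqP; congr (_ ^+ 2).
rewrite mulrACA -mulrA (mulrC (gker _ _ _ _)) mulrA -!mulrA; congr (_ * _).
rewrite !mulrA -expRD; congr (expR _ * _); ring.
Qed.

Lemma kappa_ge0 n mu b : 0 <= b < 1 -> spectral_gap n mu -> 0 <= kappa n mu b.
Proof.
move=> hb gap; have [_ <-] := gker_integral hb gap; apply: Rintegral_ge0 => s _; exact: gker_ge0.
Qed.

Lemma K_boundH n mu phi M t : a < 1 -> spectral_gap n mu -> cmeas phi ->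
  0 <= M -> (forall s, `|phi s| <= M * expR (- mu * s)) ->
  Kgood n phi t /\ `|Kop n phi t| <= kappa n mu a * M * expR (- mu * t).
Proof.
move=> a1 gap mphi M0 hM; have hb : 0 <= a < 1 by rewrite a1 andbT.
have [ip hN] := Kc_boundH t hb gap mphi M0 hM.
have [] := mkX_coef (B := kappa n mu a * M * expR (- mu * t)) _ hN.
  by rewrite !mulr_ge0 ?expR_ge0 ?kappa_ge0.
by move=> hc hn.
Qed.

(** The source already lies in D(A^alpha), so the weight lam_i^alpha stays with it and the weighted
    kernel is at most 1 ([green_le1]); integrability in time is then enough. *)
Lemma Kc_boundX n mu (phi : R -> X) t : spectral_gap n mu -> cmeas phi ->
  L1 setT (fun s : R => expR (mu * s) * `|phi s|) ->
  (forall i, L1 setT (fun s : R => green n i (t - s) * dot (phi s) (e i))) /\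
  (forall N, \sum_(0 <= i < N) (lam i `^ a * Kc n phi t i) ^+ 2 <=
    (expR (- mu * t) * \int[leb]_s (expR (mu * s) * `|phi s|)) ^+ 2).
Proof.
move=> gap mphi ip.
rewrite -RintegralZl//; apply: (Kc_bound mphi (L1Z _ measurableT ip)) => [s|s N].
  by rewrite !mulr_ge0 ?expR_ge0.
have E0 : expR (- mu * t) * (expR (mu * s) * `|phi s|) = expR (- mu * (t - s)) * `|phi s|.
  by rewrite mulrA -expRD; congr (expR _ * _); ring.
rewrite E0 exprMn; apply: (le_trans _ (ler_wpM2l (sqr_ge0 _) (fracnorm_lb (phi s) N))).
rewrite mulr_sumr; apply: ler_sum => i _.
rewrite mulrCA exprMn ler_wpM2r ?sqr_ge0//.
rewrite -[leLHS]real_normK ?num_real// ler_sqr ?nnegrE ?expR_ge0//.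
by rewrite mulNr expRN -[leRHS]mul1r ler_pdivlMr ?expR_gt0// green_le1.
Qed.

Lemma K_boundX n mu (phi : R -> X) t : spectral_gap n mu -> cmeas phi ->
  L1 setT (fun s : R => expR (mu * s) * `|phi s|) ->
  Kgood n phi t /\ `|Kop n phi t| <= expR (- mu * t) * \int[leb]_s (expR (mu * s) * `|phi s|).
Proof.
move=> gap mphi ip; have [ig hN] := Kc_boundX t gap mphi ip.
have [] := mkX_coef (B := expR (- mu * t) * \int[leb]_s (expR (mu * s) * `|phi s|)) _ hN.
  rewrite mulr_ge0 ?expR_ge0//; apply: Rintegral_ge0 => s _; by rewrite mulr_ge0 ?expR_ge0.
by move=> hc hn.
Qed.

Lemma KopB n phi psi t : Kgood n phi t -> Kgood n psi t ->
  Kgood n (fun s => phi s - psi s) t ->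
  Kop n phi t - Kop n psi t = Kop n (fun s => phi s - psi s) t.
Proof.
move=> [ip cp] [iq cq] [id cd]; apply: frac_eq => j.
rewrite coefB cp cq cd /Kc -RintegralB//; apply: eq_Rintegral => s _.
by rewrite dotBl mulrBr.
Qed.

Lemma measurable_Kc d (T : measurableType d) n (phi : T * R -> H) i :
  measurable_fun setT (fun p => dot (phi p) (e i)) ->
  measurable_fun setT (fun p : T * R => Kc n (fun s => phi (p.1, s)) p.2 i).
Proof.
move=> mphi.
apply: (measurable_Rintegral_param (f := fun q : (T * R) * R => green n i (q.1.2 - q.2) * dot (phi (q.1.1, q.2)) (e i))).
apply: measurable_funM.
  apply: (measurableT_comp (@measurable_green n i)).
  by apply: measurable_funB => //; exact: (measurableT_comp measurable_snd measurable_fst).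
apply: (measurableT_comp mphi); apply: measurable_fun_pair => //.
exact: (measurableT_comp measurable_fst measurable_fst).
Qed.

End green_kernel.

(** * Fixed points in exponentially weighted spaces *)

Section contraction.
Context {R : realType} {H : hilbertType R} (A : posOperator H) (alpha : {nonneg R}).
Local Notation e := (eigvec A).
Local Notation lam := (eigval A).
Local Notation a := (alpha%:num).
Local Notation X := (fracSpace A alpha).
Local Notation mR := (measurableTypeR R).

Lemma eq_of_geometric_bound (V : normedModType R) (x y : V) (C q : R) :
  0 <= q < 1 -> (forall m, `|x - y| <= C * q ^+ m) -> x = y.
Proof.
move=> /andP[q0 q1] hC; apply/eqP; rewrite -subr_eq0 -normr_eq0 eq_le normr_ge0 andbT.
have h : (fun m => C * q ^+ m) @ \oo --> (0 : R).
  have := @cvg_geometric R C q; rewrite ger0_norm// => /(_ q1).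
  exact.
by apply: (cvgr_to_ge h); apply: nearW.
Qed.

(** The a priori bound [C] makes the weighted supremum S of the difference finite; then S <= B + q
    S. The defect [B] allows one statement to give both uniqueness ([B = 0]) and Lipschitz
    dependence on the data. *)
Lemma K_contraction n mu L (eta1 eta2 : R -> X) (phi1 phi2 : R -> H) (B C : R) :
  a < 1 -> spectral_gap A n mu -> 0 <= L -> L * kappa A n mu a < 1 -> 0 <= B ->
  cmeas A phi1 -> cmeas A phi2 ->
  (forall t, Kgood A alpha n phi1 t) -> (forall t, Kgood A alpha n phi2 t) ->
  (forall s, `|phi1 s - phi2 s| <= L * `|eta1 s - eta2 s|) ->
  (forall t, `|eta1 t - eta2 t - (Kop A alpha n phi1 t - Kop A alpha n phi2 t)| <=
     B * expR (- mu * t)) ->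
  (forall t, `|eta1 t - eta2 t| <= C * expR (- mu * t)) ->
  forall t, `|eta1 t - eta2 t| <= B / (1 - L * kappa A n mu a) * expR (- mu * t).
Proof.
move=> a1 gap L0 hq B0 m1 m2 g1 g2 hphi heta hC.
set q := L * kappa A n mu a; have q0 : 0 <= q.
  by rewrite mulr_ge0// kappa_ge0// a1 andbT.
have step D : 0 <= D -> (forall t, `|eta1 t - eta2 t| <= D * expR (- mu * t)) ->
    forall t, `|eta1 t - eta2 t| <= (B + q * D) * expR (- mu * t).
  move=> D0 hD t.
  have mB : cmeas A (fun s => phi1 s - phi2 s).
    by move=> i; under eq_fun do rewrite dotBl; apply: measurable_funB.
  have hB s : `|phi1 s - phi2 s| <= L * D * expR (- mu * s).
    by rewrite (le_trans (hphi s))// -mulrA ler_wpM2l.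
  have [gB nB] := K_boundH t a1 gap mB (mulr_ge0 L0 D0) hB.
  rewrite -(subrK (Kop A alpha n phi1 t - Kop A alpha n phi2 t) (eta1 t - eta2 t)).
  rewrite (le_trans (ler_normD _ _))// mulrDl lerD//.
  rewrite KopB// (le_trans nB)// /q le_eqVlt; apply/orP; left; apply/eqP; ring.
pose E := [set r | exists t, r = expR (mu * t) * `|eta1 t - eta2 t|].
have E0 : E !=set0 by exists (expR (mu * 0) * `|eta1 0 - eta2 0|); exists 0.
have conv D t : (expR (mu * t) * `|eta1 t - eta2 t| <= D) = (`|eta1 t - eta2 t| <= D * expR (- mu * t)).
  by rewrite mulNr expRN ler_pdivlMr ?expR_gt0// mulrC.
have Eub : has_ubound E by exists C => _ [t ->]; rewrite conv.
have hS t : `|eta1 t - eta2 t| <= sup E * expR (- mu * t).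
  by rewrite -conv; apply: ub_le_sup => //; exists t.
have S0 : 0 <= sup E.
  apply: (@le_trans _ _ (expR (mu * 0) * `|eta1 0 - eta2 0|)); first by rewrite mulr_ge0 ?expR_ge0.
  by apply: ub_le_sup => //; exists 0.
have : sup E <= B + q * sup E.
  by apply: ge_sup => // _ [t ->]; rewrite conv; exact: step.
move=> hle t; apply: (le_trans (hS t)); rewrite ler_wpM2r ?expR_ge0//.
by rewrite ler_pdivlMr ?subr_gt0// mulrBr mulr1 lerBlDr (mulrC (sup E)).
Qed.

(** * Fixed points depending measurably on a parameter *)

Section fixed_point.
Context {d} {T : measurableType d}.

Definition pmeas (f : T * R -> H) :=
  forall i, measurable_fun setT (fun p => dot (f p) (e i)).

Lemma pmeas_section (f : T * R -> H) w : pmeas f -> cmeas A (fun s => f (w, s)).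
Proof.
move=> mf i; exact: (measurable_fun_pair2 (f := fun p => dot (f p) (e i)) w (mf i)).
Qed.

Variables (n : nat) (mu L : R) (G : T -> R -> X -> H) (a0 : T * R -> X).
Hypotheses (a1 : a < 1) (gap : spectral_gap A n mu) (L0 : 0 <= L).
Hypothesis hq : L * kappa A n mu a < 1.
Hypothesis G_meas : forall eta : T * R -> X, pmeas eta -> pmeas (fun p => G p.1 p.2 (eta p)).
Hypothesis G_lip : forall w s u v, `|G w s u - G w s v| <= L * `|u - v|.
Hypothesis G_zero : forall w, exists C, forall s, `|G w s 0| <= C * expR (- mu * s).
Hypothesis a0_meas : pmeas a0.
Hypothesis a0_bound : forall w, exists C, forall s, `|a0 (w, s)| <= C * expR (- mu * s).

Let good (eta : T * R -> X) := pmeas eta /\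
  forall w, exists C, forall s, `|eta (w, s)| <= C * expR (- mu * s).

Let step (eta : T * R -> X) : T * R -> X :=
  fun p => a0 p + Kop A alpha n (fun s => G p.1 s (eta (p.1, s))) p.2.

Let good_G eta w : good eta -> cmeas A (fun s => G w s (eta (w, s))) /\
  exists2 C, 0 <= C & forall s, `|G w s (eta (w, s))| <= C * expR (- mu * s).
Proof.
move=> [meta /(_ w)[C hC]]; split; first exact: (pmeas_section w (G_meas meta)).
have [D hD] := G_zero w; exists (L * `|C| + `|D|); first by rewrite addr_ge0// mulr_ge0.
move=> s; rewrite -(subrK (G w s 0) (G w s (eta (w, s)))) (le_trans (ler_normD _ _))//.
rewrite mulrDl lerD//; last by rewrite (le_trans (hD s))// ler_wpM2r ?expR_ge0// ler_norm.
rewrite (le_trans (G_lip _ _ _ _))// subr0 -mulrA ler_wpM2l// (le_trans (hC s))//.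
by rewrite ler_wpM2r ?expR_ge0// ler_norm.
Qed.

Let good_K eta w t : good eta -> Kgood A alpha n (fun s => G w s (eta (w, s))) t.
Proof.
by move=> /(good_G w)[mG [C C0 hC]]; have [] := K_boundH t a1 gap mG C0 hC.
Qed.

Let step_good eta : good eta -> good (step eta).
Proof.
move=> geta; split=> [i|w].
  under eq_fun do rewrite coefD (good_K _ _ geta).2.
  apply: measurable_funD; first exact: a0_meas.
  exact: (measurable_Kc n (G_meas geta.1 i)).
have [mG [C C0 hC]] := good_G w geta; have [D hD] := a0_bound w.
exists (D + kappa A n mu a * C) => s; rewrite (le_trans (ler_normD _ _))// mulrDl lerD//.
by have [_] := K_boundH s a1 gap mG C0 hC.
Qed.

Let q := L * kappa A n mu a.
Let q0 : 0 <= q. Proof. by rewrite mulr_ge0// kappa_ge0// a1 andbT. Qed.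

Let step_contr eta xi w C : good eta -> good xi -> 0 <= C ->
  (forall s, `|eta (w, s) - xi (w, s)| <= C * expR (- mu * s)) ->
  forall s, `|step eta (w, s) - step xi (w, s)| <= q * C * expR (- mu * s).
Proof.
move=> ge gx C0 hC t; rewrite /step/= opprD addrACA subrr add0r.
have [me _] := good_G w ge; have [mx _] := good_G w gx.
have mB : cmeas A (fun s => G w s (eta (w, s)) - G w s (xi (w, s))).
  by move=> i; under eq_fun do rewrite dotBl; apply: measurable_funB.
have hB s : `|G w s (eta (w, s)) - G w s (xi (w, s))| <= L * C * expR (- mu * s).
  by rewrite (le_trans (G_lip _ _ _ _))// -mulrA ler_wpM2l.
have [gB nB] := K_boundH t a1 gap mB (mulr_ge0 L0 C0) hB.
rewrite KopB//; try exact: good_K.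
by rewrite (le_trans nB)// /q le_eqVlt; apply/orP; left; apply/eqP; ring.
Qed.

Let it m := iter m step a0.
Let it_good m : good (it m).
Proof. by elim: m => [|m IH]; [split|exact: step_good]. Qed.

Let it_bound w : exists2 C, 0 <= C &
  forall m s, `|it m.+1 (w, s) - it m (w, s)| <= C * q ^+ m * expR (- mu * s).
Proof.
have [C hC] := (it_good 1).2 w; have [D hD] := a0_bound w.
exists (`|C| + `|D|); first by rewrite addr_ge0.
elim=> [|m IH] s.
  rewrite expr0 mulr1 (le_trans (ler_normB _ _))// mulrDl lerD//.
    by rewrite (le_trans (hC s))// ler_wpM2r ?expR_ge0// ler_norm.
  by rewrite (le_trans (hD s))// ler_wpM2r ?expR_ge0// ler_norm.
rewrite exprS mulrCA; apply: (step_contr (it_good m.+1) (it_good m)) => //.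
by rewrite mulr_ge0 ?exprn_ge0// addr_ge0.
Qed.

Let it_dist w : exists2 C, 0 <= C &
  forall m k s, `|it (m + k)%N (w, s) - it m (w, s)| <= C * q ^+ m * expR (- mu * s).
Proof.
have [C C0 hC] := it_bound w; have q1 : 0 < 1 - q by rewrite subr_gt0.
exists (C / (1 - q)); first by rewrite divr_ge0// ltW.
(* The factor (1 - q^k) / (1 - q) is the partial geometric sum; keeping it exact lets the induction
   on [k] close. *)
have main m k s : `|it (m + k)%N (w, s) - it m (w, s)| <=
    C * q ^+ m * (1 - q ^+ k) / (1 - q) * expR (- mu * s).
  elim: k => [|k IH]; first by rewrite addn0 subrr normr0 expr0 subrr mulr0 !mul0r.
  rewrite addnS -(subrK (it (m + k)%N (w, s)) (it (m + k).+1 (w, s))) -addrA.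
  rewrite (le_trans (ler_normD _ _))// (le_trans (lerD (hC _ _) IH))//.
  rewrite -mulrDl ler_wpM2r ?expR_ge0// le_eqVlt; apply/orP; left; apply/eqP.
  by rewrite exprD exprS; field; rewrite gt_eqF.
move=> m k s; apply: (le_trans (main m k s)); rewrite ler_wpM2r ?expR_ge0//.
rewrite [leRHS]mulrAC ler_wpM2r ?invr_ge0 ?(ltW q1)// ler_piMr ?mulr_ge0 ?exprn_ge0//.
by rewrite gerBl exprn_ge0.
Qed.

Let it_cvg p : cvgn (fun m => it m p).
Proof.
case: p => w t; have [C C0 hC] := it_dist w.
apply: cauchy_cvg; apply: cauchy_exP => eps eps0.
have h : (fun m => C * expR (- mu * t) * q ^+ m) @ \oo --> (0 : R).
  by have := @cvg_geometric R (C * expR (- mu * t)) q; rewrite ger0_norm// => /(_ hq).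
move/cvgr0Pnorm_lt: h => /(_ _ eps0)[N _ hN].
exists (it N (w, t)); exists N => // k /= Nk; rewrite -ball_normE/= distrC.
rewrite -(subnKC Nk); apply: le_lt_trans (hC _ _ _) _.
have := hN N (leqnn N); rewrite /= ger0_norm ?mulr_ge0 ?exprn_ge0 ?expR_ge0//.
by rewrite mulrAC.
Qed.

(** Picard iteration on functions of the parameter and the time jointly, so that joint measurability
    passes to the pointwise limit. The growth constants may depend on the parameter, since the
    contraction is applied for each parameter separately. *)
Theorem fixed_point_exists : exists eta : T * R -> X,
  [/\ pmeas eta, forall w, exists C, forall s, `|eta (w, s)| <= C * expR (- mu * s) &
      forall w t, eta (w, t) =
        a0 (w, t) + Kop A alpha n (fun s => G w s (eta (w, s))) t].
Proof.
pose eta p : X := limn (fun m => it m p).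
have hcv p : (fun m => it m p) @ \oo --> eta p by exact: it_cvg.
have meta : pmeas eta.
  move=> i; apply: (measurable_fun_cvg (h := fun m p => dot (it m p) (e i))) => [m|p _].
    exact: (it_good m).1.
  exact: (cvg_comp _ _ (hcv p) (@dot_frac_continuous _ _ A alpha i (eta p))).
have dist w : exists2 C, 0 <= C & forall m s,
    `|eta (w, s) - it m (w, s)| <= C * q ^+ m * expR (- mu * s).
  have [C C0 hC] := it_dist w; exists C => // m s.
  have h : (fun k => `|it k (w, s) - it m (w, s)|) @ \oo --> `|eta (w, s) - it m (w, s)|.
    by apply: cvg_norm; apply: cvgB; [exact: hcv|exact: cvg_cst].
  apply: (cvgr_to_le h); exists m => // k /= mk.
  by rewrite -(subnKC mk).
have geta : good eta.
  split=> // w; have [C C0 hC] := dist w; have [D hD] := a0_bound w.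
  exists (C + D) => s; rewrite -(subrK (it 0 (w, s)) (eta (w, s))) (le_trans (ler_normD _ _))//.
  by rewrite mulrDl lerD//; have := hC 0%N s; rewrite expr0 mulr1.
exists eta; split=> [//||w t]; first exact: geta.2.
have [C C0 hC] := dist w.
(* [eta] and [step eta] are compared through the iterate of index m + 1; each of the two distances
   is of order C q^(m+1), whence the factor 2. *)
apply: (@eq_of_geometric_bound _ _ _ (2 * C * q * expR (- mu * t)) q); first by rewrite q0.
move=> m; rewrite -[X in _ - X]/(step eta (w, t)).
rewrite -(subrKA (it m.+1 (w, t))) (le_trans (ler_normD _ _))//.
have h2 := step_contr (w := w) (C := C * q ^+ m) (it_good m) geta (mulr_ge0 C0 (exprn_ge0 m q0)).
have hC' s : `|it m (w, s) - eta (w, s)| <= C * q ^+ m * expR (- mu * s) by rewrite distrC.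
have {}h2 := h2 hC' t.
apply: (le_trans (lerD (hC m.+1 t) h2)).
by rewrite le_eqVlt; apply/orP; left; apply/eqP; rewrite exprS; ring.
Qed.

End fixed_point.
End contraction.

(** * Continuity and coefficient equations *)

Section continuity_from_coefficients.
Context {R : realType} {H : hilbertType R} (A : posOperator H) (alpha : {nonneg R}).
Local Notation e := (eigvec A).
Local Notation lam := (eigval A).
Local Notation a := (alpha%:num).
Local Notation X := (fracSpace A alpha).
Local Notation leb := (@lebesgue_measure R).
Local Notation mR := (measurableTypeR R).
Local Notation L1 D f := (leb.-integrable (D : set mR) (EFin \o f)).

Lemma cvg_sum_nat T (F : set_system T) {FF : Filter F} (f : nat -> T -> R) (l : nat -> R) N :
  (forall j, f j @ F --> l j) ->
  (fun t => \sum_(0 <= j < N) f j t) @ F --> \sum_(0 <= j < N) l j.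
Proof.
move=> hf; elim: N => [|N IH].
  by under eq_fun do rewrite big_nil; rewrite big_nil; exact: cvg_cst.
under eq_fun do rewrite big_nat_recr//=; rewrite big_nat_recr//=.
by apply: cvgD.
Qed.

Lemma fracP_le_sum M (x : X) :
  `|fracP M x| <= \sum_(0 <= j < M) lam j `^ a * `|dot x (e j)|.
Proof.
have S0 : 0 <= \sum_(0 <= j < M) lam j `^ a * `|dot x (e j)|.
  by apply: sumr_ge0 => j _; rewrite mulr_ge0 ?powR_ge0.
apply: fracnorm_ub => // N.
have h K : \sum_(0 <= j < K) (lam j `^ a * dot x (e j)) ^+ 2 <=
    (\sum_(0 <= j < K) lam j `^ a * `|dot x (e j)|) ^+ 2.
  elim: K => [|K IH]; first by rewrite !big_nil expr0n.
  rewrite !big_nat_recr//= sqrrD (le_trans (lerD IH (lexx _)))//.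
  rewrite -addrA lerD2l 2!exprMn real_normK ?num_real// lerDr mulrn_wge0// mulr_ge0//.
    by apply: sumr_ge0 => j _; rewrite mulr_ge0 ?powR_ge0.
  by rewrite mulr_ge0 ?powR_ge0.
apply: le_trans (h M).
under eq_bigr do rewrite fracP_coef.
have [NM|/ltnW MN] := leqP N M.
  rewrite [leRHS](big_cat_nat (n := N))//= -[leLHS]addr0 lerD//; last first.
    by apply: sumr_ge0 => j _; exact: sqr_ge0.
  rewrite [leLHS]big_nat [leRHS]big_nat; apply: ler_sum => j /andP[_ jN].
  by rewrite (leq_trans jN NM).
rewrite (big_cat_nat (n := M))//= [X in _ + X](_ : _ = 0) ?addr0; last first.
  by rewrite big_nat big1// => j /andP[Mj _]; rewrite ltnNge Mj mulr0 expr0n.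
by rewrite [leLHS]big_nat [leRHS]big_nat; apply: ler_sum => j /andP[_ ->].
Qed.

Lemma fracQ_le (M N : nat) (x : X) : (M <= N)%N -> `|fracQ N x| <= `|fracQ M x|.
Proof.
move=> MN; suff -> : fracQ N x = fracQ N (fracQ M x) by exact: fracQ_norm.
apply: frac_eq => j; rewrite !fracQ_coef; case: ltnP => // Nj.
by rewrite ltnNge (leq_trans MN Nj).
Qed.

(* This replaces every continuity argument for operators on D(A^alpha). *)
Lemma frac_cvg_coef T (F : set_system T) {FF : Filter F} (u : T -> X) (u0 : X) :
  (forall i, (fun t => dot (u t) (e i)) @ F --> dot u0 (e i)) ->
  (forall eps, 0 < eps -> exists M, \forall t \near F, `|fracQ M (u t)| <= eps) ->
  u @ F --> u0.
Proof.
move=> hc ht; apply/cvgrPdist_le => eps eps0.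
have eps3 : 0 < eps / 3 by rewrite divr_gt0.
have [M hM] := ht _ eps3.
have /cvgr0Pnorm_le/(_ _ eps3)[M' _ hM'] := fracQ_cvg0 u0.
pose N := maxn M M'.
have hs : (fun t => \sum_(0 <= j < N) lam j `^ a * `|dot (u0 - u t : X) (e j)|) @ F --> (0 : R).
  rewrite [X in _ --> X](_ : 0 = \sum_(0 <= j < N) lam j `^ a * `|dot u0 (e j) - dot u0 (e j)|); last first.
    by rewrite big1// => j _; rewrite subrr normr0 mulr0.
  apply: cvg_sum_nat => j; apply: cvgM; first exact: cvg_cst.
  apply: cvg_norm; under eq_fun do rewrite coefB.
  by apply: cvgB; [exact: cvg_cst|exact: hc].
move/cvgr0Pnorm_le: hs => /(_ _ eps3) hs.
near=> t.
(* One third for the finitely many low coefficients, one for the tail of the fixed [u0], one for the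
   uniformly small tail of [u t]. *)
rewrite -(fracPQ N (u0 - u t)) (le_trans (ler_normD _ _))// (_ : eps = eps / 3 + (eps / 3 + eps / 3)); last by field.
rewrite lerD//.
  rewrite (le_trans (fracP_le_sum _ _))// (le_trans (ler_norm _))//.
  by near: t; exact: hs.
rewrite fracQB (le_trans (ler_normB _ _))// lerD//.
  by apply: hM'; rewrite /= leq_maxr.
rewrite (le_trans (fracQ_le _ (leq_maxl M M')))//.
by near: t; exact: hM.
Unshelve. all: by end_near. Qed.

(** The linear flow of [x], kept only at the modes and times selected by [c]. Under [cut_ok] it
    obeys the growth exp(-mu t): the Cauchy problem keeps all modes forward in time, the dichotomy
    keeps low modes backward and high modes forward. *)
Definition hom (c : nat -> R -> bool) (x : X) (t : R) : X :=
  mkX A alpha (fun i => if c i t then expR (- lam i * t) * dot x (e i) else 0).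

Definition cut_ok (mu : R) (c : nat -> R -> bool) :=
  forall i t, c i t -> 0 <= (lam i - mu) * t.

Lemma hom_bound mu c x t : cut_ok mu c ->
  (forall i, dot (hom c x t) (e i) = if c i t then expR (- lam i * t) * dot x (e i) else 0) /\
  `|hom c x t| <= `|x| * expR (- mu * t).
Proof.
move=> hc; apply: mkX_coef; first by rewrite mulr_ge0 ?expR_ge0.
move=> N; rewrite exprMn mulrC.
apply: (le_trans _ (ler_wpM2l (sqr_ge0 _) (fracnorm_lb x N))).
rewrite mulr_sumr; apply: ler_sum => i _; case: ifPn => [hi|_]; last first.
  by rewrite mulr0 expr0n/= mulr_ge0 ?sqr_ge0.
rewrite mulrCA exprMn ler_wpM2r ?sqr_ge0// ler_sqr ?nnegrE ?expR_ge0// ler_expR.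
by rewrite -subr_ge0 -mulrBl opprK addrC; exact: hc.
Qed.

Lemma hom_tail mu c x t M : cut_ok mu c ->
  `|fracQ M (hom c x t)| <= `|fracQ M x| * expR (- mu * t).
Proof.
move=> hc; suff -> : fracQ M (hom c x t) = hom c (fracQ M x) t by exact: (hom_bound _ _ hc).2.
apply: frac_eq => i; rewrite fracQ_coef !(hom_bound _ _ hc).1 fracQ_coef.
by case: (i < M)%N; rewrite ?mulr0// if_same.
Qed.

Lemma homB mu c x y t : cut_ok mu c -> hom c x t - hom c y t = hom c (x - y) t.
Proof.
move=> hc; apply: frac_eq => i; rewrite coefB !(hom_bound _ _ hc).1 coefB.
by case: (c i t); rewrite ?subrr// mulrBr.
Qed.

Lemma hom_meas d (T : measurableType d) mu c (x : T -> X) : cut_ok mu c ->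
  (forall i, measurable_fun [set: R] (c i)) ->
  (forall i, measurable_fun setT (fun w => dot (x w) (e i))) ->
  pmeas A (fun p : T * R => hom c (x p.1) p.2).
Proof.
move=> hc mc mx i; under eq_fun do rewrite (hom_bound _ _ hc).1.
apply: measurable_fun_ifT => //.
  exact: (measurableT_comp (mc i) measurable_snd).
apply: measurable_funM.
  apply: (measurableT_comp (@measurable_expR R)).
  by apply: measurable_funM => //; exact: measurable_snd.
exact: (measurableT_comp (mx i) measurable_fst).
Qed.

Definition psi (phi : R -> H) (i : nat) (s : R) : R := expR (lam i * s) * dot (phi s) (e i).

(* In the coordinates [Ycoef u i] the linear flow disappears: the evolution
   equation says that [Ycoef u i] is a primitive of [psi f i], [f] the forcing. *)
Definition Ycoef (u : R -> X) (i : nat) (t : R) : R := expR (lam i * t) * dot (u t) (e i).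

Lemma measurable_psi phi i (D : set mR) :
  measurable_fun D (fun s : R => dot (phi s) (e i)) -> measurable_fun D (psi phi i).
Proof.
move=> mphi; apply: measurable_funM => //.
by apply: measurable_funTS; exact: measurable_expRM.
Qed.

Lemma psi_L1 phi i (r t : R) : L1 `[r, t] (fun s => dot (phi s) (e i)) ->
  L1 `[r, t] (psi phi i).
Proof.
move=> ip; have mp := L1_measurable ip.
apply: (@L1_le _ _ _ (fun s => expR (lam i * t) * `|dot (phi s) (e i)|)) => //.
- exact: measurable_psi.
- move=> s /=; rewrite in_itv/= => /andP[_ st].
  rewrite normrM ler_wpM2r// ger0_norm ?expR_ge0// ler_expR ler_wpM2l//.
  by rewrite ltW// eigval_pos.
- by apply: L1Z => //; exact: integrable_norm.
Qed.

(** The factor [expR (lam i * t)] removes [t] from the integrand, leaving a fixed function on a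
    half-line with endpoint [t]. Values at two times then differ by an integral over the interval
    between them, which is [Kc_ode]. *)
Lemma Kc_psi_lo n phi t i : (i < n)%N ->
  L1 setT (fun s : R => green A n i (t - s) * dot (phi s) (e i)) ->
  L1 `]t, +oo[ (psi phi i) /\
  expR (lam i * t) * Kc A n phi t i = - \int[leb]_(s in `]t, +oo[) psi phi i s.
Proof.
move=> ni ig.
have E (s : R) : expR (lam i * t) * (green A n i (t - s) * dot (phi s) (e i)) =
    if s \in `]t, +oo[%classic then - psi phi i s else 0.
  rewrite /green ni mem_setE in_itv/= andbT subr_lt0 /psi; case: ifP => _; last by rewrite mul0r mulr0.
  by rewrite mulNr mulrN mulrA -expRD; congr (- (expR _ * _)); ring.
have i1 : L1 `]t, +oo[ (fun s => - psi phi i s).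
  apply/(L1_restrict _ (measurable_itv _)).
  apply: L1_eq (L1Z (expR (lam i * t)) measurableT ig) => // s _; exact: E.
have i2 : L1 `]t, +oo[ (psi phi i).
  by apply: L1_eq (L1Z (-1) (measurable_itv _) i1) => // s _; rewrite mulN1r opprK.
split => //; rewrite /Kc -RintegralZl//.
under eq_Rintegral do rewrite E.
rewrite -Rintegral_restrict -[RHS]mulN1r -RintegralZl//.
by apply: eq_Rintegral => s _; rewrite mulN1r.
Qed.

Lemma Kc_psi_hi n phi t i : (n <= i)%N ->
  L1 setT (fun s : R => green A n i (t - s) * dot (phi s) (e i)) ->
  L1 `]-oo, t[ (psi phi i) /\
  expR (lam i * t) * Kc A n phi t i = \int[leb]_(s in `]-oo, t[) psi phi i s.
Proof.
move=> ni ig.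
have E (s : R) : expR (lam i * t) * (green A n i (t - s) * dot (phi s) (e i)) =
    if s \in `]-oo, t[%classic then psi phi i s else 0.
  rewrite /green ltnNge ni/= mem_setE in_itv/= subr_gt0 /psi; case: ifP => _; last by rewrite mul0r mulr0.
  by rewrite mulrA -expRD; congr (expR _ * _); ring.
have i1 : L1 `]-oo, t[ (psi phi i).
  apply/(L1_restrict _ (measurable_itv _)).
  apply: L1_eq (L1Z (expR (lam i * t)) measurableT ig) => // s _; exact: E.
split => //; rewrite /Kc -RintegralZl//.
under eq_Rintegral do rewrite E.
by rewrite -Rintegral_restrict.
Qed.

Lemma Rintegral_Nyo_split (f : R -> R) (r t : R) : r <= t -> L1 `]-oo, t[ f ->
  \int[leb]_(s in `]-oo, t[) f s = \int[leb]_(s in `]-oo, r[) f s + \int[leb]_(s in `[r, t]) f s.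
Proof.
move=> rt fi; have sub : `[r, t[ `<=` `]-oo, t[ by move=> s /=; rewrite !in_itv/= => /andP[].
have i2 : L1 `[r, t[ f by apply: L1_sub fi.
rewrite -(Rintegral_itv_bndo_bndc i2).
have E : `]-oo, t[%classic = `]-oo, r[%classic `|` `[r, t[%classic.
  by rewrite -itv_bndbnd_setU// bnd_simp.
rewrite E Rintegral_setU//; first by rewrite -E.
rewrite disj_set2E; apply/eqP; apply/seteqP; split=> // s [] /=; rewrite !in_itv/=.
by move=> sr /andP[]; rewrite leNgt sr.
Qed.

Lemma Rintegral_oy_split (f : R -> R) (r t : R) : r <= t -> L1 `]r, +oo[ f ->
  \int[leb]_(s in `]r, +oo[) f s = \int[leb]_(s in `[r, t]) f s + \int[leb]_(s in `]t, +oo[) f s.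
Proof.
move=> rt fi; have sub : `]r, t] `<=` `]r, +oo[ by move=> s /=; rewrite !in_itv/= andbT => /andP[].
have i2 : L1 `]r, t] f by apply: L1_sub fi.
rewrite -(Rintegral_itv_obnd_cbnd i2).
have E : `]r, +oo[%classic = `]r, t]%classic `|` `]t, +oo[%classic.
  by rewrite -itv_bndbnd_setU// bnd_simp.
rewrite E Rintegral_setU//; first by rewrite -E.
rewrite disj_set2E; apply/eqP; apply/seteqP; split=> // s [] /=; rewrite !in_itv/= andbT.
by move=> /andP[_ st]; rewrite ltNge st.
Qed.

Lemma Rintegral_cc_split (f : R -> R) (r t u : R) : r <= t <= u -> L1 `[r, u] f ->
  \int[leb]_(s in `[r, u]) f s = \int[leb]_(s in `[r, t]) f s + \int[leb]_(s in `[t, u]) f s.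
Proof.
move=> /andP[rt tu] fi.
have i0 : L1 `[r, t[ f.
  by apply: L1_sub fi => // s /=; rewrite !in_itv/= => /andP[-> /ltW st]/=; exact: le_trans tu.
rewrite -(Rintegral_itv_bndo_bndc i0).
have E : `[r, u]%classic = `[r, t[%classic `|` `[t, u]%classic.
  by rewrite -itv_bndbnd_setU// bnd_simp.
rewrite E Rintegral_setU//; first by rewrite -E.
rewrite disj_set2E; apply/eqP; apply/seteqP; split=> // s [] /=; rewrite !in_itv/=.
by move=> /andP[_ st] /andP[]; rewrite leNgt st.
Qed.

Lemma Kc_ode n phi i (r t : R) : r <= t ->
  L1 setT (fun s : R => green A n i (r - s) * dot (phi s) (e i)) ->
  L1 setT (fun s : R => green A n i (t - s) * dot (phi s) (e i)) ->
  L1 `[r, t] (psi phi i) /\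
  expR (lam i * t) * Kc A n phi t i = expR (lam i * r) * Kc A n phi r i +
    \int[leb]_(s in `[r, t]) psi phi i s.
Proof.
move=> rt ir it; case: (ltnP i n) => ni.
  have [i1 E1] := Kc_psi_lo ni ir; have [i2 E2] := Kc_psi_lo ni it.
  split.
    have i3 : L1 `]r, t] (psi phi i).
      by apply: L1_sub i1 => // s /=; rewrite !in_itv/= andbT => /andP[].
    apply/integrableP; split.
      apply/measurable_EFinP/measurable_fun_itv_obnd_cbndP; exact: L1_measurable i3.
    case/integrableP: i3 => /measurable_EFinP m3; rewrite integral_itv_obnd_cbnd//.
    by apply/measurable_EFinP; exact: measurableT_comp.
  have key := Rintegral_oy_split rt i1.
  refine (etrans E2 (etrans _ (congr1 (fun z => z + _) (esym E1)))).
  by rewrite key; ring.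
have [i1 E1] := Kc_psi_hi ni ir; have [i2 E2] := Kc_psi_hi ni it.
split.
  have i3 : L1 `[r, t[ (psi phi i).
    by apply: L1_sub i2 => // s /=; rewrite !in_itv/= => /andP[].
  apply/integrableP; split.
    apply/measurable_EFinP/measurable_fun_itv_bndo_bndcP; exact: L1_measurable i3.
  case/integrableP: i3 => /measurable_EFinP m3; rewrite integral_itv_bndo_bndc//.
  by apply/measurable_EFinP; exact: measurableT_comp.
have key := Rintegral_Nyo_split rt i2.
exact: (etrans E2 (etrans key (congr1 (fun z => z + _) (esym E1)))).
Qed.

Lemma Kop_ode n phi i (r t : R) : r <= t ->
  Kgood A alpha n phi r -> Kgood A alpha n phi t ->
  L1 `[r, t] (psi phi i) /\
  Ycoef (Kop A alpha n phi) i t = Ycoef (Kop A alpha n phi) i r +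
    \int[leb]_(s in `[r, t]) psi phi i s.
Proof.
move=> rt [ir cr] [it ct]; have [i1 E] := Kc_ode rt (ir i) (it i); split => //.
have Er : Ycoef (Kop A alpha n phi) i r = expR (lam i * r) * Kc A n phi r i.
  exact: congr1 (cr i).
have Et : Ycoef (Kop A alpha n phi) i t = expR (lam i * t) * Kc A n phi t i.
  exact: congr1 (ct i).
exact: (etrans Et (etrans E (congr1 (fun z => z + _) (esym Er)))).
Qed.

Lemma primitive_continuous (f p : R -> R) (x y : R) : x < y -> L1 `[x, y] p ->
  (forall t, x <= t <= y -> f t = f x + \int[leb]_(s in `[x, t]) p s) ->
  {within `[x, y], continuous f}.
Proof.
move=> xy ip hf; have := parameterized_integral_continuous (ltW xy) ip.
move=> /subspace_continuousP h; apply/subspace_continuousP => t txy.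
have ft : f t = f x + \int[leb]_(s in `[x, t]) p s.
  by apply: hf; move: txy; rewrite /= in_itv.
have hE := h t txy; move/cvgrPdist_le: hE => hE; apply/cvgrPdist_le => eps eps0.
have := hE eps eps0; rewrite !near_withinE; apply: filterS => s hs sxy.
have hfs : f s = f x + \int[leb]_(s in `[x, s]) p s.
  by apply: hf; move: sxy; rewrite /= in_itv.
by rewrite /from_subspace ft hfs opprD addrACA subrr add0r; exact: hs.
Qed.

Lemma primitive_continuousT (f p : R -> R) :
  (forall r t, r <= t -> L1 `[r, t] p) ->
  (forall r t, r <= t -> f t = f r + \int[leb]_(s in `[r, t]) p s) -> continuous f.
Proof.
move=> ip hf t; have xy : t - 1 < t + 1 by rewrite ltrD2l -subr_gt0 opprK.
have := primitive_continuous xy (ip _ _ (ltW xy)).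
move=> /(_ f) h; have {h} : {within `[(t - 1), (t + 1)], continuous f}.
  by apply: h => s /andP[ts _]; exact: hf.
move=> /(continuous_within_itvP _ xy)[h _ _]; apply: h.
by rewrite in_itv/= ltrBlDr ltrDl ltr01.
Qed.

Lemma Kop_coef_continuous n phi i : (forall t, Kgood A alpha n phi t) ->
  continuous (fun t => dot (Kop A alpha n phi t) (e i)).
Proof.
move=> g; have cY : continuous (Ycoef (Kop A alpha n phi) i).
  apply: (primitive_continuousT (p := psi phi i)) => r t rt.
    by have [] := Kop_ode i rt (g r) (g t).
  by have [] := Kop_ode i rt (g r) (g t).
rewrite (_ : (fun t => _) = fun t => expR (- lam i * t) * Ycoef (Kop A alpha n phi) i t); last first.
  by apply/funext => t; rewrite /Ycoef mulrA -expRD mulNr addNr expR0 mul1r.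
move=> t; apply: cvgM; last exact: cY.
apply: (continuous_comp (f := fun t : R => - lam i * t)); last exact: continuous_expR.
by apply: cvgM; [exact: cvg_cst|exact: cvg_id].
Qed.

Lemma near_expR (mu t0 : R) : exists2 C, 0 < C & \forall t \near t0, expR (- mu * t) <= C.
Proof.
exists (expR (- mu * t0) + 1); first by rewrite ltr_wpDl ?expR_ge0.
have h : (fun t : R => expR (- mu * t)) @ t0 --> expR (- mu * t0).
  apply: (continuous_comp (f := fun t : R => - mu * t)); last exact: continuous_expR.
  by apply: cvgM; [exact: cvg_cst|exact: cvg_id].
move/cvgrPdist_le: h => /(_ _ ltr01); apply: filterS => t ht.
by rewrite -lerBlDl (le_trans _ ht)// distrC ler_norm.
Qed.

Lemma within_ext (V : topologicalType) (D : set R) (f g : R -> V) :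
  (forall s, D s -> f s = g s) -> {within D, continuous f} -> {within D, continuous g}.
Proof.
move=> fg; apply: subspace_eq_continuous => s; rewrite inE => Ds.
by rewrite /from_subspace; exact: fg.
Qed.

Lemma within_shift (V : topologicalType) tau (f : R -> V) (D E : set R) :
  (forall s, E s -> D (s + tau)) ->
  {within D, continuous f} -> {within E, continuous (fun s : R => f (s + tau))}.
Proof.
move=> ED /subspace_continuousP cf; apply/subspace_continuousP => s Es.
move=> B /(cf _ (ED _ Es)) hB'.
have hB : \forall x \near s + tau, D x -> B (f x) by exact: hB'.
suff : \forall x \near s, E x -> B (f (x + tau)) by [].
have : (fun s : R => s + tau) @ s --> s + tau by apply: cvgD; [exact: cvg_id|exact: cvg_cst].
move=> /(_ _ hB); rewrite nbhs_simpl/=; apply: filterS => x hx Ex.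
by apply: hx; exact: ED.
Qed.

Lemma hom_within mu c (x : X) (D : set R) (b : nat -> bool) : cut_ok mu c ->
  (forall i t, D t -> c i t = b i) -> {within D, continuous (hom c x)}.
Proof.
move=> hc cb; apply/subspace_continuousP => t Dt.
apply: frac_cvg_coef => [i|eps eps0].
  rewrite (hom_bound _ _ hc).1 (cb i t Dt).
  have hcv : (fun s : R => if b i then expR (- lam i * s) * dot x (e i) else 0) @ within D (nbhs t) -->
      (if b i then expR (- lam i * t) * dot x (e i) else 0).
    apply: cvg_within_filter; case: (b i); last exact: cvg_cst.
    apply: cvgM; last exact: cvg_cst.
    apply: (continuous_comp (f := fun s : R => - lam i * s)); last exact: continuous_expR.
    by apply: cvgM; [exact: cvg_cst|exact: cvg_id].
  apply: cvg_trans hcv; apply: near_eq_cvg; rewrite near_withinE; apply: nearW => s Ds.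
  by rewrite (hom_bound _ _ hc).1 (cb i s Ds).
have [E E0 hE] := near_expR mu t.
have /cvgr0Pnorm_le/(_ _ (divr_gt0 eps0 E0))[M _ hM] := fracQ_cvg0 x.
exists M; rewrite near_withinE; move: hE; apply: filterS => s hs _.
rewrite (le_trans (hom_tail _ _ _ hc))//.
rewrite (le_trans (ler_pM _ _ (hM M (leqnn M)) hs))// ?expR_ge0//.
by rewrite divfK// gt_eqF.
Qed.

Lemma lam_powR_cvg0 (b : R) : 0 < b -> (fun M => lam M `^ (- b)) @ \oo --> (0 : R).
Proof.
move=> b0; apply/cvgr0Pnorm_le => eps eps0.
have h := eigval_infty A; move/cvgryPge: h => /(_ (eps^-1 `^ b^-1)).
apply: filterS => M hM; rewrite ger0_norm ?powR_ge0// powRN.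
rewrite -[leRHS]invrK lef_pV2 ?posrE ?invr_gt0// ?powR_gt0 ?eigval_pos//.
have -> : eps^-1 = (eps^-1 `^ b^-1) `^ b.
  by rewrite -powRrM mulVf ?gt_eqF// powRr1// invr_ge0 ltW.
by apply: ge0_ler_powR; rewrite ?nnegrE ?(ltW b0) ?powR_ge0// ltW// eigval_pos.
Qed.

(** The Green operator in fact maps into D(A^b) for every b < 1. On modes beyond [M] the surplus
    exponent yields the factor lam_M^-(b-a), small uniformly in bounded times: this replaces a
    compactness argument. *)
Lemma Kop_tailH n mu phi C t M b : a < b < 1 -> spectral_gap A n mu -> cmeas A phi ->
  0 <= C -> (forall s, `|phi s| <= C * expR (- mu * s)) ->
  `|fracQ M (Kop A alpha n phi t)| <= lam M `^ (- (b - a)) * (kappa A n mu b * C * expR (- mu * t)).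
Proof.
move=> /andP[ab b1] gap mphi C0 hC.
have hb : 0 <= b < 1 by rewrite b1 andbT (le_trans (ge0 alpha))// ltW.
have [[_ hc] _] := K_boundH t (lt_trans ab b1) gap mphi C0 hC.
have [_ hN] := Kc_boundH t hb gap mphi C0 hC.
have k0 := kappa_ge0 hb gap.
apply: fracnorm_ub; first by rewrite !mulr_ge0 ?powR_ge0 ?expR_ge0.
move=> N; rewrite exprMn; apply: (le_trans _ (ler_wpM2l (sqr_ge0 _) (hN N))).
rewrite mulr_sumr; apply: ler_sum => j _; rewrite fracQ_coef hc.
case: ltnP => Mj; first by rewrite mulr0 expr0n/= mulr_ge0 ?sqr_ge0.
rewrite -exprMn mulrA [leLHS]exprMn [leRHS]exprMn ler_wpM2r ?sqr_ge0// ler_sqr ?nnegrE ?mulr_ge0 ?powR_ge0//.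
have lj := eigval_pos A j.
have -> : lam j `^ a = lam j `^ (- (b - a)) * lam j `^ b.
  by rewrite -powRD ?(gt_eqF lj) ?implybT//; congr (_ `^ _); ring.
rewrite ler_wpM2r ?powR_ge0// !powRN lef_pV2 ?posrE ?powR_gt0 ?eigval_pos//.
apply: ge0_ler_powR; rewrite ?nnegrE ?subr_ge0 ?(ltW ab) ?(ltW (eigval_pos _ _))//.
exact: eigval_mono.
Qed.

Lemma Kop_continuousH n mu phi C : a < 1 -> spectral_gap A n mu -> cmeas A phi ->
  0 <= C -> (forall s, `|phi s| <= C * expR (- mu * s)) ->
  continuous (Kop A alpha n phi).
Proof.
move=> a1 gap mphi C0 hC t0.
have g t : Kgood A alpha n phi t by have [] := K_boundH t a1 gap mphi C0 hC.
apply: frac_cvg_coef => [i|eps eps0]; first exact: (Kop_coef_continuous (i := i) g).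
(* Any exponent strictly between alpha and 1 would do. *)
pose b := (a + 1) / 2.
have hab : a < b < 1 by rewrite /b; lra.
have hb : 0 <= b < 1 by case/andP: hab => ab ->; rewrite (le_trans (ge0 alpha))// ltW.
have [E E0 hE] := near_expR mu t0.
pose K := kappa A n mu b * C * E; have K0 : 0 <= K.
  by rewrite !mulr_ge0 ?kappa_ge0// ltW.
have ba : 0 < b - a by rewrite subr_gt0; case/andP: hab.
have K1 : 0 < K + 1 by rewrite ltr_wpDl.
have /cvgr0Pnorm_le/(_ _ (divr_gt0 eps0 K1))[M _ hM] := lam_powR_cvg0 ba.
exists M; apply: filterS hE => t ht.
rewrite (le_trans (Kop_tailH t M hab gap mphi C0 hC))//.
have := hM M (leqnn M); rewrite /= ger0_norm ?powR_ge0// ler_pdivlMr// => {}hM.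
apply: le_trans hM; rewrite ler_wpM2l ?powR_ge0//.
apply: (@le_trans _ _ K); last by rewrite lerDl.
by rewrite /K ler_wpM2l// mulr_ge0// kappa_ge0.
Qed.

(** No regularity is gained here. Instead the Green operator commutes with the tail projections, and
    the weighted integral of the tails of [phi] tends to 0 by dominated convergence. *)
Lemma Kop_continuousX n mu (phi : R -> X) : spectral_gap A n mu -> cmeas A phi ->
  L1 setT (fun s : R => expR (mu * s) * `|phi s|) ->
  continuous (Kop A alpha n phi).
Proof.
move=> gap mphi ip t0.
have g t : Kgood A alpha n phi t by have [] := K_boundX t gap mphi ip.
apply: frac_cvg_coef => [i|eps eps0]; first exact: (Kop_coef_continuous (i := i) g).
have [E E0 hE] := near_expR mu t0.
have mQ M : cmeas A (fun s => fracQ M (phi s)).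
  move=> i; under eq_fun do rewrite fracQ_coef.
  by case: (i < M)%N; [exact: measurable_cst|exact: mphi].
have mw M : measurable_fun [set: mR] (fun s : R => expR (mu * s) * `|fracQ M (phi s)|).
  by apply: measurable_funM; [exact: measurable_expRM|exact: measurable_fracnorm (mQ M)].
have iQ M : L1 setT (fun s : R => expR (mu * s) * `|fracQ M (phi s)|).
  apply: (L1_le _ (mw M) _ ip) => // s _.
  rewrite ger0_norm ?mulr_ge0 ?expR_ge0//.
  by rewrite ler_wpM2l ?expR_ge0// fracQ_norm.
have QK M t : fracQ M (Kop A alpha n phi t) = Kop A alpha n (fun s => fracQ M (phi s)) t.
  have [[_ c1] _] := K_boundX t gap (mQ M) (iQ M).
  apply: frac_eq => i; rewrite fracQ_coef c1 (g t).2 /Kc.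
  case: ifPn => iM; last first.
    by apply: eq_Rintegral => s _; rewrite fracQ_coef (negbTE iM).
  by under eq_Rintegral do rewrite fracQ_coef iM mulr0; rewrite Rintegral_cst// mul0r.
have hcv : (fun M => \int[leb]_s (expR (mu * s) * `|fracQ M (phi s)|)) @ \oo --> (0 : R).
  have d1 M : measurable_fun [set: mR] (fun s : R => (expR (mu * s) * `|fracQ M (phi s)|)%:E).
    by apply/measurable_EFinP.
  have d2 : {ae leb, forall s, setT s ->
      (fun M => (expR (mu * s) * `|fracQ M (phi s)|)%:E) @ \oo --> (0%E : \bar R)}.
    apply: aeW => s _; apply: cvg_EFin; first exact: nearW.
    rewrite [X in _ --> X](_ : _ = expR (mu * s) * `|0 : X|); last by rewrite normr0 mulr0.
    by apply: cvgM; [exact: cvg_cst|apply: cvg_norm; exact: fracQ_cvg0].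
  have d3 : {ae leb, forall s M, setT s ->
      (`|(expR (mu * s) * `|fracQ M (phi s)|)%:E| <= (expR (mu * s) * `|phi s|)%:E)%E}.
    apply: aeW => s M _; rewrite lee_fin ger0_norm ?mulr_ge0 ?expR_ge0//.
    by rewrite ler_wpM2l ?expR_ge0// fracQ_norm.
  have [_ _ h] := dominated_convergence measurableT d1 (measurable_cst _) d2 ip d3.
  by move: h; rewrite integral_cst// mul0e => /fine_cvg.
move/cvgr0Pnorm_le: hcv => /(_ _ (divr_gt0 eps0 E0))[M _ hM].
exists M; apply: filterS hE => t ht; rewrite QK.
have [_ hn] := K_boundX t gap (mQ M) (iQ M); rewrite (le_trans hn)//.
have := hM M (leqnn M); rewrite /= => {}hM.
apply: (@le_trans _ _ (E * (eps / E))); last by rewrite mulrC divfK// gt_eqF.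
apply: ler_pM; rewrite ?expR_ge0//.
  by apply: Rintegral_ge0 => s _; rewrite mulr_ge0 ?expR_ge0.
exact: le_trans (ler_norm _) hM.
Qed.

End continuity_from_coefficients.

(** * Mild and Lyapunov-Perron equations in coefficient form *)

Section bochner_coefficients.
Context {R : realType} {H : hilbertType R} (A : posOperator H) (alpha : {nonneg R}).
Local Notation e := (eigvec A).
Local Notation lam := (eigval A).
Local Notation X := (fracSpace A alpha).
Local Notation leb := (@lebesgue_measure R).
Local Notation mR := (measurableTypeR R).
Local Notation L1 D f := (leb.-integrable (D : set mR) (EFin \o f)).
Hypothesis hsep : separable H.

(** The integral is defined as a chosen vector representing a functional, so such a vector must be
    exhibited. Its coefficients are the integrals of those of [f], square summable by Minkowski's
    inequality. *)
Lemma bochner_coef (D : set R) (f : R -> H) (c : nat -> R -> R) (b : R -> R) :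
  measurable D -> (forall i, measurable_fun D (c i)) ->
  (forall i s, D s -> dot (f s) (e i) = c i s) ->
  L1 D b -> (forall s, D s -> 0 <= b s) ->
  (forall s N, D s -> \sum_(0 <= i < N) c i s ^+ 2 <= b s ^+ 2) ->
  forall i, dot (bochner_integral D f) (e i) = \int[leb]_(s in D) c i s.
Proof.
move=> mD mc fc ib b0 hb.
have mf i : measurable_fun D (fun s => dot (f s) (e i)).
  by apply: eq_measurable_fun (mc i) => s /set_mem Ds; rewrite fc.
have fb s : D s -> `|f s| <= b s.
  move=> Ds; apply: (@norm_coef_ub _ _ A); first exact: b0.
  by move=> N; under eq_bigr do rewrite fc//; exact: hb.
have mfH : measurable_fun D (f : R -> borel H) by exact/(borel_coefP A f hsep mD).
have mnf : measurable_fun (D : set mR) (fun s : R => `|f s|) by exact: (measurable_norm mf).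
have inf : L1 D (fun s : R => `|f s|).
  by apply: (L1_le mD mnf _ ib) => s Ds; rewrite normr_id; exact: fb.
have bi : bochner_integrable D f.
  split => //; case/integrableP: inf => _; under eq_integral do rewrite /= normr_id.
  exact.
have idot h : L1 D (fun s : R => dot (f s) h).
  apply: (@L1_le _ D _ (fun s => `|h| * `|f s|) mD); last exact: L1Z.
    apply: (measurable_fun_cvg (h := fun N s => \sum_(0 <= j < N) dot h (e j) * dot (f s) (e j))).
      by move=> N; apply: measurable_sum => j; apply: measurable_funM => //; exact: mf.
    move=> s Ds; have hh : (fun N => dot (series (fun j => dot h (e j) *: e j) N) (f s)) @ \oo --> dot h (f s).
      by apply: cvg_dot; exact: eigvec_basis.
    rewrite dotC (_ : (fun N => _) = (fun N => dot (series (fun j => dot h (e j) *: e j) N) (f s)))//.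
    apply/funext => N; rewrite /series/= dot_suml; apply: eq_bigr => j _.
    by rewrite dotZl (dotC (e j)).
  by move=> s Ds; rewrite mulrC; exact: dot_le.
have [y yE] : exists y : H, forall j, dot y (e j) = \int[leb]_(s in D) dot (f s) (e j).
  apply: (@coef_series _ _ A _ ((\int[leb]_(s in D) b s) ^+ 2)) => N.
  under eq_bigr do rewrite Rintegral_restrict.
  rewrite [X in _ <= X ^+ 2]Rintegral_restrict.
  apply: minkowski_Rintegral.
  - move=> i; have /(L1_restrict _ mD)/L1_measurable := idot (e i); exact.
  - exact/(L1_restrict _ mD).
  - by move=> s; case: ifPn => // /set_mem; exact: b0.
  move=> s; case: ifPn => [/set_mem Ds|_]; last by rewrite big1 ?expr0n// => i _; rewrite expr0n.
  by under eq_bigr do rewrite fc//; exact: hb.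
(* True on basis vectors, hence on the partial expansions of [h] by linearity, hence on [h] because
   both sides are continuous in it. *)
have yh h : dot y h = \int[leb]_(s in D) dot (f s) h.
  pose hN N := series (fun j => dot h (e j) *: e j) N.
  have hNh : hN @ \oo --> h by exact: eigvec_basis.
  have yN N : dot y (hN N) = \int[leb]_(s in D) dot (f s) (hN N).
    have dN (u : H) : dot u (hN N) = \sum_(0 <= j < N) dot h (e j) * dot u (e j).
      rewrite dotC /hN /series/= dot_suml; apply: eq_bigr => j _.
      by rewrite dotZl (dotC (e j)).
    rewrite dN; under eq_Rintegral do rewrite dN.
    rewrite Rintegral_sum//; last by move=> i _; apply: L1Z => //; exact: idot.
    by apply: eq_bigr => j _; rewrite yE RintegralZl//; exact: idot.
  have c1 : (fun N => dot y (hN N)) @ \oo --> dot y h.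
    rewrite dotC (_ : (fun N => _) = fun N => dot (hN N) y); first exact: cvg_dot.
    by apply/funext => N; rewrite dotC.
  apply: (cvg_unique _ c1) => //; rewrite (_ : (fun N => _) = fun N => \int[leb]_(s in D) dot (f s) (hN N)); last first.
    by apply/funext => N; exact: yN.
  pose I := \int[leb]_(s in D) `|f s|; have I0 : 0 <= I by apply: Rintegral_ge0 => s _.
  apply/cvgrPdist_le => eps eps0; have I1 : 0 < I + 1 by rewrite ltr_wpDl.
  move/cvgrPdist_le: hNh => /(_ _ (divr_gt0 eps0 I1)); apply: filterS => N hN'.
  rewrite -RintegralB//.
  under eq_Rintegral do rewrite -dotBr.
  have iB := idot (h - hN N).
  have mDm : measurable (D : set mR) by exact: mD.
  rewrite (le_trans (le_normr_Rintegral mDm iB))//.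
  apply: (@le_trans _ _ (\int[leb]_(s in D) (eps / (I + 1) * `|f s|))).
    apply: le_Rintegral => //; first exact: integrable_norm iB; first exact: L1Z.
    move=> s Ds; rewrite (le_trans (dot_le _ _))// mulrC ler_wpM2r//.
  rewrite RintegralZl// -/I mulrAC ler_pdivrMr// ler_pM2l// lerDl//.
have [_ hy] : [set y | bochner_integrable D f /\
    forall h : H, dot y h = \int[leb]_(s in D) dot (f s) h] (bochner_integral D f).
  rewrite /bochner_integral; case: xgetP => [z _ //|/(_ y)]; case; split => //.
move=> i; rewrite hy; apply: eq_Rintegral => s /set_mem Ds; exact: fc.
Qed.

Lemma psi_shift (f : R -> H) i t s :
  expR (- lam i * (t - s)) * dot (f s) (e i) = expR (- lam i * t) * psi A f i s.
Proof. by rewrite /psi mulrA -expRD; congr (expR _ * _); ring. Qed.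

(** A vector is determined by its coefficients, and multiplying the i-th one by exp(lam_i t)
    eliminates the semigroup. Integrability of [f] keeps the Bochner integral away from its default
    value. *)
Lemma mild_coef (v vr : H) (f : R -> H) (r t : R) : r <= t ->
  (forall i, measurable_fun `[r, t] (fun s => dot (f s) (e i))) ->
  L1 `[r, t] (fun s => `|f s|) ->
  (v = semigroup A (t - r) vr + bochner_integral `[r, t] (fun s => semigroup A (t - s) (f s))) <->
  forall i, expR (lam i * t) * dot v (e i) =
    expR (lam i * r) * dot vr (e i) + \int[leb]_(s in `[r, t]) psi A f i s.
Proof.
move=> rt mf inf; pose c i s := expR (- lam i * t) * psi A f i s.
have fi i : L1 `[r, t] (fun s => dot (f s) (e i)).
  by apply: (L1_le _ (mf i) _ inf) => // s _; exact: coef_le.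
have ip i := psi_L1 (fi i).
have fc i s : `[r, t]%classic s -> dot (semigroup A (t - s) (f s)) (e i) = c i s.
  rewrite /= in_itv/= => /andP[_ st].
  by rewrite semigroup_coef_ge0 ?subr_ge0// /c -psi_shift mulNr.
have bc : forall i, dot (bochner_integral `[r, t] (fun s => semigroup A (t - s) (f s))) (e i) =
    \int[leb]_(s in `[r, t]) c i s.
  apply: (bochner_coef (c := c) (b := fun s => `|f s|)) => //.
    by move=> i; apply: measurable_funM => //; exact: L1_measurable (ip i).
  move=> s N; rewrite /= in_itv/= => /andP[_ st].
  apply: le_trans (norm_coef_lb A (f s) N); apply: ler_sum => i _.
  rewrite /c -psi_shift exprMn ler_piMl ?sqr_ge0// expr_le1 ?expR_ge0//.
  by rewrite -expR0 ler_expR mulNr oppr_le0 mulr_ge0 ?subr_ge0// ltW// eigval_pos.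
have eE (x y z : R) i : (x = expR (- (lam i * (t - r))) * y + expR (- lam i * t) * z) <->
    expR (lam i * t) * x = expR (lam i * r) * y + z.
  have E1 : expR (lam i * t) * expR (- lam i * t) = 1 by rewrite -expRD mulNr subrr expR0.
  have E2 : expR (- (lam i * (t - r))) = expR (- lam i * t) * expR (lam i * r).
    by rewrite -expRD; congr expR; ring.
  split=> [->|h]; first by rewrite E2 mulrDr !mulrA E1 !mul1r.
  have -> : x = expR (- lam i * t) * (expR (lam i * t) * x) by rewrite mulrA (mulrC (expR _)) E1 mul1r.
  by rewrite h E2; ring.
split=> [-> i|h]; last first.
  apply: (@eq_coef _ _ A) => i; rewrite dotDl semigroup_coef_ge0 ?subr_ge0// bc /c RintegralZl//.
  by apply: (eE _ _ _ i).2; exact: h.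
by apply: (eE _ _ _ i).1; rewrite dotDl semigroup_coef_ge0 ?subr_ge0// bc /c RintegralZl.
Qed.

(** The weight exp(lam_(n+1) s) is the one of the slowest high mode, which dominates the others in
    the integral from minus infinity; the low modes are integrated over a bounded interval only. *)
Lemma lyapunov_perron_coef (n : nat) (xi x : H) (f : R -> H) (t : R) : t <= 0 ->
  projP A n x = x ->
  (forall i, measurable_fun `]-oo, (0:R)] (fun s => dot (f s) (e i))) ->
  L1 `]-oo, (0:R)] (fun s : R => expR (lam n * s) * `|f s|) ->
  (xi = semigroup A t x
      - bochner_integral `[t, 0] (fun s => semigroup A (t - s) (projP A n (f s)))
      + bochner_integral `]-oo, t] (fun s => semigroup A (t - s) (projQ A n (f s)))) <->
  forall i, expR (lam i * t) * dot xi (e i) =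
    if (i < n)%N then dot x (e i) - \int[leb]_(s in `[t, 0]) psi A f i s
    else \int[leb]_(s in `]-oo, t]) psi A f i s.
Proof.
move=> t0 xP mf inf.
have sub1 : `[t, 0] `<=` `]-oo, (0:R)] by move=> s /=; rewrite !in_itv/= => /andP[].
have sub2 : `]-oo, t] `<=` `]-oo, (0:R)] by move=> s /=; rewrite !in_itv/= => /le_trans; exact.
have mp i : measurable_fun (`]-oo, (0:R)] : set mR) (psi A f i) by exact: (measurable_psi (mf i)).
have mp1 i : measurable_fun (`[t, 0] : set mR) (psi A f i) by apply: measurable_funS (mp i).
have mp2 i : measurable_fun (`]-oo, t] : set mR) (psi A f i) by apply: measurable_funS (mp i).
have mn : measurable_fun (`]-oo, (0:R)] : set mR) (fun s => `|f s|) by exact: measurable_norm mf.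
have ip2 i : (n <= i)%N -> L1 `]-oo, t] (psi A f i).
  move=> ni; have i0 : L1 `]-oo, t] (fun s : R => expR (lam n * s) * `|f s|) by apply: L1_sub inf.
  apply: (@L1_le _ _ _ (fun s => 1 * (expR (lam n * s) * `|f s|)) _ (mp2 i)) => //; last exact: L1Z.
  move=> s /=; rewrite in_itv/= => st; rewrite mul1r /psi normrM (ger0_norm (expR_ge0 _)).
  rewrite ler_pM ?expR_ge0 ?coef_le// ler_expR -subr_ge0 -mulrBl mulr_le0 //.
    by rewrite subr_le0 eigval_mono.
  exact: le_trans st t0.
have i1 : L1 `[t, 0] (fun s : R => expR (lam n * s) * `|f s|) by apply: L1_sub inf.
have inf1 : L1 `[t, 0] (fun s : R => `|f s|).
  apply: (@L1_le _ _ _ (fun s => expR (- lam n * t) * (expR (lam n * s) * `|f s|))) => //; last exact: L1Z.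
    by apply: measurable_funS mn.
  move=> s /=; rewrite in_itv/= => /andP[ts _]; rewrite normr_id mulrA -expRD ler_peMl//.
  rewrite -expR0 ler_expR mulNr addrC -mulrBr mulr_ge0 ?subr_ge0// ltW// eigval_pos//.
have ip1 i : L1 `[t, 0] (psi A f i).
  apply: psi_L1; apply: (L1_le _ _ _ inf1) => //; last by move=> s _; exact: coef_le.
  by apply: measurable_funS (mf i).
pose c1 i s := if (i < n)%N then expR (- lam i * t) * psi A f i s else 0.
pose c2 i s := if (i < n)%N then 0 else expR (- lam i * t) * psi A f i s.
have b1 : forall i, dot (bochner_integral `[t, 0] (fun s => semigroup A (t - s) (projP A n (f s)))) (e i) =
    \int[leb]_(s in `[t, 0]) c1 i s.
  apply: (bochner_coef (c := c1) (b := fun s => expR (- lam n * t) * `|f s|)) => //.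
  - move=> i; rewrite /c1; case: (i < n)%N; last exact: measurable_cst.
    by apply: measurable_funM => //; exact: mp1.
  - move=> i s _; rewrite (@semigroup_coef_proj _ _ _ _ _ n); last first.
      by apply: (@eq_coef _ _ A) => j; rewrite !projP_coef; case: (j < n)%N.
    rewrite projP_coef /c1; case: ifP => _; last by rewrite mulr0.
    by rewrite -psi_shift mulNr.
  - exact: L1Z.
  move=> s N; rewrite /= in_itv/= => /andP[ts s0].
  rewrite exprMn; apply: (le_trans _ (ler_wpM2l (sqr_ge0 _) (norm_coef_lb A (f s) N))).
  rewrite mulr_sumr; apply: ler_sum => i _; rewrite /c1.
  case: ifPn => ni; last by rewrite expr0n/= mulr_ge0 ?sqr_ge0.
  rewrite -psi_shift exprMn ler_wpM2r ?sqr_ge0// ler_sqr ?nnegrE ?expR_ge0// ler_expR.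
  rewrite !mulNr lerN2; apply: (@le_trans _ _ (lam i * t)).
    by rewrite ler_wnM2r// eigval_mono// ltnW.
  by rewrite ler_wpM2l ?(ltW (eigval_pos _ _))// lerBrDr gerDl.
have b2 : forall i, dot (bochner_integral `]-oo, t] (fun s => semigroup A (t - s) (projQ A n (f s)))) (e i) =
    \int[leb]_(s in `]-oo, t]) c2 i s.
  apply: (bochner_coef (c := c2) (b := fun s : R => expR (- lam n * t) * (expR (lam n * s) * `|f s|))) => //.
  - move=> i; rewrite /c2; case: (i < n)%N; first exact: measurable_cst.
    by apply: measurable_funM => //; exact: mp2.
  - move=> i s; rewrite /= in_itv/= => st; rewrite semigroup_coef_ge0 ?subr_ge0//.
    rewrite projQ_coef /c2; case: ifP => _; first by rewrite mulr0.
    by rewrite -psi_shift mulNr.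
  - by apply: L1Z => //; apply: L1_sub inf.
  move=> s N; rewrite /= in_itv/= => st.
  rewrite mulrA exprMn; apply: (le_trans _ (ler_wpM2l (sqr_ge0 _) (norm_coef_lb A (f s) N))).
  rewrite mulr_sumr; apply: ler_sum => i _; rewrite /c2.
  case: ltnP => ni; first by rewrite expr0n/= mulr_ge0 ?sqr_ge0.
  rewrite -psi_shift exprMn ler_wpM2r ?sqr_ge0// ler_sqr ?nnegrE ?mulr_ge0 ?expR_ge0//.
  rewrite -expRD ler_expR (_ : - lam n * t + lam n * s = - lam n * (t - s)); last by ring.
  by rewrite ler_wpM2r ?subr_ge0// lerN2 eigval_mono.
have s0 i := semigroup_coef_proj t i xP.
move: b1 b2 s0; set U := bochner_integral _ _; set V := bochner_integral _ _; set S := semigroup A t x.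
move: U V S => U V S b1 b2 s0.
have coefR i : dot (S - U + V) (e i) = expR (- lam i * t) *
    (if (i < n)%N then dot x (e i) - \int[leb]_(s in `[t, 0]) psi A f i s
    else \int[leb]_(s in `]-oo, t]) psi A f i s).
  rewrite dotDl dotBl b1 b2 s0 /c1 /c2 -mulNr.
  case: ltnP => ni.
    by rewrite RintegralZl// Rintegral_cst// mul0r addr0 mulrBr.
  rewrite RintegralZl//; last exact: ip2.
  by rewrite Rintegral_cst// -xP projP_coef ltnNge ni/= mulr0 mul0r subrr add0r.
have E1 i : expR (lam i * t) * expR (- lam i * t) = 1 by rewrite -expRD mulNr subrr expR0.
split=> [-> i|h]; first by rewrite (coefR i) mulrA E1 mul1r.
apply: (@eq_coef _ _ A) => i; rewrite (coefR i) -(h i) mulrA.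
by rewrite (mulrC (expR (- lam i * t))) E1 mul1r.
Qed.

End bochner_coefficients.

(** * Solutions of the pathwise equation *)

Section pathwise_dynamics.
Context {R : realType} {H : hilbertType R} (A : posOperator H) (alpha : {nonneg R}).
Local Notation e := (eigvec A).
Local Notation lam := (eigval A).
Local Notation a := (alpha%:num).
Local Notation X := (fracSpace A alpha).
Local Notation leb := (@lebesgue_measure R).
Local Notation mR := (measurableTypeR R).
Local Notation L1 D f := (leb.-integrable (D : set mR) (EFin \o f)).
Hypothesis hsep : separable H.
Hypothesis a1 : a < 1.
Variables (F : X -> H) (L : R).
Hypothesis L0 : 0 < L.
Hypothesis F0 : F 0 = 0.
Hypothesis FL : forall u v, `|F u - F v| <= L * `|u - v|.

Lemma F_le u : `|F u| <= L * `|u|.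
Proof. by have := FL u 0; rewrite F0 !subr0. Qed.

Lemma c_alpha_ge0 : 0 <= c_alpha a.
Proof.
rewrite /c_alpha; case: ifP => // _; rewrite mulr_ge0 ?powR_ge0//.
by apply: Rintegral_ge0 => s _; rewrite mulr_ge0 ?powR_ge0 ?expR_ge0.
Qed.

(* For the Cauchy problem the weight is free, so [mu] is taken so negative
   that the Duhamel operator becomes a contraction on the whole interval. *)
Lemma small_kappa : exists2 mu, spectral_gap A 0 mu & L * kappa A 0 mu a < 1.
Proof.
pose K := L * (c_alpha a + lam 0%N `^ a).
have K0 : 0 <= K by rewrite mulr_ge0 ?(ltW L0)// addr_ge0 ?c_alpha_ge0 ?powR_ge0.
have K1 : 0 < 1 + K by rewrite ltr_pwDl.
have a1' : 0 < 1 - a by rewrite subr_gt0.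
(* [d] will be the distance from [mu] to the spectrum. As d >= 1, both terms of [kappa] are
   controlled by d^(a-1) = 1 / (1 + K), and K / (1 + K) < 1. *)
pose d := (1 + K) `^ (1 - a)^-1.
have d0 : 0 < d by rewrite powR_gt0.
have d1 : 1 <= d.
  by rewrite /d -[leLHS](powRr0 (1 + K)) ler_powR ?lerDl// invr_ge0 ltW.
have da : d `^ (a - 1) = (1 + K)^-1.
  rewrite /d -powRrM (_ : (1 - a)^-1 * (a - 1) = -1); last by field; rewrite gt_eqF.
  by rewrite powR_inv1// ltW.
exists (lam 0%N - d); first by split=> [|i //]; rewrite gtrBl.
have -> : kappa A 0 (lam 0%N - d) a = c_alpha a * d `^ (a - 1) + lam 0%N `^ a / d.
  by rewrite /kappa add0r (_ : lam 0%N - (lam 0%N - d) = d)//; ring.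
have dle : d^-1 <= d `^ (a - 1).
  by rewrite -powR_inv1 ?(ltW d0)// ler_powR// lerBrDr addNr.
apply: (@le_lt_trans _ _ (K * d `^ (a - 1))).
  rewrite /K -mulrA ler_wpM2l ?(ltW L0)// mulrDl lerD2l ler_wpM2l ?powR_ge0//.
by rewrite da ltr_pdivrMr// mul1r ltrDr.
Qed.

Lemma within_coef_cvg (v : R -> X) (D : set R) i : {within D, continuous v} ->
  {within D, continuous (fun s => dot (v s) (e i))}.
Proof.
move=> /subspace_continuousP cv; apply/subspace_continuousP => s Ds.
exact: (cvg_comp _ _ (cv s Ds) (@dot_frac_continuous _ _ A alpha i (v s))).
Qed.

Lemma within_coef_meas (v : R -> X) (D : set R) i : measurable D ->
  {within D, continuous v} -> measurable_fun D (fun s => dot (v s) (e i)).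
Proof.
by move=> mD /(@within_coef_cvg v D i) cv; exact: subspace_continuous_measurable_fun cv.
Qed.

Lemma within_bounded (v : R -> X) (r t : R) : r <= t -> {within `[r, t], continuous v} ->
  exists2 M, 0 <= M & forall s, r <= s <= t -> `|v s| <= M.
Proof.
move=> rt /subspace_continuousP cv; have cn : {within `[r, t], continuous (fun s => `|v s|)}.
  by apply/subspace_continuousP => s Ds; apply: cvg_norm; exact: cv.
have [c _ hc] := EVT_max rt cn; by exists `|v c|.
Qed.

Lemma expR_lower (mu r b : R) : exists2 c, 0 < c & forall s, r <= s <= b -> c <= expR (- mu * s).
Proof.
exists (expR (- (`|mu| * (`|r| + `|b|)))); first exact: expR_gt0.
move=> s /andP[rs sb]; rewrite ler_expR mulNr lerN2.
rewrite (le_trans (ler_norm _))// normrM ler_wpM2l// ler_norml; apply/andP; split.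
  have h1 := ler_norm (- r); rewrite normrN in h1.
  have h2 := normr_ge0 b; lra.
have h1 := ler_norm b; have h2 := normr_ge0 r; lra.
Qed.

Section forced.
Variables (zeta : R -> X) (h : R -> X).
Hypothesis zeta_cts : continuous zeta.
Hypothesis h_meas : cmeas A h.
Hypothesis h_int : forall r t, L1 `[r, t] (fun s => `|h s|).

Definition rhs (v : R -> X) (s : R) : H := F (v s + zeta s) + fracval (h s).

(** The evolution equation between two times, in coordinates where it is plain additivity of an
    integral; concatenating, cutting and shifting trajectories become immediate. *)
Definition orbit (v : R -> X) (r t : R) := forall i,
  Ycoef v i t = Ycoef v i r + \int[leb]_(s in `[r, t]) psi A (rhs v) i s.

Lemma zeta_meas i : measurable_fun [set: R] (fun s => dot (zeta s) (e i)).
Proof.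
have c : continuous (fun s : R => dot (zeta s) (e i)).
  move=> s; apply: (@continuous_comp R X R zeta (fun x : X => dot x (e i))).
    exact: zeta_cts.
  exact: dot_frac_continuous.
exact: continuous_measurable_fun c.
Qed.

Lemma F_meas (v : R -> X) (D : set R) : measurable D ->
  (forall i, measurable_fun D (fun s => dot (v s) (e i))) ->
  forall i, measurable_fun D (fun s => dot (F (v s + zeta s)) (e i)).
Proof.
move=> mD mv; apply: (lipschitz_coef_measurable (f := fun s => v s + zeta s) hsep mD FL) => i.
under eq_fun do rewrite coefD.
by apply: measurable_funD => //; apply: measurable_funTS; exact: zeta_meas.
Qed.

Lemma F_int (v : R -> X) (r t : R) : r <= t -> {within `[r, t], continuous v} ->
  exists2 M, 0 <= M & forall s, r <= s <= t -> `|F (v s + zeta s)| <= M.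
Proof.
move=> rt cv; have [M M0 hM] := within_bounded rt cv.
have [N N0 hN] := within_bounded rt (continuous_subspaceT zeta_cts).
exists (L * (M + N)); first by rewrite mulr_ge0 ?addr_ge0// ltW.
move=> s hs; rewrite (le_trans (F_le _))// ler_wpM2l ?(ltW L0)//.
by apply: (le_trans (ler_normD _ _)); apply: lerD; [exact: hM|exact: hN].
Qed.

Lemma rhs_ok (v : R -> X) (r t : R) : r <= t -> {within `[r, t], continuous v} ->
  (forall i, measurable_fun `[r, t] (fun s => dot (rhs v s) (e i))) /\
  L1 `[r, t] (fun s => `|rhs v s|).
Proof.
move=> rt cv; have mv i := within_coef_meas i (measurable_itv `[r, t]) cv.
have mF := F_meas (measurable_itv `[r, t]) mv.
have mr i : measurable_fun `[r, t] (fun s => dot (rhs v s) (e i)).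
  rewrite (_ : (fun s => _) = fun s => dot (F (v s + zeta s)) (e i) + dot (h s) (e i)).
    2: by apply/funext => s; rewrite /rhs dotDl.
  apply: measurable_funD => //.
  by apply: measurable_funTS; exact: h_meas.
split => //; have [M M0 hM] := F_int rt cv.
have iM : L1 `[r, t] (fun=> M) by apply: (@L1_bounded _ _ _ `|M|) => //.
apply: (@L1_le _ _ _ (fun s => M + (lam 0%N `^ a)^-1 * `|h s|)) => //.
- exact: (measurable_norm mr).
- move=> s /=; rewrite in_itv/= => hs; rewrite normr_id (le_trans (ler_normD _ _))//.
  by rewrite lerD ?hM// frac_norm_le.
- by apply: L1D => //; apply: L1Z.
Qed.

Lemma rhs_psi_int (v : R -> X) (r t : R) i : r <= t -> {within `[r, t], continuous v} ->
  L1 `[r, t] (psi A (rhs v) i).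
Proof.
move=> rt cv; have [mr ir] := rhs_ok rt cv; apply: psi_L1.
apply: (L1_le _ _ _ ir) => //; first exact: mr.
by move=> s _; exact: coef_le.
Qed.

Section local.
Variables (r b : R) (rb : r <= b) (vr : X).

(** Forward in time neither the noise nor the forcing has a controlled growth. Cutting both to a
    bounded interval makes every exponential weight harmless, and the whole-line fixed point theorem
    applies. *)
Let cut (V : nmodType) (f : R -> V) (s : R) : V := if (r <= s) && (s <= b) then f s else 0.

Lemma measurable_cut_set : measurable_fun [set: R] (fun s => (r <= s) && (s <= b)).
Proof.
by apply: measurable_and; apply: measurable_fun_ler.
Qed.

Let hc : R -> X := cut h.

Let hc_meas : cmeas A hc.
Proof.
move=> i; rewrite (_ : (fun s => _) = fun s => if (r <= s) && (s <= b) then dot (h s) (e i) else 0); last first.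
  by apply/funext => s; rewrite /hc /cut; case: ifP; rewrite ?coef0.
by apply: measurable_fun_ifT; [exact: measurable_cut_set|exact: h_meas|exact: measurable_cst].
Qed.

Let hc_int mu : L1 setT (fun s : R => expR (mu * s) * `|hc s|).
Proof.
have [c c0 hcl] := expR_lower mu r b.
apply: (@L1_le _ _ _ (fun s : R => c^-1 * (if s \in `[r, b]%classic then `|h s| else 0))) => //.
- apply: measurable_funM; [exact: measurable_expRM|exact: measurable_fracnorm hc_meas].
- move=> s _; rewrite ger0_norm ?mulr_ge0 ?expR_ge0// /hc /cut mem_setE in_itv/=.
  case: ifPn => [hs|_]; last by rewrite normr0 !mulr0.
  rewrite ler_wpM2r// -[leLHS]invrK -expRN -mulNr lef_pV2 ?posrE ?expR_gt0//.
  exact: hcl.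
- by apply: L1Z => //; apply/(L1_restrict _ (measurable_itv _)); exact: h_int.
Qed.

Let inip := hom (fun _ s => 0 <= s) vr.

Let cutok mu : spectral_gap A 0 mu -> cut_ok A mu (fun _ s => 0 <= s).
Proof.
by move=> [hm _] i t t0; rewrite mulr_ge0// subr_ge0 (le_trans (ltW hm))// eigval_mono.
Qed.

Let phiF (v : R -> X) : R -> H := cut (fun s => F (v s + zeta s)).

Let synth (v : R -> X) (t : R) : X :=
  (inip (t - r) + Kop A alpha 0 hc t) + Kop A alpha 0 (phiF v) t.

Let cut_bound (v : R -> X) mu M : 0 <= M ->
  (forall s, r <= s <= b -> `|F (v s + zeta s)| <= M) ->
  exists2 C, 0 <= C & forall s, `|phiF v s| <= C * expR (- mu * s).
Proof.
move=> M0 hM; have [c c0 hc'] := expR_lower mu r b.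
exists (M / c); first by rewrite divr_ge0// ltW.
move=> s; rewrite /phiF /cut; case: ifPn => hs; last by rewrite normr0 mulr_ge0 ?expR_ge0// divr_ge0// ltW.
rewrite (le_trans (hM s hs))// -mulrA ler_peMr// mulrC ler_pdivlMr// mul1r.
exact: hc'.
Qed.

Let Kc0_eq phi t i : t = r -> (forall s, s < r -> dot (phi s) (e i) = 0) ->
  Kc A 0 phi t i = 0.
Proof.
move=> -> h0; rewrite /Kc; have -> : (0 : R) = \int[leb]_s (0 : R) by rewrite Rintegral_cst// mul0r.
apply: eq_Rintegral => s _; rewrite /green ltn0 subr_gt0; case: ifPn => [/h0 ->|_]; rewrite ?mulr0 ?mul0r//.
Qed.

(** Here [v] is arbitrary: [synth v] solves the linear equation whose right-hand side is frozen
    along [v]. Existence uses it at a fixed point, uniqueness at any given solution. *)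
Let synth_orbit v mu C : spectral_gap A 0 mu -> cmeas A (phiF v) -> 0 <= C ->
  (forall s, `|phiF v s| <= C * expR (- mu * s)) ->
  [/\ synth v r = vr, {within `[r, b], continuous (synth v)} &
      forall t i, r <= t <= b -> Ycoef (synth v) i t = Ycoef (synth v) i r +
        \int[leb]_(s in `[r, t]) psi A (rhs v) i s].
Proof.
move=> gap mphi C0 hC.
have gX t := (K_boundX t gap hc_meas (hc_int mu)).1.
have gH t := (K_boundH t a1 gap mphi C0 hC).1.
have hB t x := (hom_bound x t (cutok gap)).1.
have init : synth v r = vr.
  apply: frac_eq => i; rewrite !coefD hB subrr lexx mulr0 expR0 mul1r.
  rewrite (gX r).2 (gH r).2 !Kc0_eq// ?addr0// => s sr.
    by rewrite /phiF /cut leNgt sr/= dot0l.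
  by rewrite /hc /cut leNgt sr/= coef0.
split => //.
  have cX := Kop_continuousX gap hc_meas (hc_int mu).
  have cH := Kop_continuousH a1 gap mphi C0 hC.
  apply/subspace_continuousP => t; rewrite /= in_itv/= => /andP[rt tb].
  apply: cvgD; last by apply: cvg_within_filter; exact: cH.
  apply: cvgD; last by apply: cvg_within_filter; exact: cX.
  have cI : {within `[r, b], continuous (fun t => inip (t - r))}.
    apply: (within_shift (D := `[0, +oo[%classic)) => [s|].
      by rewrite /= !in_itv/= andbT subr_ge0 => /andP[].
    have c2 (i : nat) s : `[(0 : R), +oo[%classic s -> (0 <= s) = true by rewrite /= in_itv/= andbT.
    exact: (@hom_within _ _ A alpha mu (fun _ s => 0 <= s) vr _ (fun=> true) (cutok gap) c2).
  move/subspace_continuousP: cI => /(_ t); apply; by rewrite /= in_itv/= rt.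
move=> t i /andP[rt tb].
have [iX EX] := Kop_ode i rt (gX r) (gX t).
have [iH EH] := Kop_ode i rt (gH r) (gH t).
have YD s : Ycoef (synth v) i s = Ycoef (fun t => inip (t - r)) i s +
    Ycoef (Kop A alpha 0 hc) i s + Ycoef (Kop A alpha 0 (phiF v)) i s.
  by rewrite /Ycoef !coefD !mulrDr.
have Y0 s : r <= s -> Ycoef (fun t => inip (t - r)) i s = expR (lam i * r) * dot vr (e i).
  by move=> rs; rewrite /Ycoef hB subr_ge0 rs mulrA -expRD; congr (expR _ * _); ring.
have key : \int[leb]_(s in `[r, t]) psi A (rhs v) i s =
    \int[leb]_(s in `[r, t]) psi A hc i s + \int[leb]_(s in `[r, t]) psi A (phiF v) i s.
  rewrite -RintegralD//; apply: eq_Rintegral => s; rewrite inE/= in_itv/= => /andP[rs st].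
  rewrite /psi -mulrDr -dotDl; congr (_ * dot _ _).
  by rewrite /hc /phiF /cut rs (le_trans st tb)/= addrC.
rewrite (YD t) (YD r) (Y0 t rt) (Y0 r (lexx r)) key.
apply: (etrans (f_equal2 (fun p q => expR (lam i * r) * dot vr (e i) + p + q) EX EH)).
by cbv beta; ring.
Qed.

Lemma local_solution : exists v : R -> X,
  [/\ v r = vr, {within `[r, b], continuous v} & forall t, r <= t <= b -> orbit v r t].
Proof.
have [mu gap hk] := small_kappa.
(* The noise path is fixed here, so the parameter space is trivial. *)
pose G (_ : unit) (s : R) (u : X) : H := if (r <= s) && (s <= b) then F (u + zeta s) else 0.
pose a0 (p : unit * R) : X := inip (p.2 - r) + Kop A alpha 0 hc p.2.
have Gm (eta : unit * R -> X) : pmeas A eta -> pmeas A (fun p => G p.1 p.2 (eta p)).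
  move=> meta i; rewrite (_ : (fun p => _) = fun p => if (r <= p.2) && (p.2 <= b) then
      dot (F (eta p + zeta p.2)) (e i) else 0); last first.
    by apply/funext => p; rewrite /G; case: ifP; rewrite ?dot0l.
  apply: measurable_fun_ifT => //.
    exact: (measurableT_comp measurable_cut_set measurable_snd).
  apply: (lipschitz_coef_measurable (f := fun p => eta p + zeta p.2) hsep measurableT FL) => j.
  under eq_fun do rewrite coefD.
  apply: measurable_funD; first exact: meta.
  exact: (measurableT_comp (zeta_meas j) measurable_snd).
have Gl w s u v : `|G w s u - G w s v| <= L * `|u - v|.
  rewrite /G; case: ifP => _; last by rewrite subrr normr0 mulr_ge0// ltW.
  by rewrite (le_trans (FL _ _))// opprD addrACA subrr addr0.
have Gz (w : unit) : exists C, forall s, `|G w s 0| <= C * expR (- mu * s).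
  have [M M0 hM] := F_int rb (@continuous_subspaceT _ _ `[r, b]%classic (fun=> 0 : X) (@cst_continuous _ _ 0)).
  by have [C _ hC] := cut_bound mu M0 hM; exists C.
have a0m : pmeas A a0.
  move=> i; under eq_fun do rewrite coefD (K_boundX _ gap hc_meas (hc_int mu)).1.2.
  apply: measurable_funD.
    under eq_fun do rewrite (hom_bound _ _ (cutok gap)).1.
    apply: measurable_fun_ifT => //.
      apply: measurable_fun_ler => //; apply: measurable_funB => //; exact: measurable_snd.
    apply: measurable_funM => //; apply: (measurableT_comp (@measurable_expR R)).
    by apply: measurable_funM => //; apply: measurable_funB => //; exact: measurable_snd.
  apply: (measurable_Kc 0 (phi := fun p : unit * R => hc p.2 : H)).
  exact: (measurableT_comp (hc_meas i) measurable_snd).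
have a0b (w : unit) : exists C, forall s, `|a0 (w, s)| <= C * expR (- mu * s).
  have [_ nX] := K_boundX 0 gap hc_meas (hc_int mu).
  exists (`|vr| * expR (mu * r) + \int[leb]_s (expR (mu * s) * `|hc s|)) => s.
  rewrite (le_trans (ler_normD _ _))// mulrDl lerD//.
    rewrite (le_trans (hom_bound _ _ (cutok gap)).2)// -mulrA -expRD.
    by rewrite ler_wpM2l// ler_expR/=; lra.
  by rewrite mulrC; exact: (K_boundX s gap hc_meas (hc_int mu)).2.
have [eta [meta beta eeta]] := fixed_point_exists a1 gap (ltW L0) hk Gm Gl Gz a0m a0b.
pose v s := eta (tt, s).
have vE : v = synth v.
  by apply/funext => t; rewrite {1}/v eeta.
have mv : cmeas A (phiF v).
  exact: (pmeas_section tt (Gm _ meta)).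
have [C hC] := beta tt.
have [D hD] := Gz tt.
have bphi s : `|phiF v s| <= (L * `|C| + `|D|) * expR (- mu * s).
  rewrite -[phiF v s]/(G tt s (v s)) -(subrK (G tt s 0) (G tt s (v s))) (le_trans (ler_normD _ _))//.
  rewrite mulrDl lerD//; last by rewrite (le_trans (hD s))// ler_wpM2r ?expR_ge0// ler_norm.
  rewrite (le_trans (Gl _ _ _ _))// subr0 -mulrA ler_wpM2l ?(ltW L0)// (le_trans (hC s))//.
  by rewrite ler_wpM2r ?expR_ge0// ler_norm.
have CD : 0 <= L * `|C| + `|D| by rewrite addr_ge0// mulr_ge0// ltW.
have [s1 s2 s3] := synth_orbit gap mv CD bphi.
exists v; split; [by rewrite vE|by rewrite vE|].
by move=> t rtb i; have := s3 t i rtb; rewrite -vE.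
Qed.

(** Each solution agrees on the interval with its own [synth], which is defined and bounded in the
    weight on the whole line; [K_contraction] with zero defect identifies the two. *)
Lemma local_unique (v1 v2 : R -> X) :
  {within `[r, b], continuous v1} -> {within `[r, b], continuous v2} ->
  v1 r = vr -> v2 r = vr ->
  (forall t, r <= t <= b -> orbit v1 r t) -> (forall t, r <= t <= b -> orbit v2 r t) ->
  forall t, r <= t <= b -> v1 t = v2 t.
Proof.
move=> c1 c2 i1 i2 o1 o2; have [mu gap hk] := small_kappa.
have mphi v : {within `[r, b], continuous v} -> cmeas A (phiF v).
  move=> cv i; have mv j := within_coef_meas j (measurable_itv `[r, b]) cv.
  have mF := F_meas (measurable_itv `[r, b]) mv i.
  have mE : measurable (`[r, b]%classic : set R) by [].
  have := (measurable_restrictT (fun s => dot (F (v s + zeta s)) (e i)) mE).1 mF.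
  apply: eq_measurable_fun => s _; rewrite patchE /phiF /cut mem_setE in_itv/=.
  by case: ifP; rewrite ?dot0l.
have same v : {within `[r, b], continuous v} -> v r = vr ->
    (forall t, r <= t <= b -> orbit v r t) -> forall t, r <= t <= b -> v t = synth v t.
  move=> cv iv ov t rtb; have [M M0 hM] := F_int rb cv.
  have [C C0 hC] := cut_bound mu M0 hM.
  have [s1 _ s3] := synth_orbit gap (mphi v cv) C0 hC.
  apply: frac_eq => i; have := s3 t i rtb; have := ov t rtb i.
  rewrite /Ycoef s1 iv => E1 E2.
  have l0 : expR (lam i * t) != 0 by rewrite gt_eqF// expR_gt0.
  by apply: (mulfI l0); exact: (etrans E1 (esym E2)).
have [M1 M10 hM1] := F_int rb c1; have [C1 C10 hC1] := cut_bound mu M10 hM1.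
have [M2 M20 hM2] := F_int rb c2; have [C2 C20 hC2] := cut_bound mu M20 hM2.
have sub t : synth v1 t - synth v2 t = Kop A alpha 0 (phiF v1) t - Kop A alpha 0 (phiF v2) t.
  by rewrite /synth opprD addrACA subrr add0r.
have eqs := @K_contraction _ _ A alpha 0 mu L (synth v1) (synth v2) (phiF v1) (phiF v2) 0
  (kappa A 0 mu a * C1 + kappa A 0 mu a * C2)
  a1 gap (ltW L0) hk (lexx 0) (mphi _ c1) (mphi _ c2)
  (fun t => (K_boundH t a1 gap (mphi _ c1) C10 hC1).1)
  (fun t => (K_boundH t a1 gap (mphi _ c2) C20 hC2).1).
move=> t rtb; rewrite (same v1 c1 i1 o1 t rtb) (same v2 c2 i2 o2 t rtb).
apply/eqP; rewrite -subr_eq0 -normr_eq0 eq_le normr_ge0 andbT.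
have z0 : 0 / (1 - L * kappa A 0 mu a) * expR (- mu * t) = 0 by rewrite mul0r mul0r.
rewrite -[leRHS]z0; apply: eqs => {t rtb z0}.
- move=> s; rewrite /phiF /cut; case: ifPn => hs; last by rewrite subrr normr0 mulr_ge0// ltW.
  rewrite (le_trans (FL _ _))// ler_wpM2l ?(ltW L0)// opprD addrACA subrr addr0.
  by rewrite (same v1)// (same v2).
- by move=> t; rewrite sub subrr normr0 mul0r.
- move=> t; rewrite sub (le_trans (ler_normB _ _))// mulrDl lerD//.
    exact: (K_boundH t a1 gap (mphi _ c1) C10 hC1).2.
  exact: (K_boundH t a1 gap (mphi _ c2) C20 hC2).2.
Qed.

End local.

Lemma within_cc (v : R -> X) (r s t b : R) : r <= s -> t <= b ->
  {within `[r, b], continuous v} -> {within `[s, t], continuous v}.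
Proof.
move=> rs tb; apply: continuous_subspaceW => x; rewrite /= !in_itv/= => /andP[sx xt].
by rewrite (le_trans rs sx) (le_trans xt tb).
Qed.

Lemma within_ocy (v : R -> X) (r s t : R) : r <= s ->
  {within `[r, +oo[, continuous v} -> {within `[s, t], continuous v}.
Proof.
move=> rs; apply: continuous_subspaceW => x; rewrite /= !in_itv/= => /andP[sx xt].
by rewrite (le_trans rs sx).
Qed.

Lemma orbit_ext (v1 v2 : R -> X) (r t : R) : r <= t -> (forall s, r <= s <= t -> v1 s = v2 s) ->
  orbit v1 r t -> orbit v2 r t.
Proof.
move=> rt v12 o i; have := o i.
have -> : \int[leb]_(s in `[r, t]) psi A (rhs v1) i s =
    \int[leb]_(s in `[r, t]) psi A (rhs v2) i s.
  by apply: eq_Rintegral => s; rewrite inE/= in_itv/= => st; rewrite /psi /rhs v12.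
by rewrite /Ycoef !v12 ?lexx ?rt.
Qed.

Lemma orbit_split (v : R -> X) (r s t : R) i : r <= s -> s <= t ->
  {within `[r, t], continuous v} ->
  \int[leb]_(x in `[r, t]) psi A (rhs v) i x =
  \int[leb]_(x in `[r, s]) psi A (rhs v) i x + \int[leb]_(x in `[s, t]) psi A (rhs v) i x.
Proof.
move=> rs st cv; apply: Rintegral_cc_split; first by rewrite rs.
exact: rhs_psi_int (le_trans rs st) cv.
Qed.

Lemma orbit_cat (v : R -> X) (r s t : R) : r <= s -> s <= t ->
  {within `[r, t], continuous v} -> orbit v r s -> orbit v s t -> orbit v r t.
Proof.
move=> rs st cv o1 o2 i; rewrite (orbit_split i rs st cv) addrA.
by apply: (etrans (o2 i)); congr (_ + _); exact: (o1 i).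
Qed.

Lemma orbit_tail (v : R -> X) (r s t : R) : r <= s -> s <= t ->
  {within `[r, t], continuous v} -> orbit v r s -> orbit v r t -> orbit v s t.
Proof.
move=> rs st cv o1 o2 i.
have E1 := o1 i; have E2 := o2 i; rewrite (orbit_split i rs st cv) addrA in E2.
apply: (etrans E2); congr (_ + _); exact: (esym E1).
Qed.

Definition solution (r : R) (vr : X) (v : R -> X) :=
  [/\ v r = vr, {within `[r, +oo[, continuous v} & forall t, r <= t -> orbit v r t].

(** Local solutions on the intervals of integer length are glued: at [t] the shortest one containing
    a right neighbourhood of [t] is taken, and local uniqueness makes the choice immaterial. *)
Lemma global_solution r vr : exists v, solution r vr v.
Proof.
have rm (m : nat) : r <= r + m.+1%:R by rewrite lerDl.
have /choice[V hV] m := local_solution (rm m) vr.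
have VE m t : r <= t <= r + m.+1%:R -> V (Num.truncn (t - r)) t = V m t.
  move=> /andP[rt tm]; set j := Num.truncn _.
  have tj : t <= r + j.+1%:R.
    by rewrite addrC -lerBlDr ltW// truncnS_gt// subr_ge0.
  have [i1 c1 o1] := hV j; have [i2 c2 o2] := hV m.
  have le_tm s : r <= s <= t -> r <= s <= r + m.+1%:R.
    by move=> /andP[-> st]/=; exact: le_trans st tm.
  have le_tj s : r <= s <= t -> r <= s <= r + j.+1%:R.
    by move=> /andP[-> st]/=; exact: le_trans st tj.
  apply: (local_unique rt (within_cc (lexx r) tj c1) (within_cc (lexx r) tm c2) i1 i2).
  - by move=> s /le_tj; exact: o1.
  - by move=> s /le_tm; exact: o2.
  - by rewrite rt lexx.
pose v t := V (Num.truncn (t - r)) t.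
have big t : r <= t -> exists m : nat, t < r + m.+1%:R.
  move=> rt; exists (Num.truncn (t - r)).
  by rewrite addrC -ltrBlDr truncnS_gt// subr_ge0.
exists v; split.
- by have [i0 _ _] := hV 0%N; rewrite /v (VE 0%N)// lexx rm.
- apply/subspace_continuousP => t; rewrite /= in_itv/= andbT => rt.
  have [m tm] := big t rt; have [_ /subspace_continuousP cm _] := hV m.
  have tin : `[r, r + m.+1%:R]%classic t by rewrite /= in_itv/= rt ltW.
  have Ev : v t = V m t by rewrite /v (VE m)// rt ltW.
  move=> B; rewrite [X in nbhs X]Ev => /(cm t tin) hB'.
  have hB : \forall s \near t, `[r, r + m.+1%:R]%classic s -> B (V m s) by exact: hB'.
  suff : \forall s \near t, `[r, +oo[%classic s -> B (v s) by [].
  have : \forall s \near t, s < r + m.+1%:R by exact: lt_nbhsl.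
  move: hB; apply: filterS2 => s hs sm; rewrite /= in_itv/= andbT => rs.
  have sin : r <= s <= r + m.+1%:R by rewrite rs ltW.
  by rewrite /v (VE m s sin); apply: hs; rewrite /= in_itv/=.
- move=> t rt; have [m tm] := big t rt; have [_ _ om] := hV m.
  apply: (@orbit_ext (V m)) => //; last by apply: om; rewrite rt ltW.
  by move=> s /andP[rs st]; rewrite /v (VE m)// rs (le_trans st)// ltW.
Qed.

Lemma solution_unique r b vr v1 v2 : r <= b -> solution r vr v1 ->
  {within `[r, b], continuous v2} -> v2 r = vr -> (forall t, r <= t <= b -> orbit v2 r t) ->
  forall t, r <= t <= b -> v1 t = v2 t.
Proof.
move=> rb [i1 c1 o1] c2 i2 o2.
apply: (local_unique rb (within_ocy (lexx r) c1) c2 i1 i2) => // t /andP[rt _].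
exact: o1.
Qed.

End forced.
End pathwise_dynamics.

(** * Complete orbits and the cocycle *)

Section complete_orbits.
Context {R : realType} {H : hilbertType R} (A : posOperator H) (alpha : {nonneg R}).
Local Notation lam := (eigval A).
Local Notation a := (alpha%:num).
Local Notation X := (fracSpace A alpha).
Local Notation leb := (@lebesgue_measure R).
Local Notation mR := (measurableTypeR R).
Local Notation shift := Defs.shift.
Local Notation L1 D f := (leb.-integrable (D : set mR) (EFin \o f)).
Hypothesis hsep : separable H.
Hypothesis a1 : a < 1.
Variables (F : X -> H) (L : R).
Hypothesis L0 : 0 < L.
Hypothesis F0 : F 0 = 0.
Hypothesis FL : forall u v, `|F u - F v| <= L * `|u - v|.

Lemma Rintegral_shift_cc (f : R -> R) (r t tau : R) : L1 `[r + tau, t + tau] f ->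
  \int[leb]_(s in `[r, t]) f (s + tau)%R = \int[leb]_(s in `[r + tau, t + tau]) f s.
Proof.
move=> fi; have mi : measurable (`[r + tau, t + tau]%classic : set mR) by exact: measurable_itv.
rewrite (Rintegral_restrict `[r, t] (fun s : R => f (s + tau))) (Rintegral_restrict _ f).
rewrite -(Rintegral_shift tau (L1_measurable ((L1_restrict f mi).1 fi))).
by apply: eq_Rintegral => s _; rewrite !mem_setE !in_itv/= !lerD2r.
Qed.

Definition forcing (h : R -> X) :=
  cmeas A h /\ forall r t, L1 `[r, t] (fun s => `|h s|).

Lemma shift_forcing tau h : forcing h -> forcing (shift tau h).
Proof.
move=> [mh ih]; split.
  move=> i; have m : measurable_fun [set: mR] (fun s : R => s + tau) by exact: measurable_funD.
  exact: (measurableT_comp (mh i) m).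
move=> r t; have mi : measurable (`[r, t]%classic : set mR) by exact: measurable_itv.
have mi' : measurable (`[r + tau, t + tau]%classic : set mR) by exact: measurable_itv.
apply/(L1_restrict _ mi).
have := L1_shift tau ((L1_restrict _ mi').1 (ih (r + tau) (t + tau))).
apply: L1_eq => // s _.
by rewrite !mem_setE !in_itv/= !lerD2r.
Qed.

Lemma shift_cts (V : topologicalType) tau (f : R -> V) : continuous f -> continuous (shift tau f).
Proof.
move=> cf s; apply: (@continuous_comp _ _ _ (fun s : R => s + tau) f).
  by apply: cvgD; [exact: cvg_id|exact: cvg_cst].
exact: cf.
Qed.

Lemma orbit_shift zeta h (v : R -> X) r t tau : continuous zeta -> forcing h ->
  r <= t -> {within `[r + tau, t + tau], continuous v} ->
  orbit F zeta h v (r + tau) (t + tau) ->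
  orbit F (shift tau zeta) (shift tau h) (shift tau v) r t.
Proof.
move=> cz [mh ih] rt cv o i.
have rt' : r + tau <= t + tau by rewrite lerD2r.
have ip := rhs_psi_int hsep L0 F0 FL cz mh ih i rt' cv.
have E : \int[leb]_(s in `[r, t]) psi A (rhs F (shift tau zeta) (shift tau h) (shift tau v)) i s
    = expR (- (lam i * tau)) * \int[leb]_(s in `[r + tau, t + tau]) psi A (rhs F zeta h v) i s.
  rewrite -(Rintegral_shift_cc ip) -RintegralZl//.
    apply: eq_Rintegral => s _; rewrite /psi mulrA -expRD.
    by congr (expR _ * _); ring.
  have mi : measurable (`[r, t]%classic : set mR) by exact: measurable_itv.
  have mi' : measurable (`[r + tau, t + tau]%classic : set mR) by exact: measurable_itv.
  apply/(L1_restrict _ mi).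
  have := L1_shift tau ((L1_restrict _ mi').1 ip).
  apply: L1_eq => // s _.
  by rewrite !mem_setE !in_itv/= !lerD2r.
have Y s : Ycoef (shift tau v) i s = expR (- (lam i * tau)) * Ycoef v i (s + tau).
  by rewrite /Ycoef mulrA -expRD; congr (expR _ * _); ring.
rewrite E (Y t) (Y r) -mulrDr; congr (_ * _); exact: o.
Qed.

Lemma solution_shift zeta h r vr v tau : continuous zeta -> forcing h ->
  solution F zeta h (r + tau) vr v ->
  solution F (shift tau zeta) (shift tau h) r vr (shift tau v).
Proof.
move=> cz fh [i0 cv o]; split => //.
  apply: (within_shift _ cv) => s; rewrite /= !in_itv/= !andbT.
  by rewrite lerD2r.
move=> t rt; apply: orbit_shift => //; last by apply: o; rewrite lerD2r.
exact: (within_ocy (lexx _) cv).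
Qed.

Variable mu : R.
Hypothesis mu0 : 0 <= mu.

Definition entire (zeta h xi : R -> X) :=
  Sspace mu xi /\ forall r t, r <= t -> t <= 0 -> orbit F zeta h xi r t.

Definition glue (xi v : R -> X) (s : R) : X := if s <= 0 then xi s else v s.

Lemma glue_cts xi v : {within `]-oo, (0:R)], continuous xi} ->
  {within `[(0:R), +oo[, continuous v} -> v 0 = xi 0 -> continuous (glue xi v).
Proof.
move=> c1 c2 v0.
have c : {within `]-oo, (0:R)] `|` `[(0:R), +oo[, continuous (glue xi v)}.
  apply: withinU_continuous.
  - exact: lray_closed.
  - exact: rray_closed.
  - by apply: within_ext c1 => s; rewrite /= in_itv/= /glue => ->.
  - apply: within_ext c2 => s; rewrite /= in_itv/= andbT /glue => s0.
    by case: ifPn => // s0'; have -> : s = 0 by apply/le_anti; rewrite s0' s0.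
have ET : `]-oo, (0:R)] `|` `[(0:R), +oo[ = [set: R].
  apply/seteqP; split => // s _; rewrite /= !in_itv/= andbT.
  by case: (leP s 0) => [?|/ltW ?]; [left|right].
by rewrite ET in c; apply/continuous_subspace_setT.
Qed.

(** The past orbit and the forward solution are glued at 0 and shifted by [t]; orbits across 0 are
    obtained by concatenation. *)
Lemma entire_forward zeta h xi v t : continuous zeta -> forcing h -> 0 <= t ->
  entire zeta h xi -> solution F zeta h 0 (xi 0) v ->
  exists2 xi', entire (shift t zeta) (shift t h) xi' & xi' 0 = v t.
Proof.
move=> cz fh t0 [[cxi [C hC]] o1] [v0 cv o2].
have cg := glue_cts cxi cv v0.
have gxi s : s <= 0 -> glue xi v s = xi s by rewrite /glue => ->.
have gv s : 0 <= s -> glue xi v s = v s.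
  by rewrite /glue => s0; case: ifPn => // s0'; have -> : s = 0 by apply/le_anti; rewrite s0 s0'.
have og r s : r <= s -> orbit F zeta h (glue xi v) r s.
  have lo r' s' : r' <= s' -> s' <= 0 -> orbit F zeta h (glue xi v) r' s'.
    move=> rs s0; apply: (orbit_ext rs _ (o1 _ _ rs s0)) => x /andP[_ xs].
    by rewrite gxi// (le_trans xs).
  have z_up s' : 0 <= s' -> orbit F zeta h (glue xi v) 0 s'.
    move=> s0; apply: (orbit_ext s0 _ (o2 _ s0)) => x /andP[x0 _]; by rewrite gv.
  move=> rs; have [s0|s0] := leP s 0; first exact: lo.
  have [r0|r0] := leP r 0.
    apply: (orbit_cat hsep L0 F0 FL cz fh.1 fh.2 r0 (ltW s0)).
    - exact: continuous_subspaceT.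
    - exact: lo.
    - exact: z_up (ltW s0).
  apply: (orbit_tail hsep L0 F0 FL cz fh.1 fh.2 (ltW r0) rs).
  - exact: continuous_subspaceT.
  - exact: z_up (ltW r0).
  - exact: z_up (ltW s0).
exists (shift t (glue xi v)); last by rewrite /shift add0r gv.
split; last first.
  move=> r s rs s0; apply: orbit_shift => //; first exact: continuous_subspaceT.
  by apply: og; rewrite lerD2r.
split; first by apply: continuous_subspaceT; exact: shift_cts.
have [M M0 hM] := within_bounded t0 (within_ocy (lexx _) cv).
(* The first term serves times before -t, where the glued path is [xi]; [M] bounds the solution on
   [[0, t]], the weight there being at most 1 because [mu] is nonnegative. *)
exists (expR (- mu * t) * `|C| + M) => s s0; rewrite /shift.
have [st|/ltW st] := leP (s + t) 0.
  rewrite gxi// -[leLHS]addr0 lerD//.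
  have -> : expR (mu * s) = expR (- mu * t) * expR (mu * (s + t)).
    by rewrite -expRD; congr expR; ring.
  rewrite -mulrA ler_wpM2l ?expR_ge0// (le_trans (hC _ st))// ler_norm.
  done.
rewrite gv// -[leLHS]add0r lerD// ?mulr_ge0 ?expR_ge0//.
rewrite (le_trans _ (hM (s + t) _))//; last by rewrite st gerDr.
rewrite -[leRHS]mul1r ler_wpM2r// -expR0 ler_expR.
by rewrite mulr_ge0_le0.
Qed.

(** The required orbit is the given one shifted back by [t] and read at negative times; forward
    uniqueness shows that its continuation ends at [xi 0]. *)
Lemma entire_backward zeta h xi t : continuous zeta -> forcing h -> 0 <= t ->
  entire (shift t zeta) (shift t h) xi ->
  exists2 xi0, entire zeta h xi0 &
    forall v, solution F zeta h 0 (xi0 0) v -> v t = xi 0.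
Proof.
move=> cz fh t0 [[cxi [C hC]] o].
have cz' : continuous (shift t zeta) by exact: shift_cts.
have fh' := shift_forcing t fh.
have Ez : shift (- t) (shift t zeta) = zeta by apply/funext => s; rewrite /shift subrK.
have Eh : shift (- t) (shift t h) = h by apply/funext => s; rewrite /shift subrK.
have o' r s : r <= s -> s <= t -> orbit F zeta h (shift (- t) xi) r s.
  move=> rs st; rewrite -Ez -Eh; apply: orbit_shift => //.
    apply: continuous_subspaceW cxi => x; rewrite /= !in_itv/= => /andP[_ /le_trans]; apply.
    by rewrite subr_le0.
  by apply: o; rewrite ?lerD2r// subr_le0.
have cx : {within `]-oo, t], continuous (shift (- t) xi)}.
  by apply: (within_shift _ cxi) => s; rewrite /= !in_itv/= subr_le0.
exists (shift (- t) xi).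
  split; last by move=> r s rs s0; apply: o' => //; exact: le_trans t0.
  split.
    apply: continuous_subspaceW cx => x; rewrite /= !in_itv/= => /le_trans; exact.
  exists (expR (mu * t) * `|C|) => s s0; rewrite /shift.
  have -> : expR (mu * s) = expR (mu * t) * expR (mu * (s - t)).
    by rewrite -expRD; congr expR; ring.
  rewrite -mulrA ler_wpM2l ?expR_ge0// (le_trans (hC _ _))// ?ler_norm// subr_le0.
  exact: le_trans t0.
move=> v sv; have E : shift (- t) xi t = xi 0 by rewrite /shift subrr.
rewrite -E; apply: (solution_unique hsep a1 L0 F0 FL cz fh.1 fh.2 t0 sv) => //.
- by apply: continuous_subspaceW cx => x; rewrite /= !in_itv/= => /andP[].
- by move=> s /andP[s0 st]; exact: o'.
- by rewrite t0 lexx.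
Qed.

End complete_orbits.

Section theta_group.
Context {R : realType} {H : normedModType R}.
Implicit Type w : wienerSpace H.

Lemma path0_eq (w1 w2 : path0 H) : (forall s, w1 s = w2 s) -> w1 = w2.
Proof.
case: w1 => f cf f0; case: w2 => f' cf' f0' /= /funext ff'; subst f'.
by congr Path0; exact: Prop_irrelevance.
Qed.

Lemma theta_theta s t w : theta s (theta t w) = theta (s + t) w.
Proof.
apply: path0_eq => x /=; by rewrite opprB addrA subrK addrA.
Qed.

Lemma theta0 w : theta 0 w = w.
Proof. by apply: path0_eq => x /=; rewrite addr0 path0_0 subr0. Qed.

End theta_group.

Section cocycle.
Context {R : realType} {H : hilbertType R} (A : posOperator H) (alpha : {nonneg R}).
Local Notation e := (eigvec A).
Local Notation lam := (eigval A).
Local Notation a := (alpha%:num).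
Local Notation X := (fracSpace A alpha).
Local Notation Omega := (wienerSpace H).
Local Notation shift := Defs.shift.
Hypothesis hsep : separable H.
Hypothesis a1 : a < 1.
Variables (F : X -> H) (L : R).
Hypothesis L0 : 0 < L.
Hypothesis F0 : F 0 = 0.
Hypothesis FL : forall u v, `|F u - F v| <= L * `|u - v|.
Variable z : Omega -> X.
Hypothesis hzreg : regular_version z.

Definition ztraj (w : Omega) (t : R) : X := z (theta t w).

Lemma ztraj_cts w : continuous (ztraj w).
Proof. by have [] := hzreg w. Qed.

Lemma ztraj_shift t w : ztraj (theta t w) = shift t (ztraj w).
Proof. by apply/funext => s; rewrite /ztraj /shift theta_theta. Qed.

Lemma mild_solutionP h r w vr v : forcing h ->
  mild_solution F z r w h vr v <-> solution F (ztraj w) h r vr v.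
Proof.
move=> fh; have cz := @ztraj_cts w.
have ok : {within `[r, +oo[, continuous v} -> forall t, r <= t ->
    (v t = semigroup A (t - r) vr +
      bochner_integral `[r, t] (fun s =>
        semigroup A (t - s) (F (v s + z (theta s w)) + fracval (h s))) :> H) <->
    forall i, Ycoef v i t = expR (lam i * r) * dot vr (e i) +
      \int[@lebesgue_measure R]_(s in `[r, t]) psi A (rhs F (ztraj w) h v) i s.
  move=> cv t rt; have cvt := within_ocy (lexx _) cv (t := t).
  have [mr ir] := rhs_ok hsep L0 F0 FL cz fh.1 fh.2 rt cvt.
  exact: (mild_coef hsep (v t) vr rt mr ir).
split=> [[cv hv]|[v0 cv o]].
  (* The mild formula at [t = r] has an integral over a single point, so it already contains the
     initial condition. *)
  have v0 : v r = vr.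
    apply: frac_eq => i; have := (ok cv r (lexx r)).1 (hv r (lexx r)) i.
    rewrite set_itv1 Rintegral_set1 addr0 /Ycoef => E.
    by apply: (mulfI (lt0r_neq0 (expR_gt0 (lam i * r)))).
  split => // t rt i; rewrite {2}/Ycoef v0.
  exact: ((ok cv t rt).1 (hv t rt) i).
split => // t rt; apply: (ok cv t rt).2 => i.
by have := o t rt i; rewrite {2}/Ycoef v0.
Qed.

Lemma vsolP h r w vr : forcing h ->
  solution F (ztraj w) h r vr (fun t => vsol F z t r w h vr).
Proof.
move=> fh; apply/(mild_solutionP r w vr _ fh); apply: (@xgetPex _ (fun=> 0)).
have [v sv] := global_solution hsep a1 L0 F0 FL (@ztraj_cts w) fh.1 fh.2 r vr.
by exists v; apply/(mild_solutionP r w vr _ fh).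
Qed.

Lemma vsol_unique h r b w vr v : forcing h -> r <= b ->
  {within `[r, b], continuous v} -> v r = vr ->
  (forall t, r <= t <= b -> orbit F (ztraj w) h v r t) ->
  forall t, r <= t <= b -> vsol F z t r w h vr = v t.
Proof.
move=> fh rb cv v0 ov.
exact: (solution_unique hsep a1 L0 F0 FL (@ztraj_cts w) fh.1 fh.2 rb (vsolP r w vr fh) cv v0 ov).
Qed.

(** Starting at time tau with noise theta_(-tau) w is, after translating time by tau, starting at 0
    with noise w and forcing g^tau; uniqueness of solutions makes this an equality. *)
Lemma PhiE g t tau w u0 : forcing g -> 0 <= t ->
  Phi F z g t tau w u0 =
  vsol F z t 0 w (shift tau g) (u0 - z w) + ztraj w t.
Proof.
move=> fg t0; rewrite /Phi /usol !theta_theta subrr theta0.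
rewrite (_ : t + tau - tau = t); last by rewrite addrK.
congr (_ + _); set u := u0 - z w.
have s1 := vsolP tau (theta (- tau) w) u fg.
have E : shift tau (ztraj (theta (- tau) w)) = ztraj w.
  by rewrite ztraj_shift; apply/funext => s; rewrite /shift addrK.
have s1' : solution F (ztraj (theta (- tau) w)) g (0 + tau) u
    (fun t => vsol F z t tau (theta (- tau) w) g u) by rewrite add0r.
have := solution_shift hsep L0 F0 FL (@ztraj_cts _) fg s1'; rewrite E => -[i c o].
rewrite (vsol_unique (v := shift tau (fun t => vsol F z t tau (theta (- tau) w) g u))
  (shift_forcing tau fg) t0)//.
- exact: (within_ocy (lexx _) c).
- by move=> s /andP[s0 _]; exact: o.
- by rewrite t0 lexx.
Qed.

Variables (mu : R) (g : R -> X).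
Hypothesis mu0 : 0 <= mu.
Hypothesis fg : forcing g.

Lemma MsetP tau w : Mset F z g mu tau w =
  [set xi 0 | xi in entire F mu (ztraj w) (shift tau g)].
Proof.
have fgt := shift_forcing tau fg.
apply/seteqP; split => _ [xi [S o] <-]; exists xi => //; split => // r t rt t0.
  have sv := vsolP r w (xi r) fgt; have [_ _ /(_ t rt)] := sv.
  by apply: orbit_ext => // s /andP[rs st]; apply: o => //; exact: le_trans t0.
have cxi : {within `[r, 0], continuous xi}.
  by apply: continuous_subspaceW S.1 => x; rewrite /= !in_itv/= => /andP[].
apply: (vsol_unique fgt (le_trans rt t0) cxi) => //; last by rewrite rt.
by move=> s /andP[rs s0]; exact: o.
Qed.

Lemma Mset_invariant t tau w : 0 <= t ->
  (fun x => vsol F z t 0 w (shift tau g) x) @` Mset F z g mu tau w =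
  Mset F z g mu (tau + t) (theta t w).
Proof.
move=> t0; rewrite !MsetP ztraj_shift.
have fgt := shift_forcing tau fg.
have -> : shift (tau + t) g = shift t (shift tau g).
  by apply/funext => s; rewrite /shift -addrA (addrC t).
apply/seteqP; split => [_ [_ [xi exi <-] <-]|_ [xi exi <-]].
  have [xi' e' <-] := entire_forward hsep L0 F0 FL mu0 (@ztraj_cts w) fgt t0 exi
    (vsolP 0 w (xi 0) fgt).
  by exists xi'.
have [xi0 e0 h0] := entire_backward hsep a1 L0 F0 FL (@ztraj_cts w) fgt t0 exi.
exists (xi0 0); first by exists xi0.
exact: (h0 _ (vsolP 0 w (xi0 0) fgt)).
Qed.

End cocycle.

(** * The Lyapunov-Perron equation *)

Section lyapunov_perron.
Context {R : realType} {H : hilbertType R} (A : posOperator H) (alpha : {nonneg R}).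
Local Notation e := (eigvec A).
Local Notation lam := (eigval A).
Local Notation a := (alpha%:num).
Local Notation X := (fracSpace A alpha).
Local Notation leb := (@lebesgue_measure R).
Local Notation mR := (measurableTypeR R).
Local Notation L1 D f := (leb.-integrable (D : set mR) (EFin \o f)).
Hypothesis hsep : separable H.
Hypothesis a1 : a < 1.
Variables (F : X -> H) (L : R).
Hypothesis L0 : 0 < L.
Hypothesis F0 : F 0 = 0.
Hypothesis FL : forall u v, `|F u - F v| <= L * `|u - v|.
Variables (n : nat) (mu : R).
Hypothesis gap : spectral_gap A n mu.
Hypothesis hq : L * kappa A n mu a < 1.

Definition cut0 (V : nmodType) (f : R -> V) (s : R) : V := if s <= 0 then f s else 0.

Definition lowcut (i : nat) (t : R) := (i < n)%N && (t <= 0).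

Lemma lowcut_ok : cut_ok A mu lowcut.
Proof.
move=> i t /andP[ni t0]; rewrite mulr_le0// subr_le0 ltW//; exact: gap.2.
Qed.

Lemma cut0_meas (f : R -> H) :
  (forall i, measurable_fun `]-oo, (0 : R)] (fun s => dot (f s) (e i))) -> cmeas A (cut0 f).
Proof.
move=> mf i.
have mE : measurable (`]-oo, (0 : R)]%classic : set mR) by exact: measurable_itv.
have := (measurable_restrictT (fun s => dot (f s) (e i)) mE).1 (mf i).
apply: eq_measurable_fun => s _; rewrite patchE /cut0 mem_setE in_itv/=.
by case: ifP; rewrite ?dot0l.
Qed.

Lemma growthP (xi : R -> X) C t :
  (expR (mu * t) * `|xi t| <= C) = (`|xi t| <= C * expR (- mu * t)).
Proof. by rewrite mulNr expRN ler_pdivlMr ?expR_gt0// mulrC. Qed.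

Section forced.
Variables (zeta h : R -> X).
Hypothesis zeta_cts : continuous zeta.
Hypothesis zeta_bd : exists C, forall s, s <= 0 -> `|zeta s| <= C * expR (- mu * s).
Hypothesis fh : forcing h.
Hypothesis hw : L1 `]-oo, (0 : R)] (fun s : R => expR (mu * s) * `|h s|).

Let hneg : R -> X := cut0 h.

Lemma hneg_meas : cmeas A hneg.
Proof.
move=> i; rewrite (_ : (fun s => _) = (fun s => dot (cut0 (fun s => h s : H) s) (e i))).
  by apply: cut0_meas => j; apply: measurable_funTS; exact: fh.1.
by apply/funext => s; rewrite /hneg /cut0; case: ifP => //; rewrite coef0 dot0l.
Qed.

Lemma hneg_int : L1 setT (fun s : R => expR (mu * s) * `|hneg s|).
Proof.
have mE : measurable (`]-oo, (0 : R)]%classic : set mR) by exact: measurable_itv.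
apply: L1_eq ((L1_restrict _ mE).1 hw) => // s _.
by rewrite mem_setE in_itv/= /hneg /cut0; case: ifP => //; rewrite normr0 mulr0.
Qed.

Definition phiN (xi : R -> X) : R -> H := cut0 (fun s => F (xi s + zeta s)).

(** Defined for all times, with forcing and nonlinearity cut off after 0, so that the whole-line
    bounds apply; for [t <= 0] the cut turns the future integrals into integrals over [[t, 0]]. *)
Definition LPop (x : X) (xi : R -> X) (t : R) : X :=
  (hom lowcut x t + Kop A alpha n hneg t) + Kop A alpha n (phiN xi) t.

Definition LP (x : X) (xi : R -> X) := forall t, t <= 0 -> forall i,
  Ycoef xi i t = if (i < n)%N
    then dot x (e i) - \int[leb]_(s in `[t, 0]) psi A (rhs F zeta h xi) i s
    else \int[leb]_(s in `]-oo, t]) psi A (rhs F zeta h xi) i s.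

Lemma phiN_bound xi C : (forall s, s <= 0 -> `|xi s| <= C * expR (- mu * s)) ->
  exists2 D, 0 <= D & forall s, `|phiN xi s| <= D * expR (- mu * s).
Proof.
move=> hC; have [E hE] := zeta_bd.
exists (L * (`|C| + `|E|)); first by rewrite mulr_ge0 ?addr_ge0// ltW.
move=> s; rewrite /phiN /cut0; case: ifPn => s0; last first.
  by rewrite normr0 !mulr_ge0 ?addr_ge0 ?expR_ge0// ltW.
apply: (le_trans (F_le F0 FL _)); rewrite -mulrA ler_wpM2l ?(ltW L0)//.
apply: (le_trans (ler_normD _ _)); rewrite mulrDl lerD//.
  by rewrite (le_trans (hC s s0))// ler_wpM2r ?expR_ge0// ler_norm.
by rewrite (le_trans (hE s s0))// ler_wpM2r ?expR_ge0// ler_norm.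
Qed.

Lemma phiN_meas (xi : R -> X) : (forall i, measurable_fun `]-oo, (0 : R)] (fun s => dot (xi s) (e i))) ->
  cmeas A (phiN xi).
Proof.
move=> mx; apply: cut0_meas.
exact: (F_meas hsep FL zeta_cts (measurable_itv _) mx).
Qed.

Lemma Sspace_meas (xi : R -> X) : Sspace mu xi ->
  forall i, measurable_fun `]-oo, (0 : R)] (fun s => dot (xi s) (e i)).
Proof. by move=> [c _] i; apply: within_coef_meas. Qed.

Lemma Sspace_growth (xi : R -> X) : Sspace mu xi ->
  exists C, forall s, s <= 0 -> `|xi s| <= C * expR (- mu * s).
Proof. by move=> [_ [C hC]]; exists C => s s0; rewrite -growthP hC. Qed.

Section operator.
Variables (xi : R -> X) (D : R).
Hypothesis mphi : cmeas A (phiN xi).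
Hypothesis D0 : 0 <= D.
Hypothesis hD : forall s, `|phiN xi s| <= D * expR (- mu * s).

Let gX t := (K_boundX t gap hneg_meas hneg_int).1.
Let gH t := (K_boundH t a1 gap mphi D0 hD).1.

Let psi_split i (s : R) : s <= 0 -> psi A (rhs F zeta h xi) i s = psi A hneg i s + psi A (phiN xi) i s.
Proof.
move=> s0; rewrite /psi -mulrDr -dotDl; congr (_ * dot _ _).
by rewrite /rhs /hneg /phiN /cut0 s0 addrC.
Qed.

Lemma LPop_Ycoef x i t : t <= 0 -> Ycoef (LPop x xi) i t =
  (if (i < n)%N then dot x (e i) else 0) +
  Ycoef (Kop A alpha n hneg) i t + Ycoef (Kop A alpha n (phiN xi)) i t.
Proof.
move=> t0; rewrite {1}/Ycoef !coefD !mulrDr; congr (_ + _ + _).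
rewrite (hom_bound _ _ lowcut_ok).1 /lowcut t0 andbT.
by case: ifP => _; rewrite ?mulr0// mulrA -expRD (_ : _ + _ = 0) ?expR0 ?mul1r//; ring.
Qed.

Lemma LPop_ode x r t i : r <= t -> t <= 0 ->
  Ycoef (LPop x xi) i t = Ycoef (LPop x xi) i r +
    \int[leb]_(s in `[r, t]) psi A (rhs F zeta h xi) i s.
Proof.
move=> rt t0; rewrite (LPop_Ycoef x i t0) (LPop_Ycoef x i (le_trans rt t0)).
have [iX EX] := Kop_ode i rt (gX r) (gX t).
have [iH EH] := Kop_ode i rt (gH r) (gH t).
have key : \int[leb]_(s in `[r, t]) psi A (rhs F zeta h xi) i s =
    \int[leb]_(s in `[r, t]) psi A hneg i s + \int[leb]_(s in `[r, t]) psi A (phiN xi) i s.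
  rewrite -RintegralD//; apply: eq_Rintegral => s; rewrite inE/= in_itv/= => /andP[_ st].
  by apply: psi_split; exact: le_trans t0.
rewrite key.
set c := (if _ then _ else _).
apply: (etrans (f_equal2 (fun p q => c + p + q) EX EH)).
by cbv beta; ring.
Qed.

Lemma LPop_coef x t i : t <= 0 -> Ycoef (LPop x xi) i t = if (i < n)%N
    then dot x (e i) - \int[leb]_(s in `[t, 0]) psi A (rhs F zeta h xi) i s
    else \int[leb]_(s in `]-oo, t]) psi A (rhs F zeta h xi) i s.
Proof.
move=> t0; rewrite (LPop_Ycoef x i t0).
have EX : Ycoef (Kop A alpha n hneg) i t = expR (lam i * t) * Kc A n hneg t i.
  exact: congr1 ((gX t).2 i).
have EH : Ycoef (Kop A alpha n (phiN xi)) i t = expR (lam i * t) * Kc A n (phiN xi) t i.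
  exact: congr1 ((gH t).2 i).
(* This is where the integral from the future stops at 0. *)
have psi_pos (phi : R -> H) : (forall s, 0 < s -> dot (phi s) (e i) = 0) ->
    L1 `]t, +oo[ (psi A phi i) ->
    \int[leb]_(s in `]t, +oo[) psi A phi i s = \int[leb]_(s in `[t, 0]) psi A phi i s.
  move=> hp ip.
  rewrite (Rintegral_oy_split t0 ip) [X in _ + X](_ : _ = \int[leb]_(s in `](0:R), +oo[) (0 : R)).
    by rewrite Rintegral_cst// mul0r addr0.
  by apply: eq_Rintegral => s; rewrite inE/= in_itv/= andbT /psi => /hp ->; rewrite mulr0.
have [jX _] := Kop_ode i t0 (gX t) (gX 0); have [jH _] := Kop_ode i t0 (gH t) (gH 0).
case: ifPn => [ni|]; last rewrite -leqNgt => ni.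
  have [iX KX] := Kc_psi_lo ni ((gX t).1 i); have [iH KH] := Kc_psi_lo ni ((gH t).1 i).
  have zX s : 0 < s -> dot (hneg s) (e i) = 0.
    by move=> s0; rewrite /hneg /cut0 leNgt s0/= coef0.
  have zH s : 0 < s -> dot (phiN xi s) (e i) = 0.
    by move=> s0; rewrite /phiN /cut0 leNgt s0/= dot0l.
  have eX := psi_pos hneg zX iX; have eH := psi_pos (phiN xi) zH iH.
  rewrite EX EH KX KH eX eH -addrA -opprD; congr (_ - _).
  rewrite -RintegralD//; apply: eq_Rintegral => s; rewrite inE/= in_itv/= => /andP[_ st].
  by rewrite psi_split.
have [iX KX] := Kc_psi_hi ni ((gX t).1 i); have [iH KH] := Kc_psi_hi ni ((gH t).1 i).
rewrite EX EH KX KH add0r -RintegralD//.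
have E : \int[leb]_(s in `]-oo, t[) (psi A hneg i s + psi A (phiN xi) i s) =
    \int[leb]_(s in `]-oo, t[) psi A (rhs F zeta h xi) i s.
  apply: eq_Rintegral => s; rewrite inE/= in_itv/= => /ltW st.
  by rewrite psi_split// (le_trans st).
rewrite E Rintegral_itv_bndo_bndc//.
apply: (L1_eq (f := fun s => psi A hneg i s + psi A (phiN xi) i s)) => //.
  by move=> s; rewrite /= in_itv/= => /ltW st; rewrite psi_split// (le_trans st).
exact: L1D.
Qed.

Lemma LPop_bound x : exists2 C, 0 <= C & forall t, `|LPop x xi t| <= C * expR (- mu * t).
Proof.
exists (`|x| + \int[leb]_s (expR (mu * s) * `|hneg s|) + kappa A n mu a * D).
  rewrite !addr_ge0//; last by rewrite mulr_ge0 ?kappa_ge0// a1 andbT.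
  by apply: Rintegral_ge0 => s _; rewrite mulr_ge0 ?expR_ge0.
move=> t; apply: (le_trans (ler_normD _ _)); rewrite mulrDl; apply: lerD.
  apply: (le_trans (ler_normD _ _)); rewrite mulrDl; apply: lerD.
    exact: (hom_bound _ _ lowcut_ok).2.
  by rewrite mulrC; exact: (K_boundX t gap hneg_meas hneg_int).2.
exact: (K_boundH t a1 gap mphi D0 hD).2.
Qed.

Lemma LPop_cts x : {within `]-oo, (0 : R)], continuous (LPop x xi)}.
Proof.
have cX := Kop_continuousX gap hneg_meas hneg_int.
have cH := Kop_continuousH a1 gap mphi D0 hD.
have c2 i s : `]-oo, (0 : R)]%classic s -> lowcut i s = (i < n)%N.
  by rewrite /= in_itv/= /lowcut => ->; rewrite andbT.
have cI := @hom_within _ _ A alpha mu lowcut x _ (fun i => (i < n)%N) lowcut_ok c2.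
apply/subspace_continuousP => t t0.
apply: cvgD; last by apply: cvg_within_filter; exact: cH.
apply: cvgD; last by apply: cvg_within_filter; exact: cX.
by move/subspace_continuousP: cI => /(_ t t0).
Qed.

Lemma LP_fixed x : LP x xi <-> forall t, t <= 0 -> xi t = LPop x xi t.
Proof.
split=> [hx t t0|hx t t0 i]; last by rewrite -(LPop_coef x i t0) /Ycoef hx.
apply: frac_eq => i; have := hx t t0 i; rewrite -(LPop_coef x i t0) /Ycoef.
by apply: mulfI; rewrite gt_eqF// expR_gt0.
Qed.

Lemma LP_Sspace x : LP x xi -> Sspace mu xi.
Proof.
move=> /LP_fixed hx; have [C _ hC] := LPop_bound x; split.
  have E s : `]-oo, (0 : R)]%classic s -> LPop x xi s = xi s.
    by rewrite /= in_itv/= => s0; rewrite hx.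
  exact: (within_ext E (@LPop_cts x)).
by exists C => t t0; rewrite growthP hx.
Qed.

End operator.

Lemma Sspace_phiN xi : Sspace mu xi -> cmeas A (phiN xi) /\
  exists2 D, 0 <= D & forall s, `|phiN xi s| <= D * expR (- mu * s).
Proof.
move=> S; split; first by apply: phiN_meas; exact: Sspace_meas.
by have [C hC] := Sspace_growth S; exact: phiN_bound hC.
Qed.

(** Once the Green terms are subtracted, only the linear flow of x1 - x2 on the low modes remains,
    which is the defect in [K_contraction]. *)
Lemma LP_lipschitz x1 x2 xi1 xi2 : Sspace mu xi1 -> Sspace mu xi2 ->
  LP x1 xi1 -> LP x2 xi2 -> forall t, t <= 0 ->
  `|xi1 t - xi2 t| <= `|x1 - x2| / (1 - L * kappa A n mu a) * expR (- mu * t).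
Proof.
move=> /Sspace_phiN[m1 [D1 D10 hD1]] /Sspace_phiN[m2 [D2 D20 hD2]].
move=> /(LP_fixed m1 D10 hD1) e1 /(LP_fixed m2 D20 hD2) e2 t t0.
have [C1 C10 hC1] := LPop_bound m1 D10 hD1 x1; have [C2 C20 hC2] := LPop_bound m2 D20 hD2 x2.
rewrite (e1 t t0) (e2 t t0).
apply: (@K_contraction _ _ A alpha n mu L (LPop x1 xi1) (LPop x2 xi2) (phiN xi1) (phiN xi2)
  `|x1 - x2| (C1 + C2) a1 gap (ltW L0) hq (normr_ge0 _) m1 m2
  (fun t => (K_boundH t a1 gap m1 D10 hD1).1) (fun t => (K_boundH t a1 gap m2 D20 hD2).1)).
- move=> s; rewrite /phiN /cut0; case: ifPn => s0; last by rewrite subrr normr0 mulr_ge0// ltW.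
  by rewrite (le_trans (FL _ _))// ler_wpM2l ?(ltW L0)// opprD addrACA subrr addr0 e1// e2.
- move=> s; rewrite (_ : _ - _ = hom lowcut x1 s - hom lowcut x2 s); last first.
    rewrite /LPop; move: (hom _ x1 s) (hom _ x2 s) (Kop A alpha n hneg s)
      (Kop A alpha n (phiN xi1) s) (Kop A alpha n (phiN xi2) s) => p1 p2 k k1 k2.
    by apply: frac_eq => i; rewrite !(coefB, coefD); ring.
  by rewrite (homB _ _ _ lowcut_ok); exact: (hom_bound _ _ lowcut_ok).2.
- move=> s; apply: (le_trans (ler_normB _ _)); rewrite mulrDl; apply: lerD; [exact: hC1|exact: hC2].
Qed.

Lemma LP_unique x xi1 xi2 : Sspace mu xi1 -> Sspace mu xi2 ->
  LP x xi1 -> LP x xi2 -> forall t, t <= 0 -> xi1 t = xi2 t.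
Proof.
move=> S1 S2 l1 l2 t t0; have := LP_lipschitz S1 S2 l1 l2 t0.
by rewrite subrr normr0 !mul0r normr_le0 subr_eq0 => /eqP.
Qed.

Lemma LP_low x xi i : LP x xi -> (i < n)%N -> dot (xi 0) (e i) = dot x (e i).
Proof.
move=> /(_ 0 (lexx 0) i) + ni.
by rewrite ni set_itv1 Rintegral_set1 subr0 /Ycoef mulr0 expR0 mul1r.
Qed.

Lemma LP_entire x xi : Sspace mu xi -> LP x xi -> entire F mu zeta h xi.
Proof.
move=> S hx; split => // r t rt t0 i.
have [m [D D0 hD]] := Sspace_phiN S.
have hf := (LP_fixed m D0 hD x).1 hx.
by have := LPop_ode m D0 hD x i rt t0; rewrite /Ycoef -(hf t t0) -(hf r (le_trans rt t0)).
Qed.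

(** The orbit and [LPop] along it have the same right-hand side, so their difference is constant in
    the coordinates [Ycoef]. On low modes it vanishes at 0; on high modes the growth condition
    bounds it by a multiple of exp((lam_i - mu) s), which tends to 0 as s goes to minus infinity. *)
Lemma entire_LP xi : entire F mu zeta h xi -> LP (fracP n (xi 0)) xi.
Proof.
move=> [S o]; have [m [D D0 hD]] := Sspace_phiN S.
set x := fracP n (xi 0).
have [C hC] := Sspace_growth S; have [C' C'0 hC'] := LPop_bound m D0 hD x.
move=> t t0 i; rewrite -(LPop_coef m D0 hD x i t0).
pose W s := Ycoef xi i s - Ycoef (LPop x xi) i s.
have Wc s : s <= t -> W t = W s.
  move=> st; rewrite /W (LPop_ode m D0 hD x i st t0).
  by rewrite [X in X - _](o _ _ st t0 i) opprD addrACA subrr addr0.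
suff : W t = 0 by move/eqP; rewrite subr_eq0 => /eqP.
have [ni|ni] := ltnP i n.
  have W0 : W 0 = 0.
    rewrite /W (LPop_coef m D0 hD x i (lexx 0)) ni set_itv1 Rintegral_set1 subr0.
    by rewrite /Ycoef mulr0 expR0 mul1r fracP_coef ni subrr.
  rewrite -W0 /W (LPop_ode m D0 hD x i t0 (lexx 0)).
  by rewrite [X in _ = X - _](o _ _ t0 (lexx 0) i) opprD addrACA subrr addr0.
pose B := (lam 0%N `^ a)^-1 * (`|C| + C').
have lm : 0 < lam i - mu by rewrite subr_gt0 (lt_le_trans gap.1)// eigval_mono.
have Wb s : s <= t -> `|W t| <= B * expR ((lam i - mu) * s).
  move=> st; rewrite (Wc s st) /W /Ycoef -mulrBr -coefB normrM ger0_norm ?expR_ge0//.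
  have s0 := le_trans st t0.
  have -> : expR ((lam i - mu) * s) = expR (lam i * s) * expR (- mu * s).
    by rewrite -expRD; congr expR; ring.
  rewrite mulrCA ler_wpM2l ?expR_ge0// (le_trans (coef_le _ _ _))//.
  rewrite (le_trans (frac_norm_le _))// /B -mulrA ler_wpM2l ?invr_ge0 ?powR_ge0//.
  rewrite (le_trans (ler_normB _ _))// mulrDl lerD//.
  by rewrite (le_trans (hC s s0))// ler_wpM2r ?expR_ge0// ler_norm.
(* Evaluated at the times t - j / (lam_i - mu), the exponential bound becomes geometric with ratio
   1/e. *)
apply: (@eq_of_geometric_bound _ R^o _ _ (B * expR ((lam i - mu) * t)) (expR (- 1))).
  by rewrite expR_ge0/= -expR0 ltr_expR oppr_lt0.
move=> j; rewrite subr0; have st : t - j%:R / (lam i - mu) <= t.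
  by rewrite gerBl divr_ge0// ltW.
apply: (le_trans (Wb _ st)); rewrite -[leRHS]mulrA -expRM_natl -expRD le_eqVlt; apply/orP; left.
by apply/eqP; congr (_ * expR _); field; rewrite gt_eqF.
Qed.

End forced.
End lyapunov_perron.

Section lyapunov_perron_solution.
Context {R : realType} {H : hilbertType R} (A : posOperator H) (alpha : {nonneg R}).
Local Notation e := (eigvec A).
Local Notation a := (alpha%:num).
Local Notation X := (fracSpace A alpha).
Local Notation leb := (@lebesgue_measure R).
Local Notation mR := (measurableTypeR R).
Local Notation L1 D f := (leb.-integrable (D : set mR) (EFin \o f)).
Hypothesis hsep : separable H.
Hypothesis a1 : a < 1.
Variables (F : X -> H) (L : R).
Hypothesis L0 : 0 < L.
Hypothesis F0 : F 0 = 0.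
Hypothesis FL : forall u v, `|F u - F v| <= L * `|u - v|.
Variables (n : nat) (mu : R).
Hypothesis gap : spectral_gap A n mu.
Hypothesis hq : L * kappa A n mu a < 1.
Context {d} {T : measurableType d}.

Lemma measurable_le0 : measurable_fun [set: T * R] (fun p : T * R => p.2 <= 0).
Proof. by apply: measurable_fun_ler => //; exact: measurable_snd. Qed.

(** The prescribed low part [x] may depend on the parameter, so that joint measurability is
    available when it is shifted by the noise. *)
Lemma LP_exists (zeta : T -> R -> X) (h : R -> X) (x : T -> X) :
  (forall w, continuous (zeta w)) ->
  (forall w, exists C, forall s, s <= 0 -> `|zeta w s| <= C * expR (- mu * s)) ->
  pmeas A (fun p : T * R => zeta p.1 p.2) ->
  forcing h -> L1 `]-oo, (0 : R)] (fun s : R => expR (mu * s) * `|h s|) ->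
  (forall i, measurable_fun setT (fun w => dot (x w) (e i))) ->
  exists2 xi : T * R -> X, pmeas A xi &
    forall w, Sspace mu (fun s => xi (w, s)) /\
      LP F n (zeta w) h (x w) (fun s => xi (w, s)).
Proof.
move=> cz zb mz fh hw mx.
pose G (w : T) (s : R) (u : X) : H := if s <= 0 then F (u + zeta w s) else 0.
pose a0 (p : T * R) : X := hom (lowcut n) (x p.1) p.2 + Kop A alpha n (cut0 h) p.2.
have lok := lowcut_ok gap.
have mh := hneg_meas fh; have ih := hneg_int hw.
have Gm (eta : T * R -> X) : pmeas A eta -> pmeas A (fun p => G p.1 p.2 (eta p)).
  move=> meta i; rewrite (_ : (fun p => _) = fun p => if p.2 <= 0 then
      dot (F (eta p + zeta p.1 p.2)) (e i) else 0); last first.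
    by apply/funext => p; rewrite /G; case: ifP; rewrite ?dot0l.
  apply: measurable_fun_ifT => //; first exact: measurable_le0.
  apply: (lipschitz_coef_measurable (f := fun p => eta p + zeta p.1 p.2) hsep measurableT FL) => j.
  under eq_fun do rewrite coefD.
  by apply: measurable_funD; [exact: meta|exact: mz].
have Gl w s u v : `|G w s u - G w s v| <= L * `|u - v|.
  rewrite /G; case: ifP => _; last by rewrite subrr normr0 mulr_ge0// ltW.
  by rewrite (le_trans (FL _ _))// opprD addrACA subrr addr0.
have Gz w : exists C, forall s, `|G w s 0| <= C * expR (- mu * s).
  have z0 (s : R) : s <= 0 -> `|(0 : X)| <= 0 * expR (- mu * s) by rewrite normr0 mul0r.
  have [D _ hD] := phiN_bound L0 F0 FL (zb w) z0; exists D => s.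
  by have := hD s; rewrite /phiN /cut0 /G.
have a0m : pmeas A a0.
  move=> i; under eq_fun do rewrite coefD (K_boundX _ gap mh ih).1.2.
  apply: measurable_funD.
    apply: (hom_meas lok _ mx i) => j; apply: measurable_and => //.
    exact: measurable_fun_ler.
  apply: (measurable_Kc n (phi := fun p : T * R => cut0 h p.2 : H)).
  exact: (measurableT_comp (mh i) measurable_snd).
have a0b w : exists C, forall s, `|a0 (w, s)| <= C * expR (- mu * s).
  exists (`|x w| + \int[leb]_s (expR (mu * s) * `|cut0 h s|)) => s.
  apply: (le_trans (ler_normD _ _)); rewrite mulrDl; apply: lerD.
    exact: (hom_bound _ _ lok).2.
  by rewrite mulrC; exact: (K_boundX s gap mh ih).2.
have [xi [mxi bxi exi]] := fixed_point_exists a1 gap (ltW L0) hq Gm Gl Gz a0m a0b.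
exists xi => // w; pose v s := xi (w, s).
have mphi : cmeas A (phiN F (zeta w) v) by exact: (pmeas_section w (Gm _ mxi)).
have [C hC] := bxi w.
have [D D0 hD] := phiN_bound L0 F0 FL (zb w) (fun s _ => hC s).
have lp : LP F n (zeta w) h (x w) v.
  apply/(LP_fixed a1 gap fh hw mphi D0 hD) => t t0.
  exact: exi w t.
split => //.
exact: (LP_Sspace a1 gap fh hw mphi D0 hD lp).
Qed.

End lyapunov_perron_solution.

(** * Exponential tracking *)

Section tracking.
Context {R : realType} {H : hilbertType R} (A : posOperator H) (alpha : {nonneg R}).
Local Notation e := (eigvec A).
Local Notation lam := (eigval A).
Local Notation a := (alpha%:num).
Local Notation X := (fracSpace A alpha).
Local Notation leb := (@lebesgue_measure R).
Local Notation mR := (measurableTypeR R).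
Local Notation L1 D f := (leb.-integrable (D : set mR) (EFin \o f)).
Hypothesis hsep : separable H.
Hypothesis a1 : a < 1.
Variables (F : X -> H) (L : R).
Hypothesis L0 : 0 < L.
Hypothesis F0 : F 0 = 0.
Hypothesis FL : forall u v, `|F u - F v| <= L * `|u - v|.
Variables (n : nat) (mu : R).
Hypothesis gap : spectral_gap A n mu.
Hypothesis hq : L * kappa A n mu a < 1.
Variables (zeta h : R -> X).
Hypothesis zeta_cts : continuous zeta.
Hypothesis zeta_bd : exists C, forall s, s <= 0 -> `|zeta s| <= C * expR (- mu * s).
Hypothesis fh : forcing h.
Hypothesis hw : L1 `]-oo, (0 : R)] (fun s : R => expR (mu * s) * `|h s|).
Variables (v0 : X) (v : R -> X).
Hypothesis sv : solution F zeta h 0 v0 v.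

Definition highcut (i : nat) (t : R) := (n <= i)%N && (0 < t).

Lemma highcut_ok : cut_ok A mu highcut.
Proof.
move=> i t /andP[ni t0]; rewrite mulr_ge0// ?(ltW t0)// subr_ge0.
by rewrite (le_trans (ltW gap.1))// eigval_mono.
Qed.

Let vv (s : R) : X := if s <= 0 then 0 else v s.

(** Before 0 this is the Lyapunov-Perron nonlinearity. After 0 it is an increment of F that vanishes
    at [u = 0], so the uncontrolled forward growth of [v] and of the noise does not affect the
    weighted bounds. *)
Let G (s : R) (u : X) : H := F (vv s + u + zeta s) - (if s <= 0 then 0 else F (v s + zeta s)).

Let vpos_meas (f : R -> H) : (forall i, measurable_fun `[(0 : R), +oo[ (fun s => dot (f s) (e i))) ->
  cmeas A (fun s => if s <= 0 then 0 else f s).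
Proof.
move=> mf i.
have mE : measurable (`](0 : R), +oo[%classic : set mR) by exact: measurable_itv.
have mE' : measurable (`[(0 : R), +oo[%classic : set mR) by exact: measurable_itv.
have sub : `](0 : R), +oo[ `<=` `[(0 : R), +oo[.
  by move=> s /=; rewrite !in_itv/= !andbT => /ltW.
have := (measurable_restrictT (fun s => dot (f s) (e i)) mE).1 (measurable_funS mE' sub (mf i)).
apply: eq_measurable_fun => s _; rewrite patchE mem_setE in_itv/= andbT ltNge.
by rewrite if_neg; case: ifP; rewrite ?dot0l.
Qed.

Let v_meas i : measurable_fun `[(0 : R), +oo[ (fun s => dot (v s) (e i)).
Proof. by have [_ cv _] := sv; apply: within_coef_meas. Qed.

Let vv_meas : cmeas A vv.
Proof.
rewrite (_ : (fun s => _) = fun s => if s <= 0 then 0 else v s : H); first exact: vpos_meas.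
by apply/funext => s; rewrite /vv; case: ifP.
Qed.

Let Fv_meas : cmeas A (fun s => if s <= 0 then 0 else F (v s + zeta s)).
Proof.
by apply: vpos_meas; exact: (F_meas hsep FL zeta_cts (measurable_itv _) v_meas).
Qed.

(** The low modes of v0 are present up to 0 and the high modes of -v0 after it, so the jump at 0 is
    exactly -v0, opposite to that of [vv]. *)
Let a0 (t : R) : X := (hom (lowcut n) v0 t - hom highcut v0 t) + Kop A alpha n (cut0 h) t.

Let lok := lowcut_ok gap.
Let mh := hneg_meas fh.
Let ih := hneg_int hw.

Let eta_exists : exists eta : R -> X, [/\ cmeas A (fun s => G s (eta s)),
  exists2 C, 0 <= C & forall s, `|eta s| <= C * expR (- mu * s),
  exists2 D, 0 <= D & forall s, `|G s (eta s)| <= D * expR (- mu * s) &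
  forall t, eta t = a0 t + Kop A alpha n (fun s => G s (eta s)) t].
Proof.
pose G1 (_ : unit) := G; pose a1' (p : unit * R) := a0 p.2.
have Gm (eta : unit * R -> X) : pmeas A eta -> pmeas A (fun p => G1 p.1 p.2 (eta p)).
  move=> meta i; under eq_fun do rewrite /G1 /G dotBl.
  apply: measurable_funB; last first.
    exact: (measurableT_comp (Fv_meas i) measurable_snd).
  apply: (lipschitz_coef_measurable (f := fun p => vv p.2 + eta p + zeta p.2) hsep measurableT FL) => j.
  under eq_fun do rewrite !coefD.
  apply: measurable_funD.
    apply: measurable_funD; last exact: meta.
    exact: (measurableT_comp (vv_meas j) measurable_snd).
  exact: (measurableT_comp (zeta_meas zeta_cts j) measurable_snd).
have Gl w s u1 u2 : `|G1 w s u1 - G1 w s u2| <= L * `|u1 - u2|.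
  rewrite /G1 /G opprB addrA subrK (le_trans (FL _ _))//.
  rewrite (_ : vv s + u1 + zeta s - (vv s + u2 + zeta s) = u1 - u2)//.
  by apply: frac_eq => i; rewrite !(coefB, coefD); ring.
have Gz (w : unit) : exists C, forall s, `|G1 w s 0| <= C * expR (- mu * s).
  have z0 (s : R) : s <= 0 -> `|(0 : X)| <= 0 * expR (- mu * s) by rewrite normr0 mul0r.
  have [D D0 hD] := phiN_bound L0 F0 FL zeta_bd z0; exists D => s.
  have := hD s; rewrite /phiN /cut0 /G1 /G /vv; case: ifP => s0; first by rewrite addr0 subr0.
  by rewrite addr0 subrr.
have a0m : pmeas A a1'.
  move=> i; under eq_fun do rewrite coefD coefB (K_boundX _ gap mh ih).1.2.
  have mv (j : nat) : measurable_fun setT (fun w : unit => dot v0 (e j)) by [].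
  apply: measurable_funD; last first.
    apply: (measurable_Kc n (phi := fun p : unit * R => cut0 h p.2 : H)).
    exact: (measurableT_comp (mh i) measurable_snd).
  apply: measurable_funB.
    apply: (hom_meas lok _ mv i) => j; apply: measurable_and => //.
    exact: measurable_fun_ler.
  apply: (hom_meas highcut_ok _ mv i) => j; apply: measurable_and => //.
  exact: measurable_fun_ltr.
have a0b (w : unit) : exists C, forall s, `|a1' (w, s)| <= C * expR (- mu * s).
  exists (`|v0| + `|v0| + \int[leb]_s (expR (mu * s) * `|cut0 h s|)) => s.
  apply: (le_trans (ler_normD _ _)); rewrite mulrDl; apply: lerD.
    apply: (le_trans (ler_normB _ _)); rewrite mulrDl; apply: lerD.
      exact: (hom_bound _ _ lok).2.
    exact: (hom_bound _ _ highcut_ok).2.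
  by rewrite mulrC; exact: (K_boundX s gap mh ih).2.
have [eta [meta beta eeta]] := fixed_point_exists a1 gap (ltW L0) hq Gm Gl Gz a0m a0b.
exists (fun s => eta (tt, s)); have [C hC] := beta tt; have [D hD] := Gz tt.
split.
- exact: (pmeas_section tt (Gm _ meta)).
- exists `|C| => // s; apply: (le_trans (hC s)); by rewrite ler_wpM2r ?expR_ge0// ler_norm.
- exists (L * `|C| + `|D|); first by rewrite addr_ge0// mulr_ge0// ltW.
  move=> s; rewrite -(subrK (G s 0) (G s (eta (tt, s)))); apply: (le_trans (ler_normD _ _)).
  rewrite mulrDl; apply: lerD.
    apply: (le_trans (Gl tt s _ _)); rewrite subr0 -mulrA ler_wpM2l ?(ltW L0)//.
    by apply: (le_trans (hC s)); rewrite ler_wpM2r ?expR_ge0// ler_norm.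
  by apply: (le_trans (hD s)); rewrite ler_wpM2r ?expR_ge0// ler_norm.
- by move=> t; rewrite {1}eeta.
Qed.

(* The corrector [eta] solves a fixed point equation on the whole line:
   [eta] itself is an entire orbit for [t <= 0], and [v + eta] is a solution for
   [t >= 0]. The two [hom] terms of [a0] absorb the jump of [vv] at [0]. *)
Theorem tracking : exists (xi w : R -> X) (C : R), [/\ entire F mu zeta h xi,
  solution F zeta h 0 (xi 0) w & forall t, 0 <= t -> `|v t - w t| <= C * expR (- mu * t)].
Proof.
(* Linear identities over plain variables, so that [lra] does not meet the integrals. *)
have lin1 (p A1 B1 A2 B2 I : R) : A1 + B1 = A2 + B2 + I ->
  p + A1 + B1 = p + A2 + B2 + I by move=> E; lra.
have lin2 (x p q J A1 B1 A2 B2 I : R) : x = p + q -> A1 + B1 = A2 + B2 + I ->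
  x + J + (- p + A1 + B1) = q + A2 + B2 + (I + J) by move=> -> E'; lra.
have [eta [mphi [C C0 hC] [D D0 hD] eE]] := eta_exists.
set phi := fun s => G s (eta s) in mphi hD eE.
have [i0 cv ov] := sv.
pose gX t := (K_boundX t gap mh ih).1; pose gH t := (K_boundH t a1 gap mphi D0 hD).1.
have cX := Kop_continuousX gap mh ih.
have cH := Kop_continuousH a1 gap mphi D0 hD.
have homY c t i : cut_ok A mu c ->
    expR (lam i * t) * dot (hom c v0 t) (e i) = if c i t then dot v0 (e i) else 0.
  move=> hc; rewrite (hom_bound _ _ hc).1; case: ifP => _; rewrite ?mulr0//.
  by rewrite mulrA -expRD (_ : _ + _ = 0) ?expR0 ?mul1r//; ring.
have etaY i t : Ycoef eta i t = (if lowcut n i t then dot v0 (e i) else 0) -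
    (if highcut i t then dot v0 (e i) else 0) +
    Ycoef (Kop A alpha n (cut0 h)) i t + Ycoef (Kop A alpha n phi) i t.
  rewrite {1}/Ycoef eE /a0 coefD coefD coefB !mulrDr; congr (_ + _ + _).
  by rewrite mulrN (homY _ _ _ lok) (homY _ _ _ highcut_ok).
have ode i r t : r <= t ->
    [/\ L1 `[r, t] (psi A (cut0 h) i), L1 `[r, t] (psi A phi i) &
    Ycoef (Kop A alpha n (cut0 h)) i t + Ycoef (Kop A alpha n phi) i t =
    Ycoef (Kop A alpha n (cut0 h)) i r + Ycoef (Kop A alpha n phi) i r +
    \int[leb]_(s in `[r, t]) (psi A (cut0 h) i s + psi A phi i s)].
  move=> rt; have [iX EX] := Kop_ode i rt (gX r) (gX t).
  have [iH EH] := Kop_ode i rt (gH r) (gH t); split => //.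
  rewrite RintegralD//; apply: (etrans (f_equal2 +%R EX EH)).
  by rewrite addrACA.
have psi_neg i s : s <= 0 -> psi A (cut0 h) i s + psi A phi i s = psi A (rhs F zeta h eta) i s.
  move=> s0; rewrite /psi -mulrDr -dotDl; congr (_ * dot _ _).
  by rewrite /rhs /phi /G /vv /cut0 s0 add0r subr0 addrC.
pose w t := if t <= 0 then eta t else v t + eta t.
have psi_pos i s : 0 < s -> psi A (cut0 h) i s + psi A phi i s + psi A (rhs F zeta h v) i s =
    psi A (rhs F zeta h w) i s.
  move=> s0; rewrite /psi -!mulrDr -!dotDl; congr (_ * dot _ _).
  by rewrite /rhs /phi /G /w /vv /cut0 leNgt s0/= add0r addrA subrK.
have eent : entire F mu zeta h eta.
  split; last first.
    move=> r t rt t0 i; have r0 := le_trans rt t0; rewrite (etaY i t) (etaY i r).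
    have hi (s : R) : s <= 0 -> highcut i s = false by move=> s0; rewrite /highcut ltNge s0 andbF.
    have lo (s : R) : s <= 0 -> lowcut n i s = (i < n)%N by move=> s0; rewrite /lowcut s0 andbT.
    rewrite (hi t t0) (hi r r0) (lo t t0) (lo r r0).
    have [_ _] := ode i r t rt.
    have -> : \int[leb]_(s in `[r, t]) (psi A (cut0 h) i s + psi A phi i s) =
        \int[leb]_(s in `[r, t]) psi A (rhs F zeta h eta) i s.
      apply: eq_Rintegral => s; rewrite inE/= in_itv/= => /andP[_ st].
      by rewrite psi_neg// (le_trans st).
    exact: lin1.
  split; last by exists C => t _; rewrite growthP.
  have c1 i s : `]-oo, (0 : R)]%classic s -> lowcut n i s = (i < n)%N.
    by rewrite /= in_itv/= /lowcut => ->; rewrite andbT.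
  have cI := @hom_within _ _ A alpha mu (lowcut n) v0 _ (fun i => (i < n)%N) lok c1.
  pose u t : X := (hom (lowcut n) v0 t + Kop A alpha n (cut0 h) t) + Kop A alpha n phi t.
  have cu : {within `]-oo, (0 : R)], continuous u}.
    apply/subspace_continuousP => t t0.
    apply: cvgD; last by apply: cvg_within_filter; exact: cH.
    apply: cvgD; last by apply: cvg_within_filter; exact: cX.
    by move/subspace_continuousP: cI => /(_ t t0).
  have E s : `]-oo, (0 : R)]%classic s -> u s = eta s.
    rewrite /= in_itv/= => s0; rewrite eE /a0 /u; congr (_ + _ + _).
    apply: frac_eq => i; rewrite coefB (hom_bound v0 s highcut_ok).1 /highcut ltNge s0 andbF.
    by rewrite subr0.
  exact: (within_ext E cu).
exists eta, w, (C + `|v0 - eta 0|); split => //.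
  split; first by rewrite /w lexx.
    have c2 i s : `[(0 : R), +oo[%classic s -> ((n <= i)%N && (0 <= s)) = (n <= i)%N.
      by rewrite /= in_itv/= andbT => ->; rewrite andbT.
    (* The strict inequality of [highcut] is relaxed to include 0: at 0 this leaves the low modes of
       v0, which is the value of [w] there, and the formula is continuous up to the endpoint. *)
    have hok : cut_ok A mu (fun i s => (n <= i)%N && (0 <= s)).
      move=> i t /andP[ni t0]; rewrite mulr_ge0// subr_ge0.
      by rewrite (le_trans (ltW gap.1))// eigval_mono.
    have cI := @hom_within _ _ A alpha mu _ v0 _ (fun i => (n <= i)%N) hok c2.
    pose u t : X := v t - hom (fun i s => (n <= i)%N && (0 <= s)) v0 t +
      Kop A alpha n (cut0 h) t + Kop A alpha n phi t.
    have cu : {within `[(0 : R), +oo[, continuous u}.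
      apply/subspace_continuousP => t t0.
      apply: cvgD; last by apply: cvg_within_filter; exact: cH.
      apply: cvgD; last by apply: cvg_within_filter; exact: cX.
      apply: cvgB; first by move/subspace_continuousP: cv => /(_ t t0).
      by move/subspace_continuousP: cI => /(_ t t0).
    have E s : `[(0 : R), +oo[%classic s -> u s = w s.
      rewrite /= in_itv/= andbT => s0; rewrite /w /u eE /a0.
      case: ifPn => s0'.
        have -> : s = 0 by apply/le_anti; rewrite s0' s0.
        congr (_ + _ + _); apply: frac_eq => i; rewrite i0 !coefB.
        rewrite (hom_bound v0 0 hok).1 (hom_bound v0 0 highcut_ok).1 (hom_bound v0 0 lok).1.
        rewrite /lowcut /highcut lexx ltxx !andbT andbF mulr0 expR0 mul1r subr0.
        by rewrite ltnNge; case: (n <= i)%N; rewrite ?subrr ?subr0.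
      rewrite -ltNge in s0'; rewrite !addrA; congr (_ + _ + _).
      apply: frac_eq => i; rewrite !coefB coefD.
      rewrite (hom_bound v0 s hok).1 (hom_bound v0 s highcut_ok).1 (hom_bound v0 s lok).1.
      by rewrite /lowcut /highcut s0 s0' leNgt s0' andbF addr0.
    exact: (within_ext E cu).
  move=> t; rewrite le_eqVlt => /orP[/eqP <- i|t0 i].
    by rewrite set_itv1 Rintegral_set1 addr0.
  have tn : (t <= 0) = false by rewrite leNgt t0.
  have wY : Ycoef w i t = Ycoef v i t + Ycoef eta i t.
    by rewrite /Ycoef /w tn coefD mulrDr.
  have wY0 : Ycoef w i 0 = Ycoef eta i 0 by rewrite /Ycoef /w lexx.
  have [jX jH E] := ode i 0 t (ltW t0).
  have cvt := within_ocy (lexx 0) cv (t := t).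
  have jv := rhs_psi_int hsep L0 F0 FL zeta_cts fh.1 fh.2 i (ltW t0) cvt.
  have jS : L1 `[0, t] (fun s => psi A (cut0 h) i s + psi A phi i s) by exact: L1D.
  have Iw : \int[leb]_(s in `[0, t]) psi A (rhs F zeta h w) i s =
      \int[leb]_(s in `[0, t]) (psi A (cut0 h) i s + psi A phi i s) +
      \int[leb]_(s in `[0, t]) psi A (rhs F zeta h v) i s.
    rewrite -RintegralD//.
    have jT : L1 `[0, t] (fun s => psi A (cut0 h) i s + psi A phi i s + psi A (rhs F zeta h v) i s).
      exact: L1D.
    (* The integrands are identified only for s > 0, so the endpoint 0, a null set, is removed
       first. *)
    have sub : `]0, t] `<=` `[0, t] by move=> s /=; rewrite !in_itv/= => /andP[/ltW -> ->].
    have jT' : L1 `]0, t] (fun s => psi A (cut0 h) i s + psi A phi i s + psi A (rhs F zeta h v) i s).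
      exact: (L1_sub _ _ sub jT).
    rewrite -(Rintegral_itv_obnd_cbnd jT') -Rintegral_itv_obnd_cbnd.
      apply: eq_Rintegral => s; rewrite inE/= in_itv/= => /andP[s0 _].
      by rewrite psi_pos.
    apply: L1_eq jT' => // s; rewrite /= in_itv/= => /andP[s0 _].
    by rewrite psi_pos.
  rewrite wY wY0 (etaY i t) (etaY i 0) Iw.
  rewrite [X in X + _ = _](ov t (ltW t0) i) {1}/Ycoef i0 mulr0 expR0 mul1r.
  rewrite /lowcut /highcut tn t0 lexx ltxx !andbT !andbF subr0 sub0r.
  by apply: lin2 E; rewrite ltnNge; case: (n <= i)%N; rewrite /= ?addr0 ?add0r.
move=> t; rewrite le_eqVlt => /orP[/eqP <-|t0].
  by rewrite /w lexx i0 mulr0 expR0 mulr1 lerDr.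
have tn : (t <= 0) = false by rewrite leNgt t0.
rewrite /w tn opprD addrA subrr sub0r normrN (le_trans (hC t))//.
by rewrite ler_wpM2r ?expR_ge0// lerDl.
Qed.

End tracking.

(** * Measurability of the Wiener shift *)

Section wiener_shift_measurable.
Context {R : realType} {H : hilbertType R}.
Local Notation mR := (measurableTypeR R).

(** Near a continuous path the compact-open topology is that of uniform convergence on compact sets;
    closeness on the translate of K by t and at the point t gives closeness of the shifted paths on
    K. *)
Lemma shift_compact_open_cvg (t : R) (w : R -> H) : continuous w ->
  {compact-open, (fun f : {compact-open, R -> H} => (fun s => f (s + t) - f t)) @
    nbhs (w : {compact-open, R -> H}) --> (fun s => w (s + t) - w t)}.
Proof.
move=> cw; have ct : continuous (fun s : R => s + t).
  by move=> s; apply: cvgD; [exact: cvg_id|exact: cvg_cst].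
have cSw : continuous (fun s => w (s + t) - w t).
  move=> s; apply: cvgB; last exact: cvg_cst.
  by apply: (@continuous_comp _ _ _ (fun s : R => s + t) w); [exact: ct|exact: cw].
apply/compact_open_fam_compactP => //; apply/fam_cvgP => K cK.
move=> P /uniform_nbhs[E [entE EP]].
have FF : Filter (nbhs (w : {compact-open, R -> H})) by exact: nbhs_filter.
have /fam_cvgP hw : {family compact, nbhs (w : {compact-open, R -> H}) --> w}.
  by apply/compact_open_fam_compactP => //; exact: cvg_id.
move: entE; rewrite -entourage_ballE => -[eps/= eps0 epsE].
have e2 : 0 < eps / 2 by rewrite divr_gt0.
have near_ball (A : set R) : compact A ->
    nbhs (w : {compact-open, R -> H}) [set f | forall y, A y -> ball (w y) (eps / 2) (f y)].
  move=> cA; apply: (hw A cA); apply/uniform_nbhs.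
  exists [set xy | ball xy.1 (eps / 2) xy.2]; split=> //.
  by rewrite -entourage_ballE; exists (eps / 2).
have N1 : compact [set s + t | s in K].
  by apply: continuous_compact => //; exact: continuous_subspaceT.
have N2 : compact [set t] by exact: compact_set1.
apply: filterS2 (near_ball _ N1) (near_ball _ N2) => f h1 h2.
apply: EP => s Ks; apply: epsE => /=.
have := h1 (s + t) (ex_intro2 _ _ s Ks erefl); have := h2 t erefl.
rewrite -!ball_normE/= => d1 d2.
rewrite (_ : _ - _ = (w (s + t) - f (s + t)) - (w t - f t)); last first.
  by rewrite !opprB addrACA [RHS]addrACA; congr (_ + _); exact: addrC.
by rewrite (le_lt_trans (ler_normB _ _))// [ltRHS]splitr ltrD.
Qed.

Lemma measurable_theta (t : R) : measurable_fun [set: wienerSpace H] (theta t : wienerSpace H -> wienerSpace H).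
Proof.
apply: (@measurability _ _ (wienerSpace H) (wienerSpace H) setT (theta t) (@path0_open R H) erefl).
move=> _ [_ [U oU ->] <-].
rewrite setTI; apply: sub_sigma_algebra.
pose S (f : {compact-open, R -> H}) : {compact-open, R -> H} := fun s => f (s + t) - f t.
(* The topology lives on all functions, whereas [S] is shown to be continuous only at continuous
   ones. The preimage of [U] need not be open, but its interior contains the same continuous
   paths. *)
exists (interior (S @^-1` U)); first exact: open_interior.
apply/seteqP; split => w /= hw; last exact: (interior_subset hw).
apply: (shift_compact_open_cvg (@path0_cts _ _ w)).
exact: open_nbhs_nbhs.
Qed.

Lemma measurable_countable_param d1 d2 (T1 : measurableType d1) (T2 : measurableType d2)
    (f : T1 -> int -> R) (k : T2 -> int) :
  (forall j, measurable_fun setT (fun w => f w j)) ->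
  (forall j, measurable (k @^-1` [set j])) ->
  measurable_fun setT (fun p : T1 * T2 => f p.1 (k p.2)).
Proof.
move=> mf mk _ B mB; rewrite setTI.
rewrite (_ : _ @^-1` B = \bigcup_j ((fun w => f w j) @^-1` B `*` k @^-1` [set j])); last first.
  apply/seteqP; split => [[w s] /= hB|[w s] [j _] /= [hB kj]]; last by rewrite kj.
  by exists (k s).
apply: countable_bigcupT_measurable; first exact: countableP.
move=> j; apply: measurableX => //.
by have := mf j measurableT B mB; rewrite setTI.
Qed.

(** Time is rounded down to the grid of step 1/(m+1), which leaves countably many sections;
    continuity in time gives convergence as m grows. *)
Lemma measurable_caratheodory d (T : measurableType d) (f : T -> R -> R) :
  (forall s, measurable_fun setT (fun w => f w s)) -> (forall w, continuous (f w)) ->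
  measurable_fun setT (fun p : T * R => f p.1 p.2).
Proof.
move=> mf cf; pose k (m : nat) (s : R) : int := Num.floor (m.+1%:R * s).
pose q (m : nat) (j : int) : R := j%:~R / m.+1%:R.
apply: (measurable_fun_cvg (h := fun m p => f p.1 (q m (k m p.2)))) => [m|[w s] _].
  apply: (measurable_countable_param (f := fun w j => f w (q m j)) (k := k m)) => // j.
  rewrite (_ : _ @^-1` _ = (fun s : R => m.+1%:R * s) @^-1` `[j%:~R, (j + 1)%:~R[%classic); last first.
    apply/seteqP; split => s /=; rewrite in_itv/= /k.
      by move=> <-; rewrite floor_le floorD1_gt.
    by move=> hs; exact: floor_def.
  rewrite -[X in measurable X]setTI.
  have mm : measurable_fun [set: mR] (fun s : R => m.+1%:R * s) by exact: measurable_funM.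
  by apply: mm => //; exact: measurable_itv.
have qs : (fun m => q m (k m s)) @ \oo --> s.
  apply: (@squeeze_cvgr _ _ _ _ (fun m => s - m.+1%:R^-1) (fun=> s)).
  - apply: nearW => m; rewrite /q /k.
    have h1 := floor_le (m.+1%:R * s); have h2 := floorD1_gt (m.+1%:R * s).
    have m0 : 0 < m.+1%:R :> R by [].
    rewrite ler_pdivrMr// ler_pdivlMr// mulrBl mulVf ?gt_eqF// (mulrC s) h1 andbT.
    by rewrite lerBlDr ltW// -[X in _ < _ + X](mulr1z 1) -intrD.
  - rewrite -[X in _ --> X]subr0; apply: cvgB; first exact: cvg_cst.
    exact: cvg_harmonic.
  - exact: cvg_cst.
exact: (cvg_comp _ _ qs (cf w s)).
Qed.

End wiener_shift_measurable.

(** * The forcing, the noise and the gap condition *)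

Section data.
Context {R : realType} {H : hilbertType R} (A : posOperator H) (alpha : {nonneg R}).
Local Notation lam := (eigval A).
Local Notation a := (alpha%:num).
Local Notation X := (fracSpace A alpha).
Local Notation leb := (@lebesgue_measure R).
Local Notation mR := (measurableTypeR R).
Local Notation shift := Defs.shift.
Local Notation L1 D f := (leb.-integrable (D : set mR) (EFin \o f)).

Lemma L2loc_forcing (h : R -> X) : separable H -> L2loc h -> forcing h.
Proof.
move=> hsep [mh ih]; have mc := (borel_fraccoefP h hsep measurableT).1 mh.
split => // r t; have mi : measurable (`[r, t]%classic : set mR) by exact: measurable_itv.
have mn : measurable_fun [set: mR] (fun s => `|h s|) by exact: measurable_fracnorm.
have i1 : L1 `[r, t] (fun=> 1 : R) by apply: (@L1_bounded _ _ _ 1) => // s _; rewrite normr1.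
have i2 : L1 `[r, t] (fun s => `|h s| ^+ 2).
  apply/integrableP; split.
    by apply/measurable_EFinP; apply: measurable_funTS; exact: measurable_funX.
  under eq_integral do rewrite /= ger0_norm ?sqr_ge0//.
  exact: ih.
apply: L1_le (L1D mi i1 i2) => //; first exact: measurable_funTS.
move=> s _; rewrite normr_id; set x := `|h s|.
have x0 : 0 <= x by exact: normr_ge0.
by nra.
Qed.

(** By periodicity the integrals I_m over [m] periods satisfy I_(m+1) = q I_m + c with q = exp(-nu
    T) < 1, hence stay below c / (1 - q). *)
Lemma periodic_weighted (nu T : R) (h : R -> X) : 0 < nu -> 0 < T -> forcing h ->
  (forall s, h (s + T) = h s) -> L1 `]-oo, (0 : R)] (fun s : R => expR (nu * s) * `|h s|).
Proof.
move=> nu0 T0 [mh ih] hT; pose f (s : R) := expR (nu * s) * `|h s|.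
have mf : measurable_fun [set: mR] f.
  by apply: measurable_funM; [exact: measurable_expRM|exact: measurable_fracnorm].
have f0 s : 0 <= f s by rewrite mulr_ge0 ?expR_ge0.
pose D (m : nat) : set mR := `[- (m%:R * T), 0]%classic.
have mD m : measurable (D m) by exact: measurable_itv.
have iD r t : t <= 0 -> L1 `[r, t] f.
  move=> t0; have mi : measurable (`[r, t]%classic : set mR) by exact: measurable_itv.
  apply: L1_le (ih r t) => //; first exact: measurable_funTS.
  move=> s /=; rewrite in_itv/= => /andP[_ st]; rewrite ger0_norm//.
  rewrite -[leRHS]mul1r ler_wpM2r// -expR0 ler_expR mulr_ge0_le0 ?(ltW nu0)//.
  exact: le_trans t0.
pose I m := \int[leb]_(s in D m) f s.
pose q := expR (- (nu * T)); pose c := \int[leb]_(s in `[- T, 0]) f s.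
have q1 : q < 1 by rewrite -expR0 ltr_expR oppr_lt0 mulr_gt0.
have IS m : I m.+1 = q * I m + c.
  rewrite /I /D /c (@Rintegral_cc_split _ f _ (- T) 0); last exact: iD.
    congr (_ + _).
    have -> : - (m.+1%:R * T) = - (m%:R * T) + - T by rewrite -natr1 mulrDl mul1r opprD.
    rewrite -{2}(add0r (- T)) -Rintegral_shift_cc; last by apply: iD; rewrite add0r oppr_le0 ltW.
    rewrite -RintegralZl//; last exact: iD.
    apply: eq_Rintegral => s _; rewrite /f /q mulrA -expRD -(hT (s - T)) subrK.
    by congr (expR _ * _); ring.
  by rewrite oppr_le0 (ltW T0) andbT lerN2 ler_peMl ?(ltW T0)// ler1n.
have c0 : 0 <= c by apply: Rintegral_ge0 => s _.
have Ib m : I m <= c / (1 - q).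
  elim: m => [|m IH].
    by rewrite /I /D mul0r oppr0 set_itv1 Rintegral_set1 divr_ge0// subr_ge0 ltW.
  rewrite IS (@le_trans _ _ (q * (c / (1 - q)) + c))//.
    by rewrite lerD2r ler_wpM2l ?expR_ge0.
  rewrite le_eqVlt; apply/orP; left; apply/eqP; field.
  by rewrite subr_eq0 gt_eqF.
have ED : `]-oo, (0 : R)]%classic = \bigcup_m D m :> set mR.
  apply/seteqP; split => s /=; rewrite in_itv/=.
    move=> s0; exists (Num.truncn (- s / T)).+1 => //=; rewrite /D /= in_itv/= s0 andbT.
    rewrite lerNl -ler_pdivrMr// ltW// truncnS_gt// divr_ge0// ?oppr_ge0// ltW.
  by move=> [m _]; rewrite /D /= in_itv/= => /andP[].
rewrite ED; apply: (@L1_bigcup _ D f (c / (1 - q))) => //.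
  move=> m k mk; apply/subsetPset => s; rewrite /D /= !in_itv/= => /andP[ms ->]; rewrite andbT.
  by rewrite (le_trans _ ms)// lerN2 ler_wpM2r ?(ltW T0)// ler_nat.
move=> m; have -> : (\int[leb]_(s in D m) (f s)%:E = (I m)%:E)%E.
  by rewrite /I /Rintegral fineK// integrable_fin_num//; exact: iD.
by rewrite lee_fin.
Qed.

Lemma ztraj_growth (z : wienerSpace H -> X) w c : regular_version z -> 0 < c ->
  exists C, forall s, s <= 0 -> `|ztraj z w s| <= C * expR (- c * s).
Proof.
move=> hz c0; have [cz /(_ c c0) lz] := hz w.
move/cvgrPdist_lt: lz => /(_ 1 ltr01) [M [_ hM]].
(* Nonpositive and strictly below [M]: the limit at minus infinity rules to its left, compactness
   between it and 0. *)
pose M' := Num.min M 0 - 1.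
have M0 : M' <= 0 by rewrite /M' subr_le0 ge_min ler01 orbT.
have [B B0 hB] := within_bounded M0 (@continuous_subspaceT _ _ _ (ztraj z w) cz).
exists (1 + B) => s s0; rewrite -growthP.
have [Ms|sM] := leP M' s.
  rewrite (@le_trans _ _ (1 * B))//; last by rewrite mul1r lerDr.
  apply: ler_pM => //; first by rewrite -expR0 ler_expR mulr_ge0_le0 ?(ltW c0).
  by apply: hB; rewrite Ms.
have := hM s; rewrite sub0r normrN ger0_norm ?mulr_ge0 ?expR_ge0// => h.
rewrite (@le_trans _ _ 1) ?lerDl// ltW//; apply: h.
by rewrite (lt_le_trans sM)// /M' lerBlDr ge_min lerDl ler01.
Qed.

(** Put K = 2L/k. The choice of mu makes the low summand of [kappa] exactly 1/K. The gap leaves d =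
    lambda_(n+1) - mu at least K (lambda_(n+1)^alpha + c_alpha (lambda_(n+1) - lambda_n)^alpha), and
    as d <= lambda_(n+1) - lambda_n the high summands add up to at most 1/K. The total is at most L
    * 2/K = k. *)
Lemma gap_condition (n : nat) (L k : R) : 0 < L -> 0 < k -> (0 < n)%N ->
  2 * L / k * (lam n `^ a + lam n.-1 `^ a +
      c_alpha a * (lam n - lam n.-1) `^ a) <= lam n - lam n.-1 ->
  let mu := lam n.-1 + 2 * L / k * lam n.-1 `^ a in
  spectral_gap A n mu /\ L * kappa A n mu a <= k.
Proof.
move=> L0 k0; case: n => // n _ /= hgap; set K := 2 * L / k in hgap *.
have K0 : 0 < K by rewrite divr_gt0// mulr_gt0.
set ln := lam n in hgap *; set l1 := lam n.+1 in hgap *.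
have ln0 : 0 < ln by exact: eigval_pos.
have l10 : 0 < l1 by exact: eigval_pos.
have pn : 0 < ln `^ a by rewrite powR_gt0.
have p1 : 0 < l1 `^ a by rewrite powR_gt0.
have ca : 0 <= c_alpha a by exact: c_alpha_ge0.
set mu := ln + K * ln `^ a.
have mul : 0 < mu - ln by rewrite /mu addrC addKr mulr_gt0.
pose d := l1 - mu.
have dE : l1 - ln = d + K * ln `^ a by rewrite /d /mu; ring.
have dK : K * (l1 `^ a + c_alpha a * (l1 - ln) `^ a) <= d.
  rewrite -(lerD2r (K * ln `^ a)) -dE; apply: le_trans hgap.
  by rewrite le_eqVlt; apply/orP; left; apply/eqP; ring.
have d0 : 0 < d.
  apply: lt_le_trans dK; rewrite mulr_gt0// ltr_pwDl//.
  by rewrite mulr_ge0// powR_ge0.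
have dle : d `^ a <= (l1 - ln) `^ a.
  rewrite ge0_ler_powR// ?nnegrE ?(ltW d0)//; rewrite dE.
    by rewrite addr_ge0 ?(ltW d0)// mulr_ge0// ?(ltW K0)// ltW.
  by rewrite lerDl mulr_ge0// ltW.
split.
  split; first by rewrite -subr_gt0.
  move=> i ni; apply: (@le_lt_trans _ _ ln); last by rewrite -subr_gt0.
  exact: eigval_mono.
rewrite /kappa -/ln -/l1 -/d.
have -> : ln `^ a / (mu - ln) = K^-1.
  rewrite /mu (addrC ln) addrK invfM mulrCA mulfV ?mulr1//.
  by rewrite gt_eqF.
have -> : d `^ (a - 1) = d `^ a / d.
  by rewrite powRD ?(gt_eqF d0) ?implybT// powR_inv1// ltW.
have : c_alpha a * (d `^ a / d) + l1 `^ a / d <= K^-1.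
  rewrite mulrA -mulrDl ler_pdivrMr// -(ler_pM2l K0) mulrA mulfV ?gt_eqF// mul1r.
  apply: le_trans dK; rewrite ler_wpM2l ?(ltW K0)// addrC lerD2l ler_wpM2l//.
move=> h; apply: (@le_trans _ _ (L * (K^-1 + K^-1))).
  by rewrite ler_wpM2l ?(ltW L0)// lerD2l.
rewrite /K le_eqVlt; apply/orP; left; apply/eqP; field.
by rewrite !gt_eqF.
Qed.

End data.

(** * The inertial manifold *)

Section inertial_graph_map.
Context {R : realType} {H : hilbertType R} (A : posOperator H) (alpha : {nonneg R}).
Local Notation e := (eigvec A).
Local Notation lam := (eigval A).
Local Notation a := (alpha%:num).
Local Notation X := (fracSpace A alpha).
Local Notation Omega := (wienerSpace H).
Local Notation shift := Defs.shift.
Local Notation leb := (@lebesgue_measure R).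
Local Notation mR := (measurableTypeR R).
Local Notation L1 D f := (leb.-integrable (D : set mR) (EFin \o f)).
Hypothesis hsep : separable H.
Hypothesis a1 : a < 1.
Variables (F : X -> H) (L : R).
Hypothesis L0 : 0 < L.
Hypothesis F0 : F 0 = 0.
Hypothesis FL : forall u v, `|F u - F v| <= L * `|u - v|.
Variables (n : nat) (mu : R).
Hypothesis gap : spectral_gap A n mu.
Hypothesis hq : L * kappa A n mu a < 1.
Hypothesis mu0 : 0 < mu.
Variable z : Omega -> X.
Hypothesis hzreg : regular_version z.
Hypothesis mz : measurable_fun [set: Omega] (z : Omega -> borel X).
Variables (g : R -> X) (T : R).
Hypothesis fg : forcing g.
Hypothesis T0 : 0 < T.
Hypothesis gT : forall t, g (t + T) = g t.

Lemma exp_weight_L1 (d : R) : 0 < d -> L1 `]-oo, (0 : R)] (fun s : R => expR (d * s)).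
Proof.
move=> d0; have [i1 _] := expR_integral d0.
have m1 : measurable (`](0 : R), +oo[%classic : set mR) by exact: measurable_itv.
have m2 : measurable (`]-oo, (0 : R)]%classic : set mR) by exact: measurable_itv.
have i2 := (L1_restrict _ m1).1 i1.
(* Reflecting about 1 - s rather than -s puts the closed half-line strictly inside the open one; the
   factor [expR d] compensates. *)
have i3 := L1_reflect 1 (fun s => _) i2.
have p0 (s : mR) : 0 <= (if s \in `](0 : R), +oo[%classic then expR (- (d * s)) else 0).
  by case: ifP => _ //; exact: expR_ge0.
have i4 := L1_sub measurableT m2 (@subsetT _ _) (i3 p0).
apply: L1_eq (L1Z (expR d) m2 i4) => // s; rewrite /= in_itv/= => s0.
rewrite mem_setE in_itv/= andbT subr_gt0 (le_lt_trans s0)// -expRD.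
by congr expR; ring.
Qed.

Section trajectory.
Variables (zeta h : R -> X).
Hypothesis zeta_cts : continuous zeta.
Hypothesis zeta_bd : exists C, forall s, s <= 0 -> `|zeta s| <= C * expR (- mu * s).
Hypothesis fh : forcing h.
Hypothesis hw : L1 `]-oo, (0 : R)] (fun s : R => expR (mu * s) * `|h s|).

(** The nonlinear term grows at most like exp(-mu s) and lam_(n+1) > mu makes it integrable; for the
    forcing, the new weight is smaller than exp(mu s) at negative times. *)
Lemma rhs_weighted xi : Sspace mu xi ->
  (forall i, measurable_fun `]-oo, (0 : R)] (fun s => dot (rhs F zeta h xi s) (e i))) /\
  L1 `]-oo, (0 : R)] (fun s : R => expR (lam n * s) * `|rhs F zeta h xi s|).
Proof.
move=> S; have m0 : measurable (`]-oo, (0 : R)]%classic : set mR) by exact: measurable_itv.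
have mF := F_meas hsep FL zeta_cts m0 (Sspace_meas S).
have mr i : measurable_fun `]-oo, (0 : R)] (fun s => dot (rhs F zeta h xi s) (e i)).
  rewrite (_ : (fun s => _) = fun s => dot (F (xi s + zeta s)) (e i) + dot (h s) (e i)).
    2: by apply/funext => s; rewrite /rhs dotDl.
  apply: measurable_funD; first exact: mF.
  by apply: measurable_funTS; exact: fh.1.
split => //; have [C hC] := Sspace_growth S.
have [D D0 hD] := phiN_bound L0 F0 FL zeta_bd hC.
have d0 : 0 < lam n - mu by rewrite subr_gt0 gap.1.
apply: (@L1_le _ _ _ (fun s => D * expR ((lam n - mu) * s) +
    (lam 0%N `^ a)^-1 * (expR (mu * s) * `|h s|))) => //.
- apply: measurable_funM; first by apply: measurable_funTS; exact: measurable_expRM.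
  exact: (measurable_norm mr).
- move=> s; rewrite /= in_itv/= => s0; rewrite normrM normr_id ger0_norm ?expR_ge0//.
  have el : expR (lam n * s) = expR ((lam n - mu) * s) * expR (mu * s).
    by rewrite -expRD; congr expR; ring.
  have e1 : expR ((lam n - mu) * s) <= 1 by rewrite -expR0 ler_expR mulr_ge0_le0// ltW.
  apply: (@le_trans _ _ (expR (lam n * s) * (`|F (xi s + zeta s)| + `|fracval (h s)|))).
    by rewrite ler_wpM2l ?expR_ge0//; exact: ler_normD.
  rewrite mulrDr; apply: lerD.
    have := hD s; rewrite /phiN /cut0 s0 => hs.
    apply: (le_trans (ler_wpM2l (expR_ge0 _) hs)); rewrite mulrCA -expRD.
    by rewrite le_eqVlt; apply/orP; left; apply/eqP; congr (_ * expR _); ring.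
  rewrite el -mulrA; apply: (le_trans (ler_piMl _ e1)); first by rewrite mulr_ge0 ?expR_ge0.
  by rewrite mulrCA ler_wpM2l ?expR_ge0//; exact: frac_norm_le.
- by apply: L1D => //; apply: L1Z => //; exact: exp_weight_L1.
Qed.

End trajectory.

Let zb w : exists C, forall s, s <= 0 -> `|ztraj z w s| <= C * expR (- mu * s).
Proof. exact: ztraj_growth. Qed.

Let fgt tau : forcing (shift tau g).
Proof. exact: shift_forcing. Qed.

Let hwt tau : L1 `]-oo, (0 : R)] (fun s : R => expR (mu * s) * `|shift tau g s|).
Proof.
apply: (periodic_weighted mu0 T0 (fgt tau)) => s.
by rewrite /Defs.shift addrAC gT.
Qed.

Let zc w := ztraj_cts hzreg (w := w).

Lemma ztraj_meas : pmeas A (fun p : Omega * R => ztraj z p.1 p.2).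
Proof.
move=> i; apply: (measurable_caratheodory (f := fun w s => dot (ztraj z w s) (e i))).
  move=> s; have mzi := (borel_fraccoefP z hsep measurableT).1 mz i.
  exact: (measurableT_comp mzi (measurable_theta s)).
move=> w s; apply: (@continuous_comp R X R (ztraj z w) (fun x : X => dot x (e i))).
  exact: zc.
exact: dot_frac_continuous.
Qed.

Lemma xistarP tau w x xi : PnH A alpha n x ->
  xistar_spec F z g n mu x w tau xi <->
  Sspace mu xi /\ LP F n (ztraj z w) (shift tau g) x xi.
Proof.
move=> /PnHP xP; have xP' : projP A n x = x by exact: (congr1 (@fracval _ _ _ _) xP).
split=> -[S hx]; split => //.
  move=> t t0 i; have [mr ir] := rhs_weighted (@zc w) (zb w) (fgt tau) (hwt tau) S.
  exact: ((lyapunov_perron_coef hsep (xi t) t0 xP' mr ir).1 (hx t t0) i).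
move=> t t0; have [mr ir] := rhs_weighted (@zc w) (zb w) (fgt tau) (hwt tau) S.
exact: ((lyapunov_perron_coef hsep (xi t) t0 xP' mr ir).2 (hx t t0)).
Qed.

Lemma LP_random tau (x : Omega -> X) :
  (forall i, measurable_fun setT (fun w => dot (x w) (e i))) ->
  exists2 xi : Omega * R -> X, pmeas A xi &
    forall w, Sspace mu (fun s => xi (w, s)) /\
      LP F n (ztraj z w) (shift tau g) (x w) (fun s => xi (w, s)).
Proof.
move=> mx; exact: (LP_exists hsep a1 L0 F0 FL gap hq (fun w => @zc w) zb ztraj_meas
  (fgt tau) (hwt tau) mx).
Qed.

Lemma LP_some tau w x : exists2 xi : R -> X, Sspace mu xi &
  LP F n (ztraj z w) (shift tau g) x xi.
Proof.
have mx i : measurable_fun [set: Omega] (fun _ => dot x (e i)) by exact: measurable_cst.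
have [xi _ hxi] := LP_random tau mx.
by have [S l] := hxi w; exists (fun s => xi (w, s)).
Qed.

(** Frees [mmap] from the choice inside [xistar]: uniqueness allows any solution to be used, in
    particular one depending measurably on the noise. *)
Lemma mmapE tau w x xi : PnH A alpha n x -> Sspace mu xi ->
  LP F n (ztraj z w) (shift tau g) x xi -> mmap F z g n mu tau w x = fracQ n (xi 0).
Proof.
move=> xP S l; have [S' l'] : Sspace mu (xistar F z g n mu x w tau) /\
    LP F n (ztraj z w) (shift tau g) x (xistar F z g n mu x w tau).
  apply/xistarP => //; apply: (@xgetPex _ (fun=> 0)).
  by exists xi; apply/xistarP.
rewrite /mmap; congr (fracQ n _).
exact: (LP_unique hsep a1 L0 F0 FL gap hq (@zc w) (zb w) (fgt tau) (hwt tau) S' S l' l (lexx 0)).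
Qed.

Lemma LP_graph tau w x xi : PnH A alpha n x -> Sspace mu xi ->
  LP F n (ztraj z w) (shift tau g) x xi -> xi 0 = x + mmap F z g n mu tau w x.
Proof.
move=> xP S l; rewrite (mmapE xP S l) -[LHS](fracPQ n); congr (_ + _).
apply: frac_eq => i; rewrite fracP_coef -[in RHS](PnHP n x).1// fracP_coef.
by case: ifP => // ni; exact: LP_low l ni.
Qed.

Lemma Mset_graph tau w : Mset F z g mu tau w =
  [set x + mmap F z g n mu tau w x | x in PnH A alpha n].
Proof.
rewrite (MsetP hsep a1 L0 F0 FL hzreg mu fg).
apply/seteqP; split => [_ [xi exi <-]|_ [x xP <-]].
  have l := entire_LP hsep a1 L0 F0 FL gap (@zc w) (zb w) (fgt tau) (hwt tau) exi.
  have xP : PnH A alpha n (fracP n (xi 0)) by exists (xi 0).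
  by exists (fracP n (xi 0)) => //; rewrite -(LP_graph xP exi.1 l).
have [xi S l] := LP_some tau w x; exists xi; last exact: LP_graph.
exact: (LP_entire hsep a1 L0 F0 FL gap (@zc w) (zb w) (fgt tau) (hwt tau) S l).
Qed.

Lemma mmap_lipschitz tau w x y : PnH A alpha n x -> PnH A alpha n y ->
  `|mmap F z g n mu tau w x - mmap F z g n mu tau w y| <=
  (1 - L * kappa A n mu a)^-1 * `|x - y|.
Proof.
move=> xP yP; have [xi S l] := LP_some tau w x; have [xi' S' l'] := LP_some tau w y.
rewrite (mmapE xP S l) (mmapE yP S' l') -fracQB (le_trans (fracQ_norm _ _))// mulrC.
have := LP_lipschitz hsep a1 L0 F0 FL gap hq (@zc w) (zb w) (fgt tau) (hwt tau) S S' l l' (lexx 0).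
by rewrite mulr0 expR0 mulr1.
Qed.

(** Stated for a random base point, because [inertial_map] evaluates m at x minus the low part of
    z(w). *)
Lemma mmap_meas tau (x : Omega -> X) : (forall w, PnH A alpha n (x w)) ->
  (forall i, measurable_fun setT (fun w => dot (x w) (e i))) ->
  forall i, measurable_fun setT (fun w => dot (mmap F z g n mu tau w (x w)) (e i)).
Proof.
move=> xP mx i; have [xi mxi hxi] := LP_random tau mx.
rewrite (_ : (fun w => _) = fun w => if (i < n)%N then 0 else dot (xi (w, 0)) (e i)).
  case: (i < n)%N; first exact: measurable_cst.
  exact: (measurable_fun_pair1 (f := fun p => dot (xi p) (e i)) (0 : R) (mxi i)).
apply/funext => w; have [S l] := hxi w.
by rewrite (mmapE (xP w) S l) fracQ_coef.
Qed.

Lemma mmap_periodic tau w x : PnH A alpha n x ->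
  mmap F z g n mu (tau + T) w x = mmap F z g n mu tau w x.
Proof.
move=> xP; have [xi S l] := LP_some tau w x; rewrite (mmapE xP S l).
have E : shift (tau + T) g = shift tau g.
  by apply/funext => s; rewrite /Defs.shift addrA gT.
by apply: mmapE => //; rewrite E.
Qed.

End inertial_graph_map.

(** * The splitting of D(A^alpha) into low and high modes *)

Section spaces.
Context {R : realType} {H : hilbertType R} (A : posOperator H) (alpha : {nonneg R}).
Local Notation e := (eigvec A).
Local Notation X := (fracSpace A alpha).
Variable n : nat.

Lemma fracP_fracQ (x : X) : fracP n (fracQ n x) = 0.
Proof.
apply: frac_eq => i; rewrite fracP_coef fracQ_coef coef0.
by case: (i < n)%N.
Qed.

Lemma fracPD (x y : X) : fracP n (x + y) = fracP n x + fracP n y.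
Proof. by apply: frac_eq => j; rewrite coefD !fracP_coef coefD; case: (j < n)%N; rewrite ?addr0. Qed.

Lemma PnH_fracP (x : X) : PnH A alpha n (fracP n x).
Proof. by exists x. Qed.

Lemma PnH0 : PnH A alpha n 0.
Proof. by apply/PnHP; apply: frac_eq => j; rewrite fracP_coef coef0 if_same. Qed.

Lemma PnH_D (x y : X) : PnH A alpha n x -> PnH A alpha n y -> PnH A alpha n (x + y).
Proof. by move=> /PnHP xP /PnHP yP; apply/PnHP; rewrite fracPD xP yP. Qed.

Lemma PnH_B (x y : X) : PnH A alpha n x -> PnH A alpha n y -> PnH A alpha n (x - y).
Proof. by move=> /PnHP xP /PnHP yP; apply/PnHP; rewrite fracPB xP yP. Qed.

Lemma fracP_continuous : continuous (fracP n : X -> X).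
Proof.
apply: (@lipschitz_continuous _ X X _ 1) => u v.
by rewrite -fracPB mul1r fracP_norm.
Qed.

Lemma PnH_finite_dim : finite_dim_subspace (PnH A alpha n).
Proof.
pose b (i : 'I_n) : X := FracSpace (projP_subproof A alpha n (e i)).
have coefb (c : 'I_n -> R) j : dot (\sum_i c i *: b i : X) (e j) =
    \sum_i c i * (if (j < n)%N then (nat_of_ord i == j)%:R else 0).
  have -> : dot (\sum_i c i *: b i : X) (e j) = \sum_i dot (c i *: b i : X) (e j).
    exact: (big_morph (fun x : X => dot x (e j)) (fun x y => coefD x y j) (@coef0 _ _ A alpha j)).
  by apply: eq_bigr => i _; rewrite fracvalZ dotZl /= projP_coef eigvec_ortho.
exists n, b; apply/seteqP; split=> x /=.
  move=> /PnHP xP; exists (fun i => dot x (e i)); apply: frac_eq => j.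
  rewrite coefb -[in LHS]xP fracP_coef; case: ifPn => jn; last first.
    by rewrite big1// => i _; rewrite mulr0.
  rewrite (bigD1 (Ordinal jn))//= eqxx mulr1 big1 ?addr0// => i ij.
  suff /negbTE -> : nat_of_ord i != j by rewrite mulr0.
  by apply: contra ij => /eqP ij; apply/eqP/val_inj.
move=> [c ->]; apply/PnHP; apply: frac_eq => j; rewrite fracP_coef coefb.
by case: (j < n)%N => //; symmetry; apply: big1 => i _; rewrite mulr0.
Qed.

Lemma kerP_closed : closed_subspace [set x : X | fracP n x = 0].
Proof.
split => /=.
- have -> : [set x : X | fracP n x = 0] = (fun x => `|fracP n x|) @^-1` [set r : R | r = 0].
    apply/seteqP; split=> x /=; first by move=> ->; rewrite normr0.
    by move=> /normr0_eq0.
  apply: preimage_closed; last exact: closed_eq.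
  move=> x _; apply: (continuous_comp (f := fracP n : X -> X)); first exact: fracP_continuous.
  exact: norm_continuous.
- exact: ((PnHP n 0).1 PnH0).
- move=> c x y x0 y0.
  have E : fracP n (c *: x + y : X) = c *: fracP n x + fracP n y.
    apply: frac_eq => j; rewrite fracP_coef coefD coefD !fracvalZ !dotZl !fracP_coef.
    by case: (j < n)%N; rewrite ?mulr0 ?addr0.
  by apply: (etrans E); rewrite x0 y0 scaler0 addr0.
Qed.

Lemma PQ_direct : direct_sum (PnH A alpha n) [set x : X | fracP n x = 0].
Proof.
split.
  apply/seteqP; split => [x [/PnHP xP xk]|_ ->] /=; first by rewrite -xP.
  split; first exact: PnH0.
  exact: ((PnHP n 0).1 PnH0).
move=> x; exists (fracP n x), (fracQ n x); split; first exact: PnH_fracP.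
  exact: fracP_fracQ.
by rewrite fracPQ.
Qed.

Lemma PnH_dense_seq : separable H -> exists p : nat -> X, (forall m, PnH A alpha n (p m)) /\
  forall x eps, PnH A alpha n x -> 0 < eps -> exists m, `|x - p m| < eps.
Proof.
move=> /(@frac_separable _ _ A alpha)/separable_dense_seq[u hu].
exists (fun m => fracP n (u m)); split => [m|x eps /PnHP xP eps0]; first exact: PnH_fracP.
have [m hm] := hu x eps eps0; exists m.
by rewrite -xP -fracPB (le_lt_trans (fracP_norm _ _)).
Qed.

End spaces.

(** The infimum lies below [c] exactly when some member of the countable family does, so sublevel
    sets are countable unions of measurable sets. *)
Lemma measurable_inf_dense d (T : measurableType d) (R : realType) (S : T -> set R)
    (f : nat -> T -> R) :
  (forall m, measurable_fun setT (f m)) -> (forall w, S w !=set0) ->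
  (forall w r, S w r -> 0 <= r) -> (forall m w, S w (f m w)) ->
  (forall w r c, S w r -> r < c -> exists m, f m w < c) ->
  measurable_fun setT (fun w => inf (S w)).
Proof.
move=> mf S0 Sge fS fd.
apply: (@measurability _ _ T R setT _ _ (@RGenInftyO.measurableE R)).
move=> _ [_ [c ->] <-]; rewrite setTI.
rewrite (_ : _ @^-1` _ = \bigcup_m (f m @^-1` `]-oo, c[)); last first.
  apply/seteqP; split => w /=; rewrite in_itv/=.
    move=> /(inf_lt (S0 w))[r Sr rc]; have [m hm] := fd w r c Sr rc.
    by exists m => //=; rewrite in_itv/=.
  move=> [m _]; rewrite /= in_itv/= => fc; apply: le_lt_trans fc.
  apply: ge_inf; last exact: fS.
  by exists 0 => r; exact: Sge.
apply: bigcup_measurable => m _; rewrite -[X in measurable X]setTI.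
by apply: mf => //; exact: measurable_itv.
Qed.

Section manifold.
Context {R : realType} {H : hilbertType R} (A : posOperator H) (alpha : {nonneg R}).
Local Notation e := (eigvec A).
Local Notation a := (alpha%:num).
Local Notation X := (fracSpace A alpha).
Local Notation Omega := (wienerSpace H).
Local Notation shift := Defs.shift.
Local Notation leb := (@lebesgue_measure R).
Local Notation mR := (measurableTypeR R).
Local Notation L1 D f := (leb.-integrable (D : set mR) (EFin \o f)).
Hypothesis hsep : separable H.
Hypothesis a1 : a < 1.
Variables (F : X -> H) (L : R).
Hypothesis L0 : 0 < L.
Hypothesis F0 : F 0 = 0.
Hypothesis FL : forall u v, `|F u - F v| <= L * `|u - v|.
Variables (n : nat) (mu : R).
Hypothesis gap : spectral_gap A n mu.
Hypothesis hq : L * kappa A n mu a < 1.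
Hypothesis mu0 : 0 < mu.
Variable z : Omega -> X.
Hypothesis hzreg : regular_version z.
Hypothesis mz : measurable_fun [set: Omega] (z : Omega -> borel X).
Variables (g : R -> X) (T : R).
Hypothesis fg : forcing g.
Hypothesis T0 : 0 < T.
Hypothesis gT : forall t, g (t + T) = g t.

Local Notation m := (mmap F z g n mu).
Local Notation P := (PnH A alpha n).
Let K := (1 - L * kappa A n mu a)^-1.

Let Mtilde tau w := [set x + z w + m tau w x | x in P].

(* [x + z w + m x] is not a graph over [x]: its low part is [x + fracP n (z w)],
   and [inertial_map] is its high part as a function of this low part. *)
Definition inertial_map (tau : R) (w : Omega) (x : X) : X :=
  fracQ n (z w) + m tau w (x - fracP n (z w)).

Let mlip tau w x y : P x -> P y -> `|m tau w x - m tau w y| <= K * `|x - y|.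
Proof. exact: (mmap_lipschitz hsep a1 L0 F0 FL gap hq mu0 hzreg mz fg T0 gT). Qed.

Let K0 : 0 <= K.
Proof. by rewrite invr_ge0 subr_ge0 ltW. Qed.

Let zcoef i : measurable_fun setT (fun w => dot (z w) (e i)).
Proof. exact: ((borel_fraccoefP z hsep measurableT).1 mz i). Qed.

Let mcoef := mmap_meas hsep a1 L0 F0 FL gap hq mu0 hzreg mz fg T0 gT.

Let mQ tau w x : fracP n (m tau w x) = 0.
Proof. exact: fracP_fracQ. Qed.

Lemma MtildeE tau w : Mtilde tau w = [set x + inertial_map tau w x | x in P].
Proof.
apply/seteqP; split => _ [x xP <-].
  exists (x + fracP n (z w)); first by apply: PnH_D => //; exact: PnH_fracP.
  by rewrite /inertial_map addrK addrA -(addrA x) fracPQ.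
exists (x - fracP n (z w)); first by apply: PnH_B => //; exact: PnH_fracP.
set y := x - fracP n (z w).
have -> : y + z w = x + fracQ n (z w) by rewrite /y -addrA; congr (_ + _); rewrite /fracQ addrC.
by rewrite -addrA.
Qed.

Lemma inertial_mapP : inertial_graph Mtilde P [set x : X | fracP n x = 0] inertial_map.
Proof.
split; first by split; [exact: PnH_finite_dim|exact: kerP_closed|exact: PQ_direct].
split.
- by move=> tau w x xP /=; rewrite /inertial_map fracPD fracP_fracQ mQ addr0.
- exact: MtildeE.
- move=> tau x xP; apply/(borel_fraccoefP _ hsep measurableT) => i.
  rewrite /inertial_map; under eq_fun do rewrite coefD fracQ_coef.
  apply: measurable_funD; first by case: (i < n)%N.
  apply: mcoef => [w|j]; first by apply: PnH_B => //; exact: PnH_fracP.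
  under eq_fun do rewrite coefB fracP_coef.
  by apply: measurable_funB => //; case: (j < n)%N.
- move=> tau w; exists K => -[x y] [/= xP yP].
  rewrite /inertial_map opprD addrACA subrr add0r.
  have -> : x - y = (x - fracP n (z w)) - (y - fracP n (z w)).
    by rewrite opprB addrA subrK.
  by apply: mlip; apply: PnH_B => //; exact: PnH_fracP.
Qed.

(** A graph over P_n H is the zero set of Q y - q(P y), continuous because q is Lipschitz. *)
Lemma Mtilde_closed tau w : closed (Mtilde tau w).
Proof.
pose phi (y : X) : X := fracQ n y - inertial_map tau w (fracP n y).
have cphi : continuous phi.
  apply: (@lipschitz_continuous _ X X _ (1 + K)) => u v; rewrite /phi mulrDl mul1r.
  rewrite opprB addrACA [X in _ + X]addrC addrACA addrA -addrA.
  rewrite [X in `|X|](_ : _ = fracQ n (u - v) -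
    (inertial_map tau w (fracP n u) - inertial_map tau w (fracP n v))); last first.
    by rewrite fracQB (opprB (inertial_map tau w (fracP n u))).
  apply: (le_trans (ler_normB _ _)); apply: lerD; first exact: fracQ_norm.
  rewrite /inertial_map opprD addrACA subrr add0r.
  apply: le_trans (mlip _ _ _ _) _; do ?[by apply: PnH_B; exact: PnH_fracP].
  rewrite ler_wpM2l// opprB addrA subrK -fracPB.
  exact: fracP_norm.
have -> : Mtilde tau w = (fun y => `|phi y|) @^-1` [set r : R | r = 0].
  rewrite MtildeE; apply/seteqP; split => [_ [x xP <-]|y] /=.
    have qP : fracP n (inertial_map tau w x) = 0.
      by rewrite /inertial_map fracPD fracP_fracQ mQ addr0.
    rewrite /phi fracPD qP addr0 (PnHP n x).1// /fracQ fracPD qP addr0 (PnHP n x).1//.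
    by rewrite [x + _]addrC addrK subrr normr0.
  move=> /normr0_eq0 /eqP; rewrite subr_eq0 => /eqP E.
  exists (fracP n y); first exact: PnH_fracP.
  by rewrite -E fracPQ.
apply: preimage_closed; last exact: closed_eq.
move=> x _; apply: (continuous_comp (f := phi)); first exact: cphi.
exact: norm_continuous.
Qed.

Lemma Mtilde_random tau : closed_random_set (Mtilde tau).
Proof.
split=> [w|x].
  split; first exact: Mtilde_closed.
  exists (0 + z w + m tau w 0); exists 0 => //; exact: PnH0.
have [p [pP pd]] := PnH_dense_seq A alpha n hsep.
apply: (@measurable_inf_dense _ _ _ _ (fun k w => `|x - (p k + z w + m tau w (p k))|)).
- move=> k; apply: measurable_fracnorm => i.
  under eq_fun do rewrite coefB coefD coefD.
  apply: measurable_funB => //; apply: measurable_funD; first exact: measurable_funD.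
  by apply: mcoef.
- move=> w; exists `|x - (0 + z w + m tau w 0)|; exists (0 + z w + m tau w 0) => //.
  by exists 0 => //; exact: PnH0.
- by move=> w _ [y _ <-].
- by move=> k w; exists (p k + z w + m tau w (p k)) => //; exists (p k).
- move=> w _ c [_ [y yP <-] <-] hc; set r := `|_| in hc.
  have K1 : 0 < 1 + K by rewrite ltr_pwDl.
  have cr : 0 < c - r by rewrite subr_gt0.
  (* The parametrization x + z + m(x) has Lipschitz constant at most 1 + K, so this precision in the
     base point keeps the distance below [c]. *)
  have [k hk] := pd y ((c - r) / (1 + K)) yP (divr_gt0 cr K1).
  rewrite ltr_pdivlMr// in hk.
  exists k; rewrite (le_lt_trans _ (_ : r + `|y - p k| * (1 + K) < c))//; last first.
    by rewrite addrC -ltrBrDr.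
  rewrite -(subrK (x - (y + z w + m tau w y)) (x - _)) addrC.
  apply: (le_trans (ler_normD _ _)); rewrite lerD2l.
  rewrite [X in `|X|](_ : _ = (y - p k) + (m tau w y - m tau w (p k))); last first.
    by apply: frac_eq => i; rewrite !(coefB, coefD); ring.
  apply: (le_trans (ler_normD _ _)); rewrite mulrDr mulr1 lerD2l mulrC.
  exact: mlip.
Qed.

Lemma Mtilde_Mset tau w : Mtilde tau w = [set y + z w | y in Mset F z g mu tau w].
Proof.
rewrite (Mset_graph hsep a1 L0 F0 FL gap hq mu0 hzreg mz fg T0 gT).
apply/seteqP; split => [_ [x xP <-]|_ [_ [x xP <-] <-]].
  by exists (x + m tau w x); [exists x|rewrite addrAC].
by exists x => //; rewrite addrAC.
Qed.

Let PhiE' := PhiE hsep a1 L0 F0 FL hzreg.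

(** Translation by z conjugates [Phi] to the cocycle of the transformed equation, whose invariant
    set is [Mset]. *)
Lemma Mtilde_invariant t tau w : 0 <= t ->
  Phi F z g t tau w @` Mtilde tau w = Mtilde (tau + t) (theta t w).
Proof.
move=> t0; rewrite !Mtilde_Mset.
rewrite -(Mset_invariant hsep a1 L0 F0 FL hzreg (ltW mu0) fg tau w t0).
apply/seteqP; split => [_ [_ [y My <-] <-]|_ [_ [y My <-] <-]].
  exists (vsol F z t 0 w (shift tau g) y); first by exists y.
  by rewrite PhiE'// addrK.
exists (y + z w); first by exists y.
by rewrite PhiE'// addrK.
Qed.

(** The noise terms cancel in the difference of two values of [Phi], leaving two solutions of the
    transformed equation; [tracking] is applied to the one issued from x - z(w), and the rate is
    mu. *)
Lemma Mtilde_attracts tau w x : exists2 y, Mtilde tau w y &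
  exists c1 c2 : R, [/\ 0 < c1, 0 < c2 & forall t, 0 <= t ->
    `|Phi F z g t tau w x - Phi F z g t tau w y| <= c1 * expR (- (c2 * t))].
Proof.
have fgt := shift_forcing tau fg.
have zb := ztraj_growth w hzreg mu0.
have hwt : L1 `]-oo, (0 : R)] (fun s : R => expR (mu * s) * `|shift tau g s|).
  apply: (periodic_weighted mu0 T0 fgt) => s.
  by rewrite /Defs.shift addrAC gT.
have sv := vsolP hsep a1 L0 F0 FL hzreg 0 w (x - z w) fgt.
have [xi [v [C [exi sv' hC]]]] :=
  tracking hsep a1 L0 F0 FL gap hq (ztraj_cts hzreg (w := w)) zb fgt hwt sv.
exists (xi 0 + z w).
  rewrite Mtilde_Mset (MsetP hsep a1 L0 F0 FL hzreg mu fg).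
  by exists (xi 0) => //; exists xi.
(* The added 1 makes the constant strictly positive, as the definition demands. *)
exists (`|C| + 1), mu; split => // t t0; rewrite !PhiE'// addrK opprD addrACA subrr addr0.
have [v0 cv ov] := sv'.
have -> : vsol F z t 0 w (shift tau g) (xi 0) = v t.
  apply: (vsol_unique hsep a1 L0 F0 FL hzreg fgt t0 (within_ocy (lexx _) cv) v0).
    by move=> s /andP[s0 _]; exact: ov.
  by rewrite t0 lexx.
rewrite -mulNr (le_trans (hC t t0))// ler_wpM2r ?expR_ge0//.
by rewrite (le_trans (ler_norm _))// lerDl.
Qed.

Lemma Mtilde_inertial_manifold : random_inertial_manifold theta (Phi F z g) Mtilde.
Proof.
split; [exact: Mtilde_random| | |exact: Mtilde_attracts].
- by do 3 eexists; exact: inertial_mapP.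
- by move=> t tau w; exact: Mtilde_invariant.
Qed.

Lemma Mtilde_periodic : pathwise_periodic Mtilde T.
Proof.
do 3 eexists; split; first exact: inertial_mapP.
move=> tau w x xP; have xP' := PnH_B xP (PnH_fracP n (z w)).
exact: (congr1 (+%R (fracQ n (z w)))
  (mmap_periodic hsep a1 L0 F0 FL gap hq mu0 hzreg mz fg T0 gT tau w xP')).
Qed.

End manifold.

Theorem theorem4p2 (R : realType) (H : hilbertType R) (hsep : separable H)
  (A : posOperator H) (alpha : {nonneg R}) (halpha : alpha%:num < 1 / 2)
  (P : probability (wienerSpace H) R) (Q : {linear H -> H})
  (hQ : trace_class_covariance A Q) (hP : wiener_measure P Q)
  (z : wienerSpace H -> fracSpace A alpha)
  (hz : stationary_OU P z) (hzreg : regular_version z)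
  (F : fracSpace A alpha -> H) (L : R) (hL : 0 < L) (hF0 : F 0 = 0)
  (hF : forall u1 u2 : fracSpace A alpha,
     `|F u1 - F u2| <= L * `|fracpow A alpha%:num (u1 - u2)|)
  (n : nat) (hn : (0 < n)%N) (k : R) (hk0 : 0 < k) (hk : k < 1 / 2)
  (* lambda_n is eigval A n.-1 and lambda_(n+1) is eigval A n *)
  (hgap : 2 * L / k * (eigval A n `^ alpha%:num + eigval A n.-1 `^ alpha%:num +
      c_alpha alpha%:num * (eigval A n - eigval A n.-1) `^ alpha%:num) <=
    eigval A n - eigval A n.-1)
  (g : R -> fracSpace A alpha) (hg : L2loc g) (T : R) (hT : 0 < T)
  (hgT : forall t, g (t + T) = g t) :
  let mu := eigval A n.-1 + 2 * L / k * eigval A n.-1 `^ alpha%:num in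
  let Mtilde tau w :=
    [set x + z w + mmap F z g n mu tau w x | x in PnH A alpha n] in
  [/\ random_inertial_manifold theta (Phi F z g) Mtilde,
      pathwise_periodic Mtilde T &
      forall tau w, Mtilde tau w = [set y + z w | y in Mset F z g mu tau w]].
Proof.
move=> mu.
have a1 : alpha%:num < 1 by rewrite (lt_trans halpha)// ltr_pdivrMr// mul1r ltr1n.
have [gap kle] := gap_condition hL hk0 hn hgap.
have hq : L * kappa A n mu alpha%:num < 1.
  by rewrite (le_lt_trans kle)// (lt_trans hk)// ltr_pdivrMr// mul1r ltr1n.
have mu0 : 0 < mu.
  rewrite /mu ltr_pwDl ?eigval_pos// mulr_ge0 ?powR_ge0// divr_ge0 ?(ltW hk0)//.
  by rewrite mulr_ge0// ltW.
have fg := L2loc_forcing hsep hg.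
split.
- exact: (Mtilde_inertial_manifold hsep a1 hL hF0 hF gap hq mu0 hzreg hz.1 fg hT hgT).
- exact: (Mtilde_periodic hsep a1 hL hF0 hF gap hq mu0 hzreg hz.1 fg hT hgT).
- exact: (Mtilde_Mset hsep a1 hL hF0 hF gap hq mu0 hzreg hz.1 fg hT hgT).
Qed.
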